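(* There is a left adjoint to the underlying $B_\infty$ algebra functor $d\mathcal{A}s^{1,1}\text{-alg}\to B_\infty\text{-alg}$ defined by $$T^c\colon B_\infty\text{-alg}\longrightarrow d\mathcal{A}s^{1,1}\text{-alg},$$ sending a $B_\infty$ algebra $A$ to $(T^c(A),\partial,\bullet,\odot)$, where $\partial$ and $\bullet$ are the differential and the multiplication on $T^c(A)$ that constitute the $B_\infty$ structure on $A$, and $\odot$ is concatenation of tensors. This functor is isomorphic to the universal enveloping algebra functor $U$.
   Context: Conventions. Vector spaces are $\mathbb Z$-graded over a field $\mathbb K$; maps have degree $0$ unless stated otherwise; the Koszul sign rule is used: $(f\otimes g)(a\otimes b)=(-1)^{|g||a|}f(a)\otimes g(b)$ and the symmetry is $a\otimes b\mapsto(-1)^{|a||b|}b\otimes a$. Tensor coalgebra. $T^c(X)=\bigoplus_{k\ge0}X^{\otimes k}$ with deconcatenation $\Delta(x_1\cdots x_k)=\sum_{i=0}^k x_1\cdots x_i\otimes x_{i+1}\cdots x_k$, counit the projection to $X^{\otimes0}=\mathbb K$, and unit $1=1_{\mathbb K}$; $\overline T^c(X)=\bigoplus_{k\ge1}X^{\otimes k}$; $p_1\colon T^c(X)\to X$ is the projection. $B_\infty$ algebra (in the shifted convention). A $B_\infty$ structure on $X$ is a pair $(\mu,d)$ where $\mu\colon T^c(X)\otimes T^c(X)\to T^c(X)$ is a coalgebra map of degree $0$ that is associative with unit $1$, and $d\colon T^c(X)\to T^c(X)$ is a coderivation ($\Delta d=(d\otimes\mathrm{id}+\mathrm{id}\otimes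 d)\Delta$) of degree $-1$ with $d(1)=0$, $d^2=0$ and $d\mu=\mu(d\otimes\mathrm{id}+\mathrm{id}\otimes d)$. Its structure maps are $m_n=p_1d|_{X^{\otimes n}}\colon X^{\otimes n}\to X$ ($n\ge1$) and $m_{i,j}=p_1\mu|_{X^{\otimes i}\otimes X^{\otimes j}}\colon X^{\otimes i}\otimes X^{\otimes j}\to X$ ($i,j\ge1$); these determine $(\mu,d)$. Homomorphisms are degree $0$ linear maps commuting with all structure maps. This gives the category $B_\infty\text{-alg}$. 2-associative differential algebra. This is a (unital associative) differential graded algebra $(V,\bullet,1,\partial)$, with $\partial$ of degree $-1$, together with a second associative operation $\odot$ with the same unit $1$ and no further compatibility. With their homomorphisms (degree $0$ linear maps preserving $\bullet,\odot,1,\partial$) they form the category $d\mathcal{A}s^{1,1}\text{-alg}$. Underlying $B_\infty$ algebra functor. For such $V$, let $\tau_1^{\odot}\colon\overline T^c(V)\to V$ be $v_1\otimes\cdots\otimes v_n\mapsto v_1\odot\cdots\odot v_n$ on $V^{\otimes n}$. The underlying $B_\infty$ structure on $V$ is the unique $B_\infty$ structure $(\mu_\bullet^\odot,d_\partial^\odot)$ on $V$ with $\tau_1^\odot\mu_\bullet^\odot=\bullet(\tau_1^\odot\otimes\tau_1^\odot)$ on $\overline T^c(V)\otimes\overline T^c(V)$ and $\tau_1^\odot d_\partial^\odot=\partial\tau_1^\odot$ on $\overline T^c(V)$. A homomorphism of 2-associative differential algebras is also a homomorphism of the underlying $B_\infty$ algebras, so this is a functor (identity on underlying linear maps). The functor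 $T^c$ acts on homomorphisms by $T^c(f)=\bigoplus_kf^{\otimes k}$, and the common unit of $(T^c(A),\partial,\bullet,\odot)$ is $1_{\mathbb K}$. Universal enveloping algebra. For a $B_\infty$ algebra $A$ with structure maps $\overline m_{i,j},\overline m_n$, let $F(A)$ be the free 2-associative differential algebra on the graded vector space $A$, with universal linear map $\alpha\colon A\to F(A)$, and let $m_{i,j},m_n$ be the structure maps of the underlying $B_\infty$ algebra of $F(A)$. Let $I\subseteq F(A)$ be the two-sided ideal (i.e. kernel-type ideal of 2-associative differential algebras: closed under $\partial$ and under left and right multiplication by elements of $F(A)$ for both $\bullet$ and $\odot$) generated by all elements $\alpha(\overline m_{i,j}(a\otimes b))-m_{i,j}(\alpha^{\otimes(i+j)}(a\otimes b))$ with $a\in A^{\otimes i},b\in A^{\otimes j}$, $i,j\ge1$, and $\alpha(\overline m_n(c))-m_n(\alpha^{\otimes n}(c))$ with $c\in A^{\otimes n}$, $n\ge1$. Then $U(A)=F(A)/I$; the universal property of the quotient makes $U$ a functor $B_\infty\text{-alg}\to d\mathcal{A}s^{1,1}\text{-alg}$ . *)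

(* Defs.v *)
From HB Require Import structures.
From mathcomp Require Import all_boot all_order all_algebra.
From mathcomp Require Import boolp classical_sets functions cardinality fsbigop.
From mathcomp Require Import ring_quotient.
From mathcomp.multinomials Require Import freeg.

Set Implicit Arguments.
Unset Strict Implicit.
Unset Printing Implicit Defensive.

Import Order.TTheory GRing.Theory Num.Theory.

Local Open Scope classical_set_scope.
Local Open Scope ring_scope.
Local Open Scope quotient_scope.

#[local] Obligation Tactic := idtac.

Record category := Category {
  obj :> Type;
  hom : obj -> obj -> Type;
  idm : forall a, hom a a;
  comp : forall a b c, hom b c -> hom a b -> hom a c;
  comp1m : forall a b (f : hom a b), comp (idm b) f = f;
  compm1 : forall a b (f : hom a b), comp f (idm a) = f;
  compA : forall a b c d (h : hom c d) (g : hom b c) (f : hom a b),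
    comp h (comp g f) = comp (comp h g) f }.

Arguments idm {c0}.
Arguments comp {c0 a b c}.

(* A functor with prescribed object map F. *)
Record functor (C D : category) (F : C -> D) := Functor {
  fmap :> forall a b : C, hom a b -> hom (F a) (F b);
  fmap_id : forall a, fmap (idm a) = idm (F a);
  fmap_comp : forall a b c (g : hom b c) (f : hom a b),
    fmap (comp g f) = comp (fmap g) (fmap f) }.

Arguments fmap {C D F} _ {a b}.

Definition left_adjoint (C D : category) (L : C -> D) (fL : functor L)
    (R : D -> C) (fR : functor R) : Prop :=
  exists phi : forall (a : C) (b : D), hom (L a) b -> hom a (R b),
    (forall a b, bijective (@phi a b)) /\
    (forall a a' b b' (f : hom a' a) (h : hom (L a) b) (g : hom b b'),
       phi a' b' (comp g (comp h (fmap fL f))) =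
       comp (fmap fR g) (comp (phi a b h) f)).

Definition naturally_isomorphic (C D : category) (F : C -> D) (fF : functor F)
    (G : C -> D) (fG : functor G) : Prop :=
  exists eta : forall a : C, hom (F a) (G a),
    (forall a, exists eta' : hom (G a) (F a),
       comp eta' (eta a) = idm (F a) /\ comp (eta a) eta' = idm (G a)) /\
    (forall a b (f : hom a b),
       comp (eta b) (fmap fF f) = comp (fmap fG f) (eta a)).

Section Span.
Variables (K : fieldType) (V : lmodType K).

Definition span (S : V -> Prop) : {pred V} := fun x =>
  `[< forall P : {pred V}, submod_closed P ->
        (forall y, S y -> y \in P) -> x \in P >].

Lemma spanP (S : V -> Prop) x :
  reflect (forall P : {pred V}, submod_closed P ->
             (forall y, S y -> y \in P) -> x \in P) (x \in span S).
Proof. exact: asboolP. Qed.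

Lemma span_submod_closed S : submod_closed (span S).
Proof.
split; first by apply/spanP => P [].
move=> a x y /spanP Sx /spanP Sy; apply/spanP => P Pcl SP.
by case: (Pcl) => _; apply; [exact: Sx|exact: Sy].
Qed.

HB.instance Definition _ S :=
  GRing.isSubmodClosed.Build K V (span S) (span_submod_closed S).
HB.instance Definition _ S := GRing.isOppClosed.Build V (span S)
  (GRing.zmod_closedN (GRing.submod_closedB (span_submod_closed S))).

Lemma mem_span (S : V -> Prop) x : S x -> x \in span S.
Proof. by move=> Sx; apply/spanP => P _; exact. Qed.

End Span.

Section QuotientModule.
Variables (K : fieldType) (V : lmodType K) (S : V -> Prop).

Local Notation I := (span S).

(* The quotient of V by the subspace spanned by S. *)
Definition quotmod := Quotient.quot I.
HB.instance Definition _ := GRing.Zmodule.on quotmod.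

Definition qpi (x : V) : quotmod := \pi x.
Definition qrepr (q : quotmod) : V := repr q.

Lemma qpiE x y : (qpi x = qpi y) <-> (x - y \in I).
Proof.
rewrite /qpi Quotient.idealrBE; split => [->//|/eqP//].
Qed.

Lemma qreprK q : qpi (qrepr q) = q. Proof. exact: reprK. Qed.

Lemma qpi_repr x : x - qrepr (qpi x) \in I.
Proof. by apply/qpiE; rewrite qreprK. Qed.

Lemma qpiD x y : qpi (x + y) = qpi x + qpi y.
Proof. by rewrite /qpi [LHS]raddfD. Qed.

Definition qscale (a : K) (q : quotmod) : quotmod := qpi (a *: qrepr q).

Lemma qpiZ a x : qpi (a *: x) = qscale a (qpi x).
Proof. by apply/qpiE; rewrite -scalerBr rpredZ// qpi_repr. Qed.

Fact qscaleA a b q : qscale a (qscale b q) = qscale (a * b) q.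
Proof. by rewrite -(qreprK q) -!qpiZ scalerA. Qed.
Fact qscale1 : left_id 1 qscale.
Proof. by move=> q; rewrite -(qreprK q) -!qpiZ scale1r. Qed.
Fact qscaleDr : right_distributive qscale +%R.
Proof.
by move=> a q r; rewrite -(qreprK q) -(qreprK r) -qpiD -!qpiZ -qpiD scalerDr.
Qed.
Fact qscaleDl q : {morph qscale^~ q : a b / a + b}.
Proof. by move=> a b; rewrite -(qreprK q) -!qpiZ -qpiD scalerDl. Qed.

HB.instance Definition _ := GRing.Zmodule_isLmodule.Build K quotmod
  qscaleA qscale1 qscaleDr qscaleDl.

Lemma qpi_linear : linear qpi.
Proof. by move=> a x y; rewrite qpiD qpiZ. Qed.

HB.instance Definition _ := GRing.isLinear.Build K V quotmod _ qpi qpi_linear.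

Lemma qlift_respect (T : Type) (f : V -> T) x :
  (forall x y, x - y \in I -> f x = f y) -> f (qrepr (qpi x)) = f x.
Proof. by move=> fI; apply: fI; apply/qpiE; rewrite qreprK. Qed.

End QuotientModule.

Section Presented.
Variables (K : fieldType) (G : choiceType) (rel : {freeg G / K} -> Prop).

Definition pres : lmodType K := quotmod rel.

Definition pgen (g : G) : pres := qpi rel << g >>.

(* The linear map pgen g |-> f g, provided that f respects the relations. *)
Definition plift (W : lmodType K) (f : G -> W) (q : pres) : W :=
  fglift f (qrepr q).

Definition prespects (W : lmodType K) (f : G -> W) :=
  forall r, rel r -> fglift f r = 0.

HB.instance Definition _ (W : lmodType K) (f : G -> W) :=
  GRing.isZmodMorphism.Build {freeg G / K} W (fglift f)
    (@lift_is_additive K G W f).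

Lemma fglift_linear (W : lmodType K) (f : G -> W) : linear (fglift f).
Proof.
move=> a x y; rewrite raddfD/=; congr (_ + _).
have fE z : fglift f z = \sum_(k <- dom z) coeff k z *: f k.
  rewrite -{1}(freeg_sumE z) raddf_sum; apply: eq_bigr => k _.
  by rewrite [LHS]liftU.
have [->|a0] := eqVneq a 0; first by rewrite !scale0r raddf0.
rewrite !fE scaler_sumr.
have -> : \sum_(k <- dom (a *: x)) coeff k (a *: x) *: f k =
          \sum_(k <- dom x) coeff k (a *: x) *: f k.
  by apply: perm_big; apply: uniq_perm; rewrite ?uniq_dom//; exact: domZ.
by apply: eq_bigr => k _; rewrite coeffZ scalerA.
Qed.

Lemma freeg_span_ind (P : {pred {freeg G / K}}) :
  submod_closed P -> (forall g, << g >> \in P) -> forall x, x \in P.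
Proof.
move=> [P0 Pl] Pg x; rewrite -(freeg_sumE x).
elim: (dom x) => [|k s IH]; rewrite ?big_nil// big_cons.
have -> : << coeff k x *g k >> = coeff k x *: << k >>.
  by apply/eqP/freeg_eqP => z; rewrite coeffZ !coeffU mul1r.
exact: Pl.
Qed.

Section Lift.
Variables (W : lmodType K) (f : G -> W).
Hypothesis fR : prespects f.

Lemma plift_qpi x : plift f (qpi _ x) = fglift f x.
Proof.
rewrite /plift; apply: (@qlift_respect _ _ _ _ (fglift f)) => {}x y xy.
apply/eqP; rewrite -subr_eq0 -raddfB/=.
suff : x - y \in (fun z => fglift f z == 0) by [].
move: xy => /spanP; apply; last by move=> r /fR fr; apply/eqP.
split; first by rewrite unfold_in raddf0.
move=> a u v; rewrite !unfold_in => /eqP fu /eqP fv.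
by rewrite fglift_linear fu fv scaler0 addr0.
Qed.

Lemma pliftE g : plift f (pgen g) = f g.
Proof. by rewrite plift_qpi [LHS]liftU scale1r. Qed.

Lemma plift_linear : linear (plift f).
Proof.
move=> a x y; rewrite -(qreprK x) -(qreprK y) -linearP.
by rewrite !plift_qpi fglift_linear.
Qed.

End Lift.

Lemma pres_ind (P : {pred pres}) :
  submod_closed P -> (forall g, pgen g \in P) -> forall x, x \in P.
Proof.
move=> [P0 Pl] Pg x; rewrite -(qreprK x).
suff : qrepr x \in (fun y => qpi rel y \in P) by [].
apply: freeg_span_ind => //; split; first by rewrite unfold_in linear0.
by move=> a u v; rewrite !unfold_in => Pu Pv; rewrite linearP; exact: Pl.
Qed.

Lemma linear_eq0_submod (U W : lmodType K) (f g : U -> W) :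
  linear f -> linear g -> submod_closed (fun x => f x == g x).
Proof.
move=> fl gl; have l0 h : linear h -> h (0 : U) = 0 :> W.
  by move=> hl; have := hl (-1) 0 0; rewrite scaler0 addr0 scaleN1r addNr.
split=> [|a x y]; rewrite !unfold_in ?l0// => /eqP fx /eqP fy.
by rewrite fl gl fx fy.
Qed.

Lemma pres_ext (W : lmodType K) (f g : pres -> W) :
  linear f -> linear g -> (forall x, f (pgen x) = g (pgen x)) ->
  forall x, f x = g x.
Proof.
move=> fl gl fg x; apply/eqP.
by apply: (pres_ind (linear_eq0_submod fl gl)) => y; apply/eqP/fg.
Qed.

End Presented.

Section Tensor.
Variables (K : fieldType).

Definition bilin (U V W : lmodType K) (f : U -> V -> W) :=
  (forall v, linear (f ^~ v)) /\ (forall u, linear (f u)).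

Section Def.
Variables (U V : lmodType K).

Inductive tens_rel : {freeg (U * V)%type / K} -> Prop :=
| TensRelL a u u' v :
    tens_rel (<< (a *: u + u', v) >> - (a *: << (u, v) >> + << (u', v) >>))
| TensRelR a u v v' :
    tens_rel (<< (u, a *: v + v') >> - (a *: << (u, v) >> + << (u, v') >>)).

Definition tens : lmodType K := pres tens_rel.

Definition tprod (u : U) (v : V) : tens := pgen tens_rel (u, v).

(* The linear map u (x) v |-> f u v, for bilinear f. *)
Definition tenlift (W : lmodType K) (f : U -> V -> W) : tens -> W :=
  plift (fun p => f p.1 p.2).

Lemma tens_respects (W : lmodType K) (f : U -> V -> W) :
  bilin f -> prespects tens_rel (fun p => f p.1 p.2).
Proof.
move=> [fl fr] _ [a u u' v|a u v v'];
  rewrite raddfB/= fglift_linear !liftU !scale1r/=.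
  by rewrite fl subrr.
by rewrite fr subrr.
Qed.

Lemma tenliftE (W : lmodType K) (f : U -> V -> W) u v :
  bilin f -> tenlift f (tprod u v) = f u v.
Proof. by move=> fb; rewrite /tenlift pliftE//; exact: tens_respects. Qed.

Lemma tenlift_linear (W : lmodType K) (f : U -> V -> W) :
  bilin f -> linear (tenlift f).
Proof. by move=> fb; apply: plift_linear; exact: tens_respects. Qed.

Lemma tprod_bilin : bilin tprod.
Proof.
split=> [v|u] a x y; rewrite /tprod /pgen -linearP; apply/qpiE; apply: mem_span.
  exact: TensRelL.
exact: TensRelR.
Qed.

Lemma tens_ext (W : lmodType K) (f g : tens -> W) : linear f -> linear g ->
  (forall u v, f (tprod u v) = g (tprod u v)) -> forall x, f x = g x.
Proof. by move=> fl gl fg; apply: pres_ext => // -[u v]; exact: fg. Qed.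

End Def.
End Tensor.

Notation "u \ox v" := (tprod u v) (at level 40, left associativity).

Section TensorAlgebra.
Variables (K : fieldType).

Section Def.
Variables (X : lmodType K).

(* The tensor space (+)_k X^(x)k: the generator [:: x1; ...; xk] stands for
   x1 (x) ... (x) xk, and the relations, multilinearity in each letter, preserve
   the length k. *)
Inductive word_rel : {freeg (seq X) / K} -> Prop :=
| WordRel s a x y t :
    word_rel (<< s ++ (a *: x + y) :: t >> -
              (a *: << s ++ x :: t >> + << s ++ y :: t >>)).

Definition tensV : lmodType K := pres word_rel.

Definition word (s : seq X) : tensV := pgen word_rel s.

Definition multilin (W : lmodType K) (f : seq X -> W) :=
  forall s t, linear (fun x => f (s ++ x :: t)).

(* The linear map word s |-> f s, for multilinear f. *)
Definition tlift (W : lmodType K) (f : seq X -> W) : tensV -> W :=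
  plift f.

Lemma word_respects (W : lmodType K) (f : seq X -> W) :
  multilin f -> prespects word_rel f.
Proof.
move=> fm _ [s a x y t].
by rewrite raddfB/= fglift_linear !liftU !scale1r fm subrr.
Qed.

Lemma tliftE (W : lmodType K) (f : seq X -> W) s :
  multilin f -> tlift f (word s) = f s.
Proof. by move=> fm; rewrite /tlift pliftE//; exact: word_respects. Qed.

Lemma tlift_linear (W : lmodType K) (f : seq X -> W) :
  multilin f -> linear (tlift f).
Proof. by move=> fm; apply: plift_linear; exact: word_respects. Qed.

Lemma word_multilin : multilin word.
Proof.
move=> s t a x y; rewrite /word /pgen -linearP; apply/qpiE; apply: mem_span.
exact: WordRel.
Qed.

Lemma tensV_ext (W : lmodType K) (f g : tensV -> W) : linear f -> linear g ->
  (forall s, f (word s) = g (word s)) -> forall x, f x = g x.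
Proof. exact: pres_ext. Qed.

Lemma tensV_ind (P : {pred tensV}) :
  submod_closed P -> (forall s, word s \in P) -> forall x, x \in P.
Proof. exact: pres_ind. Qed.

(* The summand X^(x)n. *)
Definition tpow (n : nat) : {pred tensV} :=
  span (fun a => exists2 s, size s = n & a = word s).

(* The sum of the X^(x)k with k >= 1. *)
Definition Tbar : {pred tensV} :=
  span (fun a => exists2 s, s != [::] & a = word s).

Definition Tone : tensV := word [::].

Definition counit : tensV -> K^o := tlift (fun s => (nilp s)%:R : K^o).

Definition p1 : tensV -> X := tlift (fun s => if s is [:: x] then x else 0).

Definition Delta : tensV -> tens tensV tensV :=
  tlift (fun s => \sum_(i < (size s).+1) word (take i s) \ox word (drop i s)).

Definition lcons (x : X) : tensV -> tensV := tlift (fun s => word (x :: s)).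

Definition concat (a b : tensV) : tensV :=
  tlift (fun s => tlift (fun t => word (s ++ t)) b) a.

Lemma counit_multilin : multilin (fun s : seq X => (nilp s)%:R : K^o).
Proof. by move=> [|z s] t a x y /=; rewrite scaler0 addr0. Qed.

Lemma p1_multilin : multilin (fun s : seq X => if s is [:: x] then x else 0).
Proof.
by move=> [|z [|z' s]] [|z'' t] a x y /=; rewrite ?scaler0 ?addr0.
Qed.

Lemma tprodl (U V : lmodType K) (v : V) : linear (fun u : U => u \ox v).
Proof. by case: (tprod_bilin U V). Qed.
Lemma tprodr (U V : lmodType K) (u : U) : linear (fun v : V => u \ox v).
Proof. by case: (tprod_bilin U V). Qed.

Lemma Delta_multilin : multilin (fun s =>
  \sum_(i < (size s).+1) word (take i s) \ox word (drop i s)).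
Proof.
move=> s t a x y; rewrite !size_cat/= scaler_sumr -big_split/=.
apply: eq_bigr => i _; rewrite !take_cat !drop_cat.
case: ltnP => si; first by rewrite word_multilin tprodr.
case: (i - size s)%N => [|j] /=; last by rewrite word_multilin tprodl.
by rewrite cats0 (word_multilin [::]) tprodr.
Qed.

Lemma lcons_multilin x : multilin (fun s => word (x :: s)).
Proof. by move=> s t; exact: (word_multilin (x :: s)). Qed.

Lemma lcons_linear x : linear (lcons x).
Proof. exact/tlift_linear/lcons_multilin. Qed.

Lemma lconsE x s : lcons x (word s) = word (x :: s).
Proof. by rewrite /lcons tliftE//; exact: lcons_multilin. Qed.

Lemma catl_multilin s : multilin (fun t => word (s ++ t)).
Proof. by move=> t u a x y; rewrite !catA word_multilin. Qed.

Lemma linear_comb (U W : lmodType K) (f g : U -> W) a :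
  linear f -> linear g -> linear (fun x => a *: f x + g x).
Proof.
move=> fl gl b x y; rewrite fl gl !scalerDr !scalerA (mulrC a b).
by rewrite -!addrA; congr (_ + _); rewrite addrCA.
Qed.

Lemma concat_multilin b :
  multilin (fun s => tlift (fun t => word (s ++ t)) b).
Proof.
move=> s t a x y; move: b; apply: tensV_ext.
- exact/tlift_linear/catl_multilin.
- by apply: linear_comb; apply/tlift_linear/catl_multilin.
- move=> u; rewrite !tliftE; [|exact: catl_multilin..].
  by rewrite -!catA/= word_multilin.
Qed.

Lemma concatE s t : concat (word s) (word t) = word (s ++ t).
Proof.
rewrite /concat tliftE; last exact: concat_multilin.
by rewrite tliftE//; exact: catl_multilin.
Qed.

Lemma concat_bilin : bilin concat.
Proof.
split=> [b|a]; first exact/tlift_linear/concat_multilin.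
move=> c x y; move: a; apply: tensV_ext.
- exact/tlift_linear/concat_multilin.
- by apply: linear_comb; apply/tlift_linear/concat_multilin.
- move=> s; rewrite /concat !tliftE; [|exact: concat_multilin..].
  by rewrite tlift_linear//; exact: catl_multilin.
Qed.

Lemma counitE s : counit (word s) = (nilp s)%:R.
Proof. by rewrite /counit tliftE//; exact: counit_multilin. Qed.
Lemma counit_linear : linear counit.
Proof. exact/tlift_linear/counit_multilin. Qed.
Lemma p1E x : p1 (word [:: x]) = x.
Proof. by rewrite /p1 tliftE//; exact: p1_multilin. Qed.
Lemma p1_linear : linear p1.
Proof. exact/tlift_linear/p1_multilin. Qed.
Lemma DeltaE s : Delta (word s) =
  \sum_(i < (size s).+1) word (take i s) \ox word (drop i s).
Proof. by rewrite /Delta tliftE//; exact: Delta_multilin. Qed.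
Lemma Delta_linear : linear Delta.
Proof. exact/tlift_linear/Delta_multilin. Qed.

Lemma linear_comp (U V W : lmodType K) (f : V -> W) (g : U -> V) :
  linear f -> linear g -> linear (fun x => f (g x)).
Proof. by move=> fl gl a x y; rewrite gl fl. Qed.

Lemma linear_id (U : lmodType K) : linear (fun x : U => x).
Proof. by []. Qed.

Lemma concat_linl (U : lmodType K) (f : U -> tensV) b :
  linear f -> linear (fun a => concat (f a) b).
Proof. by move=> fl c x y; case: concat_bilin => cl _; rewrite fl cl. Qed.
Lemma concat_linr (U : lmodType K) (f : U -> tensV) a :
  linear f -> linear (fun b => concat a (f b)).
Proof. by move=> fl c x y; case: concat_bilin => _ cr; rewrite fl cr. Qed.

Lemma concatA : associative concat.
Proof.
move=> a b c; move: a; apply: tensV_ext.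
- exact/concat_linl/linear_id.
- exact/concat_linl/concat_linl/linear_id.
move=> s; move: b; apply: tensV_ext.
- exact/concat_linr/concat_linl/linear_id.
- exact/concat_linl/concat_linr/linear_id.
move=> t; move: c; apply: tensV_ext.
- exact/concat_linr/concat_linr/linear_id.
- exact/concat_linr/linear_id.
by move=> u; rewrite !concatE catA.
Qed.

Lemma concat1 : left_id Tone concat.
Proof.
apply: tensV_ext; [exact/concat_linr/linear_id|exact: linear_id|].
by move=> s; rewrite concatE.
Qed.

Lemma concat_1 : right_id Tone concat.
Proof.
apply: tensV_ext; [exact/concat_linl/linear_id|exact: linear_id|].
by move=> s; rewrite concatE cats0.
Qed.

End Def.

Section Map.
Variables (X Y : lmodType K) (f : X -> Y).

Definition Tmap : tensV X -> tensV Y := tlift (fun s => word (map f s)).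

Hypothesis fl : linear f.

Lemma Tmap_multilin : multilin (fun s => word (map f s)).
Proof. by move=> s t a x y; rewrite !map_cat/= fl word_multilin. Qed.
Lemma TmapE s : Tmap (word s) = word (map f s).
Proof. by rewrite /Tmap tliftE//; exact: Tmap_multilin. Qed.
Lemma Tmap_linear : linear Tmap.
Proof. exact/tlift_linear/Tmap_multilin. Qed.
End Map.

Lemma Tmap_id (X : lmodType K) (a : tensV X) : Tmap id a = a.
Proof.
move: a; apply: tensV_ext => //; first by apply: Tmap_linear.
by move=> s; rewrite TmapE// map_id.
Qed.

Lemma Tmap_comp (X Y Z : lmodType K) (g : Y -> Z) (f : X -> Y) (a : tensV X) :
  linear g -> linear f -> Tmap (g \o f) a = Tmap g (Tmap f a).
Proof.
move=> gl fl; have gfl : linear (g \o f) by exact: linear_comp.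
move: a; apply: tensV_ext; first exact: Tmap_linear.
  by move=> c x y; rewrite !Tmap_linear.
by move=> s; rewrite !TmapE// map_comp.
Qed.

Lemma span_linear (U W : lmodType K) (f : U -> W) (S : U -> Prop) (P : {pred W})
    x : linear f -> submod_closed P -> (forall y, S y -> f y \in P) ->
  x \in span S -> f x \in P.
Proof.
move=> fl [P0 Pl] SP /spanP/(_ (fun y => f y \in P)); apply => //.
split=> [|a u v fu fv]; last by rewrite unfold_in fl; exact: Pl.
by rewrite unfold_in; have := fl (-1) 0 0;
  rewrite scaler0 addr0 scaleN1r addNr => ->.
Qed.

Lemma Tmap_tpow (X Y : lmodType K) (f : X -> Y) n a :
  linear f -> a \in tpow n -> Tmap f a \in tpow n.
Proof.
move=> fl; apply: span_linear; first exact: Tmap_linear.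
  exact: span_submod_closed.
move=> _ [s ss ->]; apply: mem_span; exists (map f s); rewrite ?size_map//.
exact: TmapE.
Qed.

End TensorAlgebra.

Arguments Tbar {K X}.
Arguments tpow {K X}.

(* A Z-graded vector space V = (+)_n V_n is given by its total space together
   with the projections gpr n : V -> V onto the summands V_n. *)
Record grVect (K : fieldType) := GrVect {
  gcar :> lmodType K;
  gpr : int -> gcar -> gcar;
  gpr_linear : forall n, linear (gpr n);
  gpr_gpr : forall m n x, gpr m (gpr n x) = if m == n then gpr n x else 0;
  gpr_fin : forall x, finite_set [set n | gpr n x != 0];
  gpr_sum : forall x, \sum_(n \in setT) gpr n x = x }.

Arguments gpr {K g}.

Section Graded.
Variable K : fieldType.

(* x lies in V_n *)
Definition homog (V : grVect K) (n : int) (x : V) : Prop := gpr n x = x.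

Definition has_degree (U V : grVect K) (k : int) (f : U -> V) : Prop :=
  forall n x, homog n x -> homog (n + k) (f x).

Lemma linear0E (U W : lmodType K) (f : U -> W) : linear f -> f 0 = 0.
Proof.
by move=> fl; have := fl (-1) 0 0; rewrite scaler0 addr0 scaleN1r addNr.
Qed.

Lemma linear_sumE (U W : lmodType K) (f : U -> W) : linear f ->
  forall (I : Type) (r : seq I) (F : I -> U),
  f (\sum_(i <- r) F i) = \sum_(i <- r) f (F i).
Proof.
move=> fl I r F; elim: r => [|i r IH]; first by rewrite !big_nil linear0E.
by rewrite !big_cons -[F i]scale1r fl IH !scale1r.
Qed.

Lemma bigsum_linear (I : Type) (U W : lmodType K) (r : seq I)
    (F : I -> U -> W) :
  (forall i, linear (F i)) -> linear (fun x => \sum_(i <- r) F i x).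
Proof.
move=> Fl a x y; rewrite scaler_sumr -big_split/=.
by apply: eq_bigr => i _; rewrite Fl.
Qed.

Lemma gpr_supp (V : grVect K) (x : V) :
  exists s : seq int, forall n, n \notin s -> gpr n x = 0.
Proof.
have /finite_seqP[s sE] := gpr_fin x; exists s => n ns; apply/eqP.
apply/negPn/negP => xn; have : [set` s] n by rewrite -sE.
by move/negP: ns.
Qed.

Lemma fsbig_uniq (W : lmodType K) (F : int -> W) (s : seq int) : uniq s ->
  (forall n, n \notin s -> F n = 0) ->
  \sum_(n \in setT) F n = \sum_(n <- s) F n.
Proof.
move=> us Fs; rewrite (fsbigE s)//; last by move=> n _; exact: Fs.
by apply: eq_bigl => n; rewrite in_setT.
Qed.

Lemma gsumE (V : grVect K) (W : lmodType K) (F : int -> V -> W) x s :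
  (forall n, linear (F n)) -> uniq s -> (forall n, n \notin s -> gpr n x = 0) ->
  \sum_(n \in setT) F n (gpr n x) = \sum_(n <- s) F n (gpr n x).
Proof.
by move=> Fl us xs; apply: fsbig_uniq => // n /xs ->; exact: linear0E.
Qed.

Lemma gsum_linear (V : grVect K) (W : lmodType K) (F : int -> V -> W) :
  (forall n, linear (F n)) ->
  linear (fun x => \sum_(n \in setT) F n (gpr n x)).
Proof.
move=> Fl a x y.
have [s sx] := gpr_supp x; have [t ty] := gpr_supp y.
pose r := undup (s ++ t).
have ur : uniq r by exact: undup_uniq.
have rx n : n \notin r -> gpr n x = 0.
  by rewrite mem_undup mem_cat negb_or => /andP[/sx].
have ry n : n \notin r -> gpr n y = 0.
  by rewrite mem_undup mem_cat negb_or => /andP[_ /ty].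
rewrite !(@gsumE _ _ _ _ r)// => [|n nr]; last first.
  by rewrite gpr_linear rx// ry// scaler0 addr0.
rewrite scaler_sumr -big_split/=.
by apply: eq_bigr => n _; rewrite gpr_linear Fl.
Qed.

Lemma gpr_homog (V : grVect K) n (x : V) : homog n (gpr n x).
Proof. by rewrite /homog gpr_gpr eqxx. Qed.

Lemma homog_gpr (V : grVect K) n (x : V) m :
  homog n x -> gpr m x = if m == n then x else 0.
Proof. by move=> xn; rewrite -{1}xn gpr_gpr xn. Qed.

Lemma gsum_homog (V : grVect K) (W : lmodType K) (F : int -> V -> W) n x :
  (forall m, linear (F m)) -> homog n x ->
  \sum_(m \in setT) F m (gpr m x) = F n x.
Proof.
move=> Fl xn; rewrite (@gsumE _ _ _ _ [:: n])//.
  by rewrite big_seq1 xn.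
by move=> m; rewrite inE (homog_gpr _ xn) => /negbTE ->.
Qed.

Lemma homog_ind (V : grVect K) (P : {pred V}) : submod_closed P ->
  (forall n x, homog n x -> x \in P) -> forall x, x \in P.
Proof.
move=> [P0 Pl] Ph x; rewrite -(gpr_sum x).
have [s sx] := gpr_supp x.
rewrite (@fsbig_uniq _ _ (undup s)) ?undup_uniq// => [|n]; last first.
  by rewrite mem_undup => /sx.
elim: (undup s) => [|n r IH]; rewrite ?big_nil// big_cons.
by rewrite -[gpr n x]scale1r; apply: Pl => //; exact/Ph/gpr_homog.
Qed.

Section Build.
Variables (V : lmodType K) (pr : int -> V -> V).
Hypothesis prl : forall n, linear (pr n).
Hypothesis prpr : forall m n x, pr m (pr n x) = if m == n then pr n x else 0.
Hypothesis prs : forall x, exists s : seq int, forall t : seq int,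
  uniq t -> {subset s <= t} ->
  x = \sum_(n <- t) pr n x.

Lemma pr_supp x : exists s, [/\ uniq s, x = \sum_(n <- s) pr n x &
  forall n, n \notin s -> pr n x = 0].
Proof.
have [s xs] := prs x; have us := undup_uniq s.
have ss : {subset s <= undup s} by move=> n; rewrite mem_undup.
exists (undup s); split=> [//||n ns]; first exact: xs.
have /xs : uniq (n :: undup s) by rewrite /= ns us.
move=> /(_ (fun k ks => mem_behead (s := n :: undup s) (ss k ks))).
rewrite big_cons -xs// => /esym/eqP.
by rewrite -[X in _ == X]add0r => /eqP/addIr.
Qed.

Lemma pr_fin x : finite_set [set n | pr n x != 0].
Proof.
have [s [_ _ xs]] := pr_supp x; apply/(@sub_finite_set _ _ [set` s]) => //= n/=.
by apply: contraNT => /xs ->.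
Qed.

Lemma pr_sum x : \sum_(n \in setT) pr n x = x.
Proof.
by have [s [us xE xs]] := pr_supp x; rewrite (fsbig_uniq us xs).
Qed.

Definition grVect_of : grVect K := GrVect prl prpr pr_fin pr_sum.
End Build.

(* koszul q x = (-1)^(q |x|) x *)
Definition koszul (V : grVect K) (q : int) (x : V) : V :=
  \sum_(n \in setT) (-1) ^ (q * n) *: gpr n x.

(* (f (x) g)(a (x) b) = (-1)^(|g||a|) f(a) (x) g(b), with |g| = q *)
Definition tens_map (U V : grVect K) (U' V' : lmodType K) (q : int)
    (f : U -> U') (g : V -> V') : tens U V -> tens U' V' :=
  tenlift (fun a b => f (koszul q a) \ox g b).

(* The symmetry a (x) b |-> (-1)^(|a||b|) b (x) a *)
Definition ksym (U V : grVect K) : tens U V -> tens V U :=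
  tenlift (fun a b => \sum_(i \in setT) \sum_(j \in setT)
    (-1) ^ (i * j) *: (gpr j b \ox gpr i a)).

Arguments ksym : clear implicits.

(* (m (x) m)(id (x) ksym (x) id)(s (x) t), where m is a bilinear operation
   regarded as a linear map V (x) V -> V; on generators,
   (a1 (x) a2)(b1 (x) b2) = (-1)^(|a2||b1|) m(a1, b1) (x) m(a2, b2). *)
Definition tens_mul (V : grVect K) (m : V -> V -> V) (s t : tens V V) :
    tens V V :=
  tenlift (fun a1 a2 => tenlift (fun b1 b2 =>
    tenlift (fun b a => m a1 b \ox m a b2) (ksym V V (a2 \ox b1))) t) s.

Lemma scale_linear (V : lmodType K) (c : K) : linear (fun x : V => c *: x).
Proof. by move=> a x y; rewrite scalerDr !scalerA mulrC. Qed.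

Lemma koszul_linear (V : grVect K) q : linear (@koszul V q).
Proof.
apply: (gsum_linear (F := fun n x => (-1) ^ (q * n) *: x)) => n.
exact: scale_linear.
Qed.

Lemma koszulE (V : grVect K) q n (x : V) :
  homog n x -> koszul q x = (-1) ^ (q * n) *: x.
Proof.
move=> xn; apply: (gsum_homog (F := fun n x => (-1) ^ (q * n) *: x)) => // m.
exact: scale_linear.
Qed.

Section Maps.
Variables (U V : grVect K).

Section TensMap.
Variables (U' V' : lmodType K) (q : int) (f : U -> U') (g : V -> V').
Hypotheses (fl : linear f) (gl : linear g).

Let tmb : bilin (fun a b => f (koszul q a) \ox g b).
Proof.
split=> [v|u] a x y; last by rewrite gl tprodr.
by rewrite koszul_linear fl tprodl.
Qed.

Lemma tens_map_linear : linear (tens_map q f g).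
Proof. exact: tenlift_linear tmb. Qed.

Lemma tens_mapE n a b : homog n a ->
  tens_map q f g (a \ox b) = (-1) ^ (q * n) *: (f a \ox g b).
Proof.
move=> an; rewrite /tens_map (tenliftE _ _ tmb) (koszulE _ an).
rewrite -[_ *: a]addr0 fl (linear0E fl) addr0.
by rewrite -[_ *: f a]addr0 tprodl (linear0E (tprodl _)) addr0.
Qed.
End TensMap.

Let kf (i j : int) (a : U) (b : V) := (-1 : K) ^ (i * j) *: (b \ox a).

Let kfl i j b : linear (fun a => kf i j a b).
Proof. by move=> c x y; rewrite /kf tprodr scale_linear. Qed.
Let kfr i j a : linear (kf i j a).
Proof. by move=> c x y; rewrite /kf tprodl scale_linear. Qed.

Let kfsl i b : linear (fun a => \sum_(j \in setT) kf i j a (gpr j b)).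
Proof.
have [s sb] := gpr_supp b.
have us := undup_uniq s.
have sb' n : n \notin undup s -> gpr n b = 0 by rewrite mem_undup; exact: sb.
move=> c x y; rewrite !(@gsumE _ _ (fun j => kf i j _) b _ _ us)//.
apply: (@bigsum_linear _ _ _ _ (fun j a => kf i j a (gpr j b))) => j.
exact: kfl.
Qed.

Lemma ksym_bilin : bilin (fun (a : U) (b : V) =>
  \sum_(i \in setT) \sum_(j \in setT) (-1 : K) ^ (i * j) *:
    (gpr j b \ox gpr i a)).
Proof.
split=> [b|a].
  exact: (gsum_linear (F := fun i a => \sum_(j \in setT) kf i j a (gpr j b))).
have [s sa] := gpr_supp a.
have us := undup_uniq s.
have sa' n : n \notin undup s -> gpr n a = 0 by rewrite mem_undup; exact: sa.
move=> c x y.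
rewrite !(@gsumE _ _ (fun i a => \sum_(j \in setT) kf i j a (gpr j _)) _ _ _ us)//.
apply: (@bigsum_linear _ _ _ _
  (fun i b => \sum_(j \in setT) kf i j (gpr i a) (gpr j b))) => i.
exact: (gsum_linear (F := fun j b => kf i j (gpr i a) b)).
Qed.

Lemma ksym_linear : linear (ksym U V).
Proof. exact: tenlift_linear ksym_bilin. Qed.

Lemma ksymE i j a b : homog i a -> homog j b ->
  ksym U V (a \ox b) = (-1) ^ (i * j) *: (b \ox a).
Proof.
move=> ai bj; rewrite /ksym (tenliftE _ _ ksym_bilin).
rewrite (gsum_homog (F := fun i a => \sum_(j \in setT) kf i j a (gpr j b)) _ ai)//.
by rewrite (gsum_homog (F := fun j b => kf i j a b) _ bj).
Qed.

End Maps.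

Section TensMul.
Variables (V : grVect K) (m : V -> V -> V).
Hypothesis mb : bilin m.

Let ml b c x y : m (c *: x + y) b = c *: m x b + m y b.
Proof. by case: mb => + _; exact. Qed.
Let mr a c x y : m a (c *: x + y) = c *: m a x + m a y.
Proof. by case: mb => _; exact. Qed.

Let inner a1 b2 (z : tens V V) := tenlift (fun b a => m a1 b \ox m a b2) z.

Let inner_bilin a1 b2 : bilin (fun b a => m a1 b \ox m a b2).
Proof.
by split=> [u|u] c x y; [rewrite mr tprodl|rewrite ml tprodr].
Qed.

Let inner_l a1 b2 : linear (inner a1 b2).
Proof. exact/tenlift_linear/inner_bilin. Qed.

Let inner_1 b2 z : linear (fun a1 => inner a1 b2 z).
Proof.
move=> c x y; move: z; apply: tens_ext => //.
  by apply: linear_comb; exact: inner_l.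
move=> u v; rewrite /inner !tenliftE; [|exact: inner_bilin..].
by rewrite ml tprodl.
Qed.

Let inner_2 a1 z : linear (fun b2 => inner a1 b2 z).
Proof.
move=> c x y; move: z; apply: tens_ext => //.
  by apply: linear_comb; exact: inner_l.
move=> u v; rewrite /inner !tenliftE; [|exact: inner_bilin..].
by rewrite mr tprodr.
Qed.

Let mid a1 a2 (t : tens V V) :=
  tenlift (fun b1 b2 => inner a1 b2 (ksym V V (a2 \ox b1))) t.

Let mid_bilin a1 a2 : bilin (fun b1 b2 => inner a1 b2 (ksym V V (a2 \ox b1))).
Proof.
by split=> [u|u] c x y; rewrite ?inner_2// tprodr ksym_linear inner_l.
Qed.

Let mid_l a1 a2 : linear (mid a1 a2).
Proof. exact/tenlift_linear/mid_bilin. Qed.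

Let out_bilin t : bilin (fun a1 a2 => mid a1 a2 t).
Proof.
split=> [u|u] c x y; move: t; apply: tens_ext.
- exact: mid_l.
- by apply: linear_comb; exact: mid_l.
- by move=> v w; rewrite /mid !tenliftE; [|exact: mid_bilin..]; exact: inner_1.
- exact: mid_l.
- by apply: linear_comb; exact: mid_l.
move=> v w; rewrite /mid !tenliftE; [|exact: mid_bilin..].
by rewrite tprodl ksym_linear inner_l.
Qed.

Lemma tens_mul_bilin : bilin (tens_mul m).
Proof.
split=> [t|s]; first exact: tenlift_linear (out_bilin t).
move=> c x y; move: s; apply: tens_ext.
- exact: tenlift_linear (out_bilin _).
- by apply: linear_comb; exact: tenlift_linear (out_bilin _).
move=> u v; rewrite /tens_mul !(tenliftE _ _ (out_bilin _)).
exact: mid_l.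
Qed.

Lemma tens_mulE i j a1 a2 b1 b2 : homog i a2 -> homog j b1 ->
  tens_mul m (a1 \ox a2) (b1 \ox b2) =
  (-1) ^ (i * j) *: (m a1 b1 \ox m a2 b2).
Proof.
move=> a2i b1j; rewrite /tens_mul (tenliftE _ _ (out_bilin _)).
rewrite /mid (tenliftE _ _ (mid_bilin _ _)) (ksymE a2i b1j).
rewrite -[_ *: (b1 \ox _)]addr0 inner_l (linear0E (@inner_l _ _)) addr0.
by rewrite /inner (tenliftE _ _ (inner_bilin _ _)).
Qed.

End TensMul.
End Graded.

Section GradedT.
Variables (K : fieldType) (X : grVect K).

(* The component of x1 ... xk in total degree n. *)
Fixpoint wpr (n : int) (s : seq X) : tensV X :=
  match s with
  | [::] => if n == 0 then word [::] else 0
  | x :: s' => \sum_(i \in setT) lcons (gpr i x) (wpr (n - i) s')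
  end.

Definition Tpr (n : int) : tensV X -> tensV X := tlift (wpr n).

Lemma lcons_linl (a : tensV X) : linear (fun x => lcons x a).
Proof.
move=> c x y; move: a; apply: tensV_ext.
- exact: lcons_linear.
- by apply: linear_comb; exact: lcons_linear.
by move=> s; rewrite !lconsE (word_multilin [::]).
Qed.

Lemma wpr_multilin n : multilin (wpr n).
Proof.
move=> s t; elim: s n => [|z s IH] n /=.
  exact: (gsum_linear (F := fun i x => lcons x (wpr (n - i) t)))
    (fun i => @lcons_linl _).
have [r zr] := gpr_supp z.
have zr' i : i \notin undup r -> gpr i z = 0 by rewrite mem_undup; exact: zr.
move=> c x y.
rewrite !(@gsumE _ _ _ (fun i z => lcons z (wpr (n - i) (s ++ _ :: t))) z _ _
  (undup_uniq r) zr'); [|by move=> i; exact: lcons_linl..].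
apply: (@bigsum_linear _ _ _ _ _
  (fun i x => lcons (gpr i z) (wpr (n - i) (s ++ x :: t)))) => i {}c {}x {}y.
by rewrite IH lcons_linear.
Qed.

Lemma Tpr_linear n : linear (Tpr n).
Proof. exact/tlift_linear/wpr_multilin. Qed.

Lemma TprE n s : Tpr n (word s) = wpr n s.
Proof. exact/tliftE/wpr_multilin. Qed.

Inductive hword : int -> seq X -> Prop :=
| HNil : hword 0 [::]
| HCons i x n s : homog i x -> hword n s -> hword (i + n) (x :: s).

Lemma wpr_hword m n s : hword n s -> wpr m s = if m == n then word s else 0.
Proof.
move=> ns; elim: ns m => [|i x {}n {}s xi _ IH] m //=.
rewrite (gsum_homog (F := fun i x => lcons x (wpr (m - i) s)) _ xi); last first.
  by move=> j; exact: lcons_linl.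
rewrite IH subr_eq addrC; case: eqP => _; first by rewrite lconsE.
exact: linear0E (@lcons_linear _ _ _).
Qed.

Lemma Tpr_hword m n s : hword n s ->
  Tpr m (word s) = if m == n then word s else 0.
Proof. by move=> /(wpr_hword m) <-; rewrite TprE. Qed.

Lemma hword_span_ind (P : {pred tensV X}) : submod_closed P ->
  (forall n s, hword n s -> word s \in P) -> forall a, a \in P.
Proof.
move=> Pcl Ph; apply: tensV_ind => // s.
pose Q := span (fun a => exists n t, hword n t /\ a = word t).
suff : word s \in Q.
  by move=> /spanP; apply => // _ [n [t [nt ->]]]; exact: Ph nt.
elim: s => [|x s IH].
  by apply: mem_span; exists 0, [::]; split => //; exact: HNil.
rewrite -lconsE; apply: span_linear IH; first exact: lcons_linear.
  exact: span_submod_closed.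
move=> _ [n [t [nt ->]]].
have : x \in (fun x => lcons x (word t) \in Q).
  apply: homog_ind => [|i {}x xi]; last first.
    rewrite unfold_in lconsE; apply: mem_span.
    by exists (i + n), (x :: t); split => //; exact: HCons.
  have [Q0 Ql] := span_submod_closed
    (fun a => exists n t, hword n t /\ a = word t).
  split; first by rewrite unfold_in (linear0E (@lcons_linl _)).
  by move=> c u v uQ vQ; rewrite unfold_in lcons_linl; exact: Ql.
by [].
Qed.

Lemma hword_ext (W : lmodType K) (f g : tensV X -> W) : linear f -> linear g ->
  (forall n s, hword n s -> f (word s) = g (word s)) -> forall a, f a = g a.
Proof.
move=> fl gl fg a; apply/eqP.
by apply: (hword_span_ind (linear_eq0_submod fl gl)) => n s ns; apply/eqP/(fg n).
Qed.

Lemma cst0_linear (U W : lmodType K) : linear (fun _ : U => 0 : W).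
Proof. by move=> c x y; rewrite scaler0 addr0. Qed.

Lemma Tpr_Tpr m n a : Tpr m (Tpr n a) = if m == n then Tpr n a else 0.
Proof.
move: a; apply: hword_ext.
- by move=> c x y; rewrite !Tpr_linear.
- by case: eqP => _; [exact: Tpr_linear|exact: cst0_linear].
move=> k s ks; rewrite (Tpr_hword n ks).
case: (eqVneq n k) => [->|nk].
  by rewrite (Tpr_hword m ks).
by rewrite (linear0E (@Tpr_linear _)); case: ifP.
Qed.

Lemma Tpr_sum a : exists r : seq int, forall r' : seq int,
  uniq r' -> {subset r <= r'} ->
  a = \sum_(n <- r') Tpr n a.
Proof.
suff /asboolP : a \in (fun a => `[< exists r : seq int,
  forall r' : seq int, uniq r' ->
  {subset r <= r'} -> a = \sum_(n <- r') Tpr n a >]) by [].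
apply: hword_span_ind => [|n s ns].
  split; first by apply/asboolP; exists [::] => r _ _;
    rewrite big1// => n _; exact: (linear0E (@Tpr_linear _)).
  move=> c x y /asboolP[r xr] /asboolP[t yt]; apply/asboolP.
  exists (r ++ t) => u uu ru; rewrite {1}(xr u uu); last first.
    by move=> n nr; apply: ru; rewrite mem_cat nr.
  rewrite {1}(yt u uu) => [|n nr]; last by apply: ru; rewrite mem_cat nr orbT.
  rewrite scaler_sumr -big_split/=; apply: eq_bigr => n _.
  by rewrite Tpr_linear.
apply/asboolP; exists [:: n] => r ur nr.
rewrite (bigD1_seq n)//=; last by apply: nr; rewrite inE.
rewrite (Tpr_hword n ns) eqxx big1 ?addr0// => k /negbTE kn.
by rewrite (Tpr_hword k ns) kn.
Qed.

Definition Tc : grVect K := grVect_of Tpr_linear Tpr_Tpr Tpr_sum.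

Lemma hword_homog n s : hword n s -> homog (V := Tc) n (word s).
Proof. by move=> ns; rewrite /homog/= (Tpr_hword n ns) eqxx. Qed.

Lemma homog_span n (a : Tc) : homog n a ->
  a \in span (fun a => exists2 s, hword n s & a = word s).
Proof.
move=> <- /=; have [P0 Pl] := span_submod_closed
  (fun a => exists2 s, hword n s & a = word s).
suff : (a : tensV X) \in (fun a => Tpr n a \in
  span (fun a => exists2 s, hword n s & a = word s)) by [].
apply: hword_span_ind => [|m s ms].
  split; first by rewrite unfold_in (linear0E (@Tpr_linear _)).
  by move=> c x y xP yP; rewrite unfold_in Tpr_linear; exact: Pl.
rewrite unfold_in (Tpr_hword n ms); case: eqP => // ->.
by apply: mem_span; exists s.
Qed.

Lemma homog_submod (V : grVect K) n :
  submod_closed (fun x : V => `[< homog n x >]).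
Proof.
split=> [|c x y /asboolP xn /asboolP yn]; apply/asboolP.
  exact: (linear0E (@gpr_linear _ V n)).
by rewrite /homog gpr_linear xn yn.
Qed.

Lemma span_homog (U : lmodType K) (V : grVect K) (f : U -> V) S n x :
  linear f -> (forall y, S y -> homog n (f y)) -> x \in span S ->
  homog n (f x).
Proof.
move=> fl fS xS; apply/asboolP.
have : f x \in (fun x : V => `[< homog n x >]).
  apply: (@span_linear K U V f S _ x fl (@homog_submod V n) _ xS) => y Sy.
  by rewrite unfold_in; apply/asboolP/fS.
by rewrite unfold_in.
Qed.

Lemma hword_cat m n s t : hword m s -> hword n t -> hword (m + n) (s ++ t).
Proof.
move=> ms nt; elim: ms => [|i x k {}s xi _ IH]; first by rewrite add0r.
by rewrite -addrA /=; exact: HCons.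
Qed.

Lemma concat_degree i j (a b : Tc) : homog i a -> homog j b ->
  homog (V := Tc) (i + j) (concat a b).
Proof.
move=> /homog_span ai /homog_span bj.
apply: (span_homog (f := fun a => concat a b : Tc)) ai.
  exact/concat_linl/linear_id.
move=> _ [s si ->].
apply: (span_homog (f := fun b => concat (word s) b : Tc)) bj.
  exact/concat_linr/linear_id.
by move=> _ [t tj ->]; rewrite concatE; exact/hword_homog/hword_cat.
Qed.

Lemma Tone_homog : homog (V := Tc) 0 (Tone X).
Proof. exact/hword_homog/HNil. Qed.

End GradedT.

Canonical Tc.

Lemma Tmap_degree (K : fieldType) (X Y : grVect K) (f : X -> Y) :
  linear f -> has_degree 0 f -> has_degree 0 (Tmap f : Tc X -> Tc Y).
Proof.
move=> fl f0 n a /homog_span an; rewrite addr0.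
apply: (span_homog (f := Tmap f : tensV X -> Tc Y)) an; first exact: Tmap_linear.
move=> _ [s sn ->]; rewrite TmapE//; apply: hword_homog.
elim: sn => [|i x k t xi _ IH] /=; first exact: HNil.
by apply: HCons => //; have := f0 _ _ xi; rewrite addr0.
Qed.

(* The multiplication mu : T^c(X) (x) T^c(X) -> T^c(X) is given as a bilinear
   operation; bmu_Delta and bmu_counit say that it is a coalgebra map. *)
Record binf (K : fieldType) (X : grVect K) := Binf {
  bmu : Tc X -> Tc X -> Tc X;
  bdiff : Tc X -> Tc X;
  bmu_bilin : bilin bmu;
  bmu_degree : forall i j a b,
    homog i a -> homog j b -> homog (i + j) (bmu a b);
  bmu_Delta : forall a b,
    Delta (bmu a b) = tens_mul bmu (Delta a) (Delta b);
  bmu_counit : forall a b, counit (bmu a b) = counit a * counit b;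
  bmuA : associative bmu;
  bmu1l : left_id (Tone X) bmu;
  bmu1r : right_id (Tone X) bmu;
  bdiff_linear : linear bdiff;
  bdiff_degree : has_degree (-1) bdiff;
  bdiff_Delta : forall a,
    Delta (bdiff a) =
    tens_map 0 bdiff id (Delta a) + tens_map (-1) id bdiff (Delta a);
  bdiff1 : bdiff (Tone X) = 0;
  bdiff2 : forall a, bdiff (bdiff a) = 0;
  bdiff_mu : forall i a b, homog i a ->
    bdiff (bmu a b) = bmu (bdiff a) b + (-1) ^ i *: bmu a (bdiff b) }.

Record binfAlg (K : fieldType) := BinfAlg {
  bcar :> grVect K;
  bstr :> binf bcar }.

Section BinfCategory.
Variable K : fieldType.

(* m_n c = bm S c for c in X^(x)n, and m_{i,j} (a (x) b) = bmm S a b for a in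
   X^(x)i and b in X^(x)j. *)
Definition bm (X : grVect K) (S : binf X) (c : Tc X) : X := p1 (bdiff S c).
Definition bmm (X : grVect K) (S : binf X) (a b : Tc X) : X := p1 (bmu S a b).

Record binf_hom (A B : binfAlg K) := BinfHom {
  bfun :> A -> B;
  bfun_linear : linear bfun;
  bfun_degree : has_degree 0 bfun;
  bfun_m : forall n (c : Tc A), (0 < n)%N -> c \in tpow n ->
    bfun (bm A c) = bm B (Tmap bfun c);
  bfun_mm : forall i j (a b : Tc A), (0 < i)%N -> (0 < j)%N ->
    a \in tpow i -> b \in tpow j ->
    bfun (bmm A a b) = bmm B (Tmap bfun a) (Tmap bfun b) }.

Lemma binf_hom_ext A B (f g : binf_hom A B) : (forall x, f x = g x) -> f = g.
Proof.
case: f g => [f p1 p2 p3 p4] [g q1 q2 q3 q4] /= /funext fg.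
case: _ / fg in q1 q2 q3 q4 *.
by congr BinfHom; exact: Prop_irrelevance.
Qed.

Lemma has_degree_comp0 (U V W : grVect K) (g : V -> W) (f : U -> V) :
  has_degree 0 g -> has_degree 0 f -> has_degree 0 (g \o f).
Proof.
by move=> g0 f0 n x /f0 fx; have := g0 _ _ fx; rewrite !addr0.
Qed.

Lemma has_degree_id (V : grVect K) : has_degree 0 (@id V).
Proof. by move=> n x; rewrite addr0. Qed.

Program Definition binf_id (A : binfAlg K) : binf_hom A A :=
  @BinfHom A A id _ (@has_degree_id A) _ _.
Next Obligation. by []. Qed.
Next Obligation. by move=> A n c _ _; rewrite Tmap_id. Qed.
Next Obligation. by move=> A i j a b _ _ _ _; rewrite !Tmap_id. Qed.

Program Definition binf_comp (A B C : binfAlg K) (g : binf_hom B C)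
    (f : binf_hom A B) : binf_hom A C :=
  @BinfHom A C (g \o f) (linear_comp (bfun_linear g) (bfun_linear f))
    (has_degree_comp0 (bfun_degree g) (bfun_degree f)) _ _.
Next Obligation.
move=> A B C g f n c n0 cn; have fl := bfun_linear f; have gl := bfun_linear g.
rewrite /= (bfun_m f n0 cn) (bfun_m g n0); last exact: Tmap_tpow.
by rewrite (Tmap_comp c gl fl).
Qed.
Next Obligation.
move=> A B C g f i j a b i0 j0 ai bj.
have fl := bfun_linear f; have gl := bfun_linear g.
rewrite /= (bfun_mm f i0 j0 ai bj) (bfun_mm g i0 j0); [|exact: Tmap_tpow..].
by rewrite (Tmap_comp a gl fl) (Tmap_comp b gl fl).
Qed.

Program Definition BinfCat : category :=
  @Category (binfAlg K) binf_hom binf_id binf_comp _ _ _.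
Next Obligation. by move=> A B f; exact: binf_hom_ext. Qed.
Next Obligation. by move=> A B f; exact: binf_hom_ext. Qed.
Next Obligation. by move=> A B C D h g f; exact: binf_hom_ext. Qed.

End BinfCategory.

Record dAs (K : fieldType) := DAs {
  dcar :> grVect K;
  dmul : dcar -> dcar -> dcar;
  dodot : dcar -> dcar -> dcar;
  dunit : dcar;
  dd : dcar -> dcar;
  dmul_bilin : bilin dmul;
  dmul_degree : forall i j a b,
    homog i a -> homog j b -> homog (i + j) (dmul a b);
  dmulA : associative dmul;
  dmul1l : left_id dunit dmul;
  dmul1r : right_id dunit dmul;
  dodot_bilin : bilin dodot;
  dodot_degree : forall i j a b,
    homog i a -> homog j b -> homog (i + j) (dodot a b);
  dodotA : associative dodot;
  dodot1l : left_id dunit dodot;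
  dodot1r : right_id dunit dodot;
  dunit_degree : homog 0 dunit;
  dd_linear : linear dd;
  dd_degree : has_degree (-1) dd;
  dd2 : forall a, dd (dd a) = 0;
  dd_mul : forall i a b, homog i a ->
    dd (dmul a b) = dmul (dd a) b + (-1) ^ i *: dmul a (dd b) }.

Arguments dmul {K d}.
Arguments dodot {K d}.
Arguments dd {K d}.

Section DAsCategory.
Variable K : fieldType.

Record dAs_hom (V W : dAs K) := DAsHom {
  dfun :> V -> W;
  dfun_linear : linear dfun;
  dfun_degree : has_degree 0 dfun;
  dfun_mul : forall a b, dfun (dmul a b) = dmul (dfun a) (dfun b);
  dfun_odot : forall a b, dfun (dodot a b) = dodot (dfun a) (dfun b);
  dfun_one : dfun (dunit V) = dunit W;
  dfun_dd : forall a, dfun (dd a) = dd (dfun a) }.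

Lemma dAs_hom_ext V W (f g : dAs_hom V W) : (forall x, f x = g x) -> f = g.
Proof.
case: f g => [f p1 p2 p3 p4 p5 p6] [g q1 q2 q3 q4 q5 q6] /= /funext fg.
case: _ / fg in q1 q2 q3 q4 q5 q6 *.
by congr DAsHom; exact: Prop_irrelevance.
Qed.

Definition dAs_id (V : dAs K) : dAs_hom V V :=
  @DAsHom V V id (@linear_id K V) (@has_degree_id K V)
    (fun _ _ => erefl) (fun _ _ => erefl) erefl (fun _ => erefl).

Program Definition dAs_comp (U V W : dAs K) (g : dAs_hom V W)
    (f : dAs_hom U V) : dAs_hom U W :=
  @DAsHom U W (g \o f) (linear_comp (dfun_linear g) (dfun_linear f))
    (has_degree_comp0 (dfun_degree g) (dfun_degree f)) _ _ _ _.
Next Obligation. by move=> U V W g f a b /=; rewrite !dfun_mul. Qed.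
Next Obligation. by move=> U V W g f a b /=; rewrite !dfun_odot. Qed.
Next Obligation. by move=> U V W g f /=; rewrite !dfun_one. Qed.
Next Obligation. by move=> U V W g f a /=; rewrite !dfun_dd. Qed.

Program Definition DAsCat : category :=
  @Category (dAs K) dAs_hom dAs_id dAs_comp _ _ _.
Next Obligation. by move=> A B f; exact: dAs_hom_ext. Qed.
Next Obligation. by move=> A B f; exact: dAs_hom_ext. Qed.
Next Obligation. by move=> A B C D h g f; exact: dAs_hom_ext. Qed.

End DAsCategory.

Section Underlying.
Variables (K : fieldType) (V : dAs K).

(* The formula also gives tau1 1 = 1, but tau1 is only used on Tbar. *)
Definition tau1 : Tc V -> V := tlift (fun s => foldr dodot (dunit V) s).

Lemma tau1_multilin : multilin (fun s => foldr dodot (dunit V) s).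
Proof.
have [ol or] := dodot_bilin V.
by move=> s t; elim: s => [|z s IH] c x y /=; rewrite ?ol// IH or.
Qed.

Lemma tau1E s : tau1 (word s) = foldr dodot (dunit V) s.
Proof. exact/tliftE/tau1_multilin. Qed.

Definition underlying_structure (S : binf V) : Prop :=
  (forall a b, a \in Tbar -> b \in Tbar ->
     tau1 (bmu S a b) = dmul (tau1 a) (tau1 b)) /\
  (forall a, a \in Tbar -> tau1 (bdiff S a) = dd (tau1 a)).

End Underlying.

Section TensorDAs.
Variables (K : fieldType) (A : binfAlg K).

Definition TcAlg : dAs K :=
  @DAs K (Tc A) (bmu A) (@concat K A) (Tone A) (bdiff A)
    (bmu_bilin A) (@bmu_degree K A A) (@bmuA K A A) (@bmu1l K A A)
    (@bmu1r K A A) (@concat_bilin K A) (@concat_degree K A) (@concatA K A)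
    (@concat1 K A) (@concat_1 K A) (@Tone_homog K A) (@bdiff_linear K A A)
    (@bdiff_degree K A A) (@bdiff2 K A A) (@bdiff_mu K A A).

End TensorDAs.

Section QuotientDAs.
Variables (K : fieldType) (V : dAs K) (rel : V -> Prop).

(* The ideal generated by rel. As all vector spaces are graded, ideals are
   graded subspaces, whence IdealPr. *)
Inductive ideal_gen : V -> Prop :=
| IdealRel x : rel x -> ideal_gen x
| Ideal0 : ideal_gen 0
| IdealLin c x y : ideal_gen x -> ideal_gen y -> ideal_gen (c *: x + y)
| IdealPr n x : ideal_gen x -> ideal_gen (gpr n x)
| IdealD x : ideal_gen x -> ideal_gen (dd x)
| IdealMulL a x : ideal_gen x -> ideal_gen (dmul a x)
| IdealMulR a x : ideal_gen x -> ideal_gen (dmul x a)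
| IdealOdotL a x : ideal_gen x -> ideal_gen (dodot a x)
| IdealOdotR a x : ideal_gen x -> ideal_gen (dodot x a).

Let Q := quotmod ideal_gen.

Lemma span_idealE x : (x \in span ideal_gen) <-> ideal_gen x.
Proof.
split=> [/spanP/(_ (fun y => `[< ideal_gen y >]))|]; last exact: mem_span.
move=> H; apply/asboolP; have : x \in (fun y => `[< ideal_gen y >]).
  apply: H => [|y Iy]; last by rewrite unfold_in; exact/asboolP.
  split; first by rewrite unfold_in; exact/asboolP/Ideal0.
  by move=> c u v /asboolP Iu /asboolP Iv; apply/asboolP; exact: IdealLin.
by rewrite unfold_in.
Qed.

Let qp : V -> Q := qpi ideal_gen.

Let qpE x y : (qp x = qp y) <-> ideal_gen (x - y).
Proof. by rewrite /qp qpiE; exact: span_idealE. Qed.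

Let qK (q : Q) : qp (qrepr q) = q. Proof. exact: qreprK. Qed.

Let qpl : linear qp. Proof. exact: qpi_linear. Qed.

Let qr x : ideal_gen (x - qrepr (qp x)).
Proof. by apply/qpE; rewrite qK. Qed.

Let lB (U W : lmodType K) (f : U -> W) x y :
  linear f -> f (x - y) = f x - f y.
Proof. by move=> fl; rewrite addrC -scaleN1r fl scaleN1r addrC. Qed.

Section Op1.
Variable f : V -> V.
Hypotheses (fl : linear f) (fI : forall x, ideal_gen x -> ideal_gen (f x)).
Definition qop1 (q : Q) : Q := qp (f (qrepr q)).
Let q1E x : qop1 (qp x) = qp (f x).
Proof. by apply/esym/qpE; rewrite -lB//; apply/fI/qr. Qed.
Let q1l : linear qop1.
Proof. by move=> c x y; rewrite -(qK x) -(qK y) -qpl !q1E fl qpl. Qed.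
Lemma qop1P : (forall x, qop1 (qp x) = qp (f x)) /\ linear qop1.
Proof. by []. Qed.
End Op1.

Section Op2.
Variable f : V -> V -> V.
Hypotheses (fb : bilin f)
  (fIl : forall a x, ideal_gen x -> ideal_gen (f a x))
  (fIr : forall a x, ideal_gen x -> ideal_gen (f x a)).
Definition qop2 (q r : Q) : Q := qp (f (qrepr q) (qrepr r)).
Let q2E x y : qop2 (qp x) (qp y) = qp (f x y).
Proof.
have [fl fr] := fb; apply/esym; transitivity (qp (f x (qrepr (qp y)))).
  by apply/qpE; rewrite -lB//; apply/fIl/qr.
by apply/qpE; rewrite -(lB _ _ (fl _)); apply/fIr/qr.
Qed.
Let q2b : bilin qop2.
Proof.
have [fl fr] := fb.
split=> [v|u] c x y; rewrite -(qK x) -(qK y) -qpl.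
  by rewrite -(qK v) !q2E fl qpl.
by rewrite -(qK u) !q2E fr qpl.
Qed.
Lemma qop2P : (forall x y, qop2 (qp x) (qp y) = qp (f x y)) /\ bilin qop2.
Proof. by []. Qed.
End Op2.

Definition qpr (n : int) : Q -> Q := qop1 (gpr n).
Definition qdd : Q -> Q := qop1 dd.
Definition qmul : Q -> Q -> Q := qop2 dmul.
Definition qodot : Q -> Q -> Q := qop2 dodot.

Lemma qprE n x : qpr n (qp x) = qp (gpr n x).
Proof. have [+ _] := qop1P (gpr_linear n) (@IdealPr n); exact. Qed.
Lemma qpr_linear n : linear (qpr n).
Proof. by have [] := qop1P (gpr_linear n) (@IdealPr n). Qed.
Lemma qddE x : qdd (qp x) = qp (dd x).
Proof. have [+ _] := qop1P (@dd_linear K V) IdealD; exact. Qed.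
Lemma qdd_linear : linear qdd.
Proof. by have [] := qop1P (@dd_linear K V) IdealD. Qed.
Lemma qmulE x y : qmul (qp x) (qp y) = qp (dmul x y).
Proof. have [+ _] := qop2P (@dmul_bilin K V) IdealMulL IdealMulR; exact. Qed.
Lemma qmul_bilin : bilin qmul.
Proof. by have [] := qop2P (@dmul_bilin K V) IdealMulL IdealMulR. Qed.
Lemma qodotE x y : qodot (qp x) (qp y) = qp (dodot x y).
Proof. have [+ _] := qop2P (@dodot_bilin K V) IdealOdotL IdealOdotR; exact. Qed.
Lemma qodot_bilin : bilin qodot.
Proof. by have [] := qop2P (@dodot_bilin K V) IdealOdotL IdealOdotR. Qed.

Let qp0 : qp 0 = 0. Proof. exact: linear0E. Qed.

Lemma qpr_qpr m n q : qpr m (qpr n q) = if m == n then qpr n q else 0.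
Proof.
by rewrite -(qK q) !qprE gpr_gpr; case: ifP => // _; rewrite qp0.
Qed.

Lemma qpr_sum q : exists s : seq int, forall t : seq int,
  uniq t -> {subset s <= t} -> q = \sum_(n <- t) qpr n q.
Proof.
have [s xs] := gpr_supp (qrepr q); exists s => t ut st.
rewrite -{1}(qK q) -{1}(gpr_sum (qrepr q)) (@fsbig_uniq _ _ _ t)//.
  by rewrite (linear_sumE qpl); apply: eq_bigr => n _; rewrite -qprE qK.
by move=> n nt; apply: xs; apply: contra nt; exact: st.
Qed.

Definition qgr : grVect K := grVect_of qpr_linear qpr_qpr qpr_sum.

Let qhom n (q : qgr) : homog n q -> exists2 x : V, homog n x & q = qp x.
Proof.
move=> qn; exists (gpr n (qrepr q)); first exact: gpr_homog.
by rewrite -qprE qK.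
Qed.

Let hqp n x : homog n x -> homog (V := qgr) n (qp x).
Proof. by move=> xn; rewrite /homog/= qprE xn. Qed.

Program Definition quotDAs : dAs K :=
  @DAs K qgr qmul qodot (qp (dunit V)) qdd qmul_bilin _ _ _ _
    qodot_bilin _ _ _ _ _ qdd_linear _ _ _.
Next Obligation.
move=> i j a b /qhom[x xi ->] /qhom[y yj ->].
by rewrite qmulE; exact/hqp/dmul_degree.
Qed.
Next Obligation.
by move=> x y z; rewrite -(qK x) -(qK y) -(qK z) !qmulE dmulA.
Qed.
Next Obligation. by move=> x; rewrite -(qK x) qmulE dmul1l. Qed.
Next Obligation. by move=> x; rewrite -(qK x) qmulE dmul1r. Qed.
Next Obligation.
move=> i j a b /qhom[x xi ->] /qhom[y yj ->].
by rewrite qodotE; exact/hqp/dodot_degree.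
Qed.
Next Obligation.
by move=> x y z; rewrite -(qK x) -(qK y) -(qK z) !qodotE dodotA.
Qed.
Next Obligation. by move=> x; rewrite -(qK x) qodotE dodot1l. Qed.
Next Obligation. by move=> x; rewrite -(qK x) qodotE dodot1r. Qed.
Next Obligation. exact/hqp/dunit_degree. Qed.
Next Obligation.
by move=> n a /qhom[x xn ->]; rewrite qddE; exact/hqp/dd_degree.
Qed.
Next Obligation. by move=> x; rewrite -(qK x) !qddE dd2 qp0. Qed.
Next Obligation.
move=> i a b /qhom[x xi ->]; rewrite -(qK b) !(qmulE, qddE) (dd_mul _ xi).
by rewrite addrC qpl addrC.
Qed.

Definition quotDAs_pi : V -> quotDAs := qp.

End QuotientDAs.

(* A free object is given by its universal property among degree 0 linear maps
   out of X. *)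
Record free_dAs (K : fieldType) (X : grVect K) := FreeDAs {
  fcar :> dAs K;
  falpha : X -> fcar;
  falpha_linear : linear falpha;
  falpha_degree : has_degree 0 falpha;
  falpha_univ : forall (V : dAs K) (g : X -> V),
    linear g -> has_degree 0 g ->
    exists! h : dAs_hom fcar V, forall x, h (falpha x) = g x }.

Section Enveloping.
Variables (K : fieldType) (A : binfAlg K) (F : free_dAs A) (S : binf F).

Let alpha := @falpha _ _ F.

Inductive env_rel : F -> Prop :=
| EnvMM i j (a b : Tc A) : (0 < i)%N -> (0 < j)%N ->
    a \in tpow i -> b \in tpow j ->
    env_rel (alpha (bmm A a b) - bmm S (Tmap alpha a) (Tmap alpha b))
| EnvM n (c : Tc A) : (0 < n)%N -> c \in tpow n ->
    env_rel (alpha (bm A c) - bm S (Tmap alpha c)).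

Definition env : dAs K := quotDAs env_rel.
Definition env_map (x : A) : env := quotDAs_pi env_rel (alpha x).

End Enveloping.

Arguments env {K A} F S.
Arguments env_map {K A} F S x.

Section Objects.
Variable K : fieldType.

Definition underlying_obj (und : forall V : dAs K, binf V) :
    DAsCat K -> BinfCat K :=
  fun V : dAs K => BinfAlg (und V).

Definition Tc_obj : BinfCat K -> DAsCat K := @TcAlg K.

Definition env_obj (und : forall V : dAs K, binf V)
    (F : forall X : grVect K, free_dAs X) : BinfCat K -> DAsCat K :=
  fun A : binfAlg K => env (F A) (und (F A)).

End Objects.

(* Main.v *)
From HB Require Import structures.
Require Import Defs.
From mathcomp Require Import all_boot all_order all_algebra.
From mathcomp Require Import boolp classical_sets functions cardinality fsbigop.
From mathcomp Require Import generic_quotient.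
From mathcomp Require Import ring zify.

Set Implicit Arguments.
Unset Strict Implicit.
Unset Printing Implicit Defensive.

Import Order.TTheory GRing.Theory Num.Theory.

Local Open Scope ring_scope.

(** Everything rests on the cofreeness of the tensor coalgebra. A coalgebra map
    [F] from a connected coalgebra to [T^c(X)] is determined by [tau \o F] for
    any linear [tau : T^c(X) -> X] that is the identity on single letters: if two
    such maps agree on smaller elements, then their difference is primitive,
    hence a letter, hence detected by [tau] ([cmap_unique]). Conversely [tau \o F]
    may be prescribed, and [F] is then built by recursion on the size ([cofree]).
    The usual choice of [tau] is [p1], which gives structure maps; the choice
    [tau1] gives the underlying structure of an algebra [V]. There the products
    and differentials of [T^c(V)] and [V] are related by [tau1], so the
    underlying structure exists and is unique, and each of its axioms follows
    from the same axiom in [V] by comparing two coalgebra maps under [tau1].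

    A coderivation is treated as a coalgebra map on the tensor product with a
    coalgebra spanned by [1] and a primitive element [delta], so that one
    uniqueness and one existence statement serve for products and differentials.
    The sources of these maps are tensor products of the coalgebra of words in
    homogeneous letters. They are handled on generators: a coalgebra is a set of
    generators with a list of terms for each coproduct, and signs are those of
    the degrees of generators.

    The adjunction is then formal. A homomorphism out of [(T^c(A), bullet, odot)]
    is determined by its restriction [g] to letters, since words are
    [odot]-products of letters; it is [tau1 \o Tmap g]. Uniqueness under [tau1]
    shows that [tau1 \o Tmap g] respects [bullet] and the differential exactly
    when [Tmap g] commutes with the B-infinity operations of [A] and [V], and
    uniqueness under [p1] shows that this holds exactly when [g] commutes with
    the structure maps ([adj_left], [adj_right]).

    Free algebras are quotients of terms by the identities valid in all algebras.
    The relations dividing the free algebra on [A] make the canonical map from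
    [A] a homomorphism to the underlying structure, so [U(A)] has the same
    universal property as [T^c(A)], and the two are isomorphic. *)

#[local] Obligation Tactic := idtac.

(** * Linearity and signs *)

Section LinearMaps.
Variables (K : fieldType) (U V W : lmodType K).

Lemma linD (f : U -> V) x y : linear f -> f (x + y) = f x + f y.
Proof. by move=> fl; rewrite -{1}[x]scale1r fl scale1r. Qed.

Lemma linZ (f : U -> V) a x : linear f -> f (a *: x) = a *: f x.
Proof. by move=> fl; rewrite -[a *: x]addr0 fl linear0E// addr0. Qed.

Lemma linB (f : U -> V) x y : linear f -> f (x - y) = f x - f y.
Proof. by move=> fl; rewrite linD// -[- y]scaleN1r linZ// scaleN1r. Qed.

Lemma linear_add (f g : U -> V) :
  linear f -> linear g -> linear (fun x => f x + g x).
Proof. by move=> fl gl a x y; rewrite fl gl scalerDr addrACA. Qed.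

Lemma bilin0l (f : U -> V -> W) y : bilin f -> f 0 y = 0.
Proof. by case=> fl _; exact: (linear0E (fl y)). Qed.

Lemma bilin0r (f : U -> V -> W) x : bilin f -> f x 0 = 0.
Proof. by case=> _ fr; exact: (linear0E (fr x)). Qed.

Lemma bilinZl (f : U -> V -> W) a x y : bilin f -> f (a *: x) y = a *: f x y.
Proof. by move=> fb; rewrite -[a *: x]addr0 fb.1 bilin0l// addr0. Qed.

Lemma bilinZr (f : U -> V -> W) a x y : bilin f -> f x (a *: y) = a *: f x y.
Proof. by move=> fb; rewrite -[a *: y]addr0 fb.2 bilin0r// addr0. Qed.

Lemma bilinDl (f : U -> V -> W) x x' y : bilin f ->
  f (x + x') y = f x y + f x' y.
Proof. by move=> fb; rewrite -[x]scale1r fb.1 !scale1r. Qed.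

Lemma bilinDr (f : U -> V -> W) x y y' : bilin f ->
  f x (y + y') = f x y + f x y'.
Proof. by move=> fb; rewrite -[y]scale1r fb.2 !scale1r. Qed.

End LinearMaps.

Section Signs.
Variable K : fieldType.
Implicit Types i j k : int.

Definition ksign i : K := (-1) ^ i.

Lemma ksignD i j : ksign (i + j) = ksign i * ksign j.
Proof. by rewrite /ksign expfzDr// oppr_eq0 oner_eq0. Qed.

Lemma ksign_sq i : ksign i * ksign i = 1.
Proof.
by rewrite /ksign -expfzMl mulrNN mulr1 exp1rz.
Qed.

Lemma ksign_even i j k : i = j + k * 2 -> ksign i = ksign j.
Proof. by move=> ->; rewrite mulrDr mulr1 !ksignD ksign_sq mulr1. Qed.

Lemma ksign0 : ksign 0 = 1. Proof. by []. Qed.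

Lemma ksign_odd i j k : i = j + k * 2 + 1 -> ksign i = - ksign j.
Proof.
move=> ->; rewrite ksignD (ksign_even (j := j) (k := k))//.
by rewrite [ksign 1]expr1z mulrN1.
Qed.

End Signs.
Arguments ksign {K}.
Arguments ksign_even {K i j k}.
Arguments ksign_odd {K i j k}.

(** * Graded connected coalgebras on generators *)

(** A finite sum of tensors of generators, with coefficients, is stored as a
    list; [dsum l h] is the image of this sum under the map sending
    [a (x) b] to [h a b]. *)
Definition dsum (K : fieldType) (G : Type) (l : seq (K * (G * G)))
  (W : lmodType K) (h : G -> G -> W) : W := \sum_(x <- l) x.1 *: h x.2.1 x.2.2.

Section DSum.
Variables (K : fieldType) (G G' : Type) (l : seq (K * (G * G)))
  (l' : seq (K * (G' * G'))) (W W' : lmodType K).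
Implicit Types h : G -> G -> W.

Lemma eq_dsum h h' : (forall a b, h a b = h' a b) -> dsum l h = dsum l h'.
Proof. by move=> hh; apply: eq_bigr => x _; rewrite hh. Qed.

Lemma dsumD h h' : dsum l (fun a b => h a b + h' a b) = dsum l h + dsum l h'.
Proof. by rewrite -big_split/=; apply: eq_bigr => x _; rewrite scalerDr. Qed.

Lemma dsumZ c h : dsum l (fun a b => c *: h a b) = c *: dsum l h.
Proof.
by rewrite scaler_sumr; apply: eq_bigr => x _; rewrite !scalerA mulrC.
Qed.

Lemma dsum0 : dsum l (fun _ _ => 0 : W) = 0.
Proof. by rewrite /dsum big1// => x _; rewrite scaler0. Qed.

Lemma linear_dsum (f : W -> W') h : linear f ->
  f (dsum l h) = dsum l (fun a b => f (h a b)).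
Proof.
by move=> fl; rewrite linear_sumE//; apply: eq_bigr => x _; rewrite linZ.
Qed.

Lemma dsum_exchange (k : G -> G -> G' -> G' -> W) :
  dsum l (fun a b => dsum l' (k a b)) =
  dsum l' (fun c d => dsum l (fun a b => k a b c d)).
Proof.
rewrite /dsum; under eq_bigr do rewrite scaler_sumr.
rewrite exchange_big; apply: eq_bigr => y _/=; rewrite scaler_sumr.
by apply: eq_bigr => x _; rewrite !scalerA mulrC.
Qed.

End DSum.

(** A graded coalgebra with basis [gens], connected for the filtration by
    [gsize]. The axioms are identities between the images of tensors of
    generators under arbitrary functions [h], which stand for multilinear maps;
    this avoids iterated tensor products of modules. [eq_gsum] says that only
    terms of total size [gsize g] and total degree [gdeg g] occur in the
    coproduct of [g]. *)
Record gcoalg (K : fieldType) := GCoalg {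
  gens :> Type;
  gone : gens;
  gsize : gens -> nat;
  gdeg : gens -> int;
  gdec : gens -> seq (K * (gens * gens));
  gone_size : gsize gone = 0%N;
  gone_deg : gdeg gone = 0;
  gsize0 : forall g, gsize g = 0%N -> g = gone;
  eq_gsum : forall (W : lmodType K) g (h h' : gens -> gens -> W),
    (forall a b, (gsize a + gsize b)%N = gsize g -> gdeg a + gdeg b = gdeg g ->
       h a b = h' a b) ->
    dsum (gdec g) h = dsum (gdec g) h';
  gcounitl : forall (W : lmodType K) g (h : gens -> gens -> W),
    dsum (gdec g) (fun a b => if gsize a == 0%N then h a b else 0) = h gone g;
  gcounitr : forall (W : lmodType K) g (h : gens -> gens -> W),
    dsum (gdec g) (fun a b => if gsize b == 0%N then h a b else 0) = h g gone;
  gcoassoc : forall (W : lmodType K) g (h : gens -> gens -> gens -> W),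
    dsum (gdec g) (fun a b => dsum (gdec a) (fun a1 a2 => h a1 a2 b)) =
    dsum (gdec g) (fun a b => dsum (gdec b) (fun b1 b2 => h a b1 b2)) }.

Arguments gone {K g0}.
Arguments gcounitl {K g0 W g} h.
Arguments gcounitr {K g0 W g} h.

Section TensorProduct.
Variables (K : fieldType) (G H : gcoalg K).

Definition tdec (x : G * H) : seq (K * ((G * H) * (G * H))) :=
  [seq (ksign (gdeg a.2.2 * gdeg b.2.1) * a.1 * b.1,
        ((a.2.1, b.2.1), (a.2.2, b.2.2)))
     | a <- gdec x.1, b <- gdec x.2].

Lemma dsum_tdec (W : lmodType K) x (k : G * H -> G * H -> W) :
  dsum (tdec x) k =
  dsum (gdec x.1) (fun a a' => dsum (gdec x.2) (fun b b' =>
    ksign (gdeg a' * gdeg b) *: k (a, b) (a', b'))).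
Proof.
rewrite /dsum /tdec big_allpairs_dep/=; apply: eq_bigr => a _.
rewrite scaler_sumr; apply: eq_bigr => b _ /=; rewrite !scalerA.
by congr (_ *: _); ring.
Qed.

Let tsize (x : G * H) := (gsize x.1 + gsize x.2)%N.
Let tdeg (x : G * H) := gdeg x.1 + gdeg x.2.

Fact tone_size : tsize (gone, gone) = 0%N.
Proof. by rewrite /tsize !gone_size. Qed.

Fact tone_deg : tdeg (gone, gone) = 0.
Proof. by rewrite /tdeg !gone_deg addr0. Qed.

Fact tsize0 x : tsize x = 0%N -> x = (gone, gone).
Proof.
case: x => a b /eqP; rewrite /tsize addn_eq0/= => /andP[/eqP + /eqP].
by move=> /gsize0 -> /gsize0 ->.
Qed.

Fact eq_tsum (W : lmodType K) x (h h' : G * H -> G * H -> W) :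
  (forall a b, (tsize a + tsize b)%N = tsize x -> tdeg a + tdeg b = tdeg x ->
     h a b = h' a b) ->
  dsum (tdec x) h = dsum (tdec x) h'.
Proof.
move=> hh; rewrite !dsum_tdec; apply: eq_gsum => a a' sa da.
apply: eq_gsum => b b' sb db; rewrite hh//.
  by rewrite /tsize /= -sa -sb addnACA.
by rewrite /tdeg /= -da -db addrACA.
Qed.

Fact tcounitl (W : lmodType K) x (h : G * H -> G * H -> W) :
  dsum (tdec x) (fun a b => if tsize a == 0%N then h a b else 0) =
  h (gone, gone) x.
Proof.
rewrite dsum_tdec; under eq_dsum => a a' /=.
  under eq_dsum => b b' /=.
    have -> : ksign (gdeg a' * gdeg b) *:
        (if tsize (a, b) == 0%N then h (a, b) (a', b') else 0) =
      if gsize b == 0%N then if gsize a == 0%N then h (a, b) (a', b') else 0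
      else 0.
      rewrite addn_eq0/=; have [/gsize0 ->|_] := eqVneq (gsize b) 0%N.
        by rewrite gone_deg mulr0 ksign0 scale1r andbT.
      by rewrite andbF scaler0.
    over.
  rewrite gcounitl. over.
by rewrite gcounitl; case: x.
Qed.

Fact tcounitr (W : lmodType K) x (h : G * H -> G * H -> W) :
  dsum (tdec x) (fun a b => if tsize b == 0%N then h a b else 0) =
  h x (gone, gone).
Proof.
rewrite dsum_tdec; under eq_dsum => a a' /=.
  under eq_dsum => b b' /=.
    have -> : ksign (gdeg a' * gdeg b) *:
        (if tsize (a', b') == 0%N then h (a, b) (a', b') else 0) =
      if gsize b' == 0%N then if gsize a' == 0%N then h (a, b) (a', b') else 0
      else 0.
      rewrite addn_eq0/=; have [/gsize0 ->|_] := eqVneq (gsize a') 0%N.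
        rewrite gone_deg mul0r ksign0 scale1r.
        by case: ifP.
      by rewrite scaler0 if_same.
    over.
  rewrite gcounitr. over.
by rewrite gcounitr; case: x.
Qed.

(** With [a1], [a2], [a3] and [b1], [b2], [b3] the three tensor factors on
    either side, both iterated coproducts carry the sign of the permutation
    moving [a2 a3] past [b1] and [a3] past [b2]. *)
Fact tcoassoc (W : lmodType K) x (h : G * H -> G * H -> G * H -> W) :
  dsum (tdec x) (fun a b => dsum (tdec a) (fun a1 a2 => h a1 a2 b)) =
  dsum (tdec x) (fun a b => dsum (tdec b) (fun b1 b2 => h a b1 b2)).
Proof.
pose s (a2 a3 : G) (b1 b2 : H) : K := ksign (gdeg a2 * gdeg b1) *
  ksign (gdeg a3 * gdeg b1) * ksign (gdeg a3 * gdeg b2).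
transitivity (dsum (gdec x.1) (fun a a3 => dsum (gdec a) (fun a1 a2 =>
  dsum (gdec x.2) (fun b b3 => dsum (gdec b) (fun b1 b2 =>
    s a2 a3 b1 b2 *: h (a1, b1) (a2, b2) (a3, b3)))))).
  rewrite dsum_tdec; apply: eq_dsum => a a3; rewrite [RHS]dsum_exchange.
  apply: eq_dsum => b b3; rewrite dsum_tdec -dsumZ/=.
  apply: eq_dsum => a1 a2; rewrite -dsumZ.
  apply: eq_gsum => b1 b2 _ db; rewrite scalerA; congr (_ *: _).
  by rewrite /s -db mulrDr ksignD; ring.
under eq_dsum do under eq_dsum do rewrite gcoassoc.
rewrite gcoassoc dsum_tdec; apply: eq_dsum => a1 a; rewrite [LHS]dsum_exchange.
apply: eq_dsum => b1 b; rewrite dsum_tdec -dsumZ/=.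
apply: eq_gsum => a2 a3 _ da; rewrite -dsumZ; apply: eq_dsum => b2 b3.
rewrite scalerA; congr (_ *: _).
by rewrite /s -da mulrDl ksignD; ring.
Qed.

Definition tcoalg : gcoalg K :=
  GCoalg tone_size tone_deg tsize0 eq_tsum tcounitl tcounitr tcoassoc.

End TensorProduct.

Lemma tcoalg_dsum (K : fieldType) (G H : gcoalg K) (W : lmodType K)
    (x : tcoalg G H) (k : tcoalg G H -> tcoalg G H -> W) :
  dsum (gdec x) k =
  dsum (gdec x.1) (fun a a' => dsum (gdec x.2) (fun b b' =>
    ksign (gdeg a' * gdeg b) *: k (a, b) (a', b'))).
Proof. exact: dsum_tdec. Qed.

(** The coalgebra spanned by [1] and a primitive [delta] of degree [k]. Tensoring
    with it turns coderivations into coalgebra maps: [F] on [1 (x) G] and [D] on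
    [delta (x) G] form a coalgebra map exactly when [F] is one and [D] is a
    coderivation of degree [k] along [F]. *)
Section Primitive.
Variables (K : fieldType) (k : int).

Definition prim_dec (b : bool) : seq (K * (bool * bool)) :=
  if b then [:: (1, (false, true)); (1, (true, false))]
  else [:: (1, (false, false))].

Lemma dsum_prim (W : lmodType K) b (h : bool -> bool -> W) :
  dsum (prim_dec b) h =
  if b then h false true + h true false else h false false.
Proof. by case: b; rewrite /dsum !(big_cons, big_nil) !scale1r addr0. Qed.

Program Definition prim : gcoalg K :=
  @GCoalg K bool false nat_of_bool (fun b => if b then k else 0) prim_dec
    erefl erefl _ _ _ _ _.
Next Obligation. by case. Qed.
Next Obligation.
move=> W g h h' hh; rewrite !dsum_prim; case: g hh => hh; last exact: hh.
by rewrite !hh ?add0r ?addr0.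
Qed.
Next Obligation.
by move=> W g h; rewrite dsum_prim; case: g; rewrite /= ?addr0.
Qed.
Next Obligation.
by move=> W g h; rewrite dsum_prim; case: g; rewrite /= ?add0r.
Qed.
Next Obligation.
by move=> W g h; rewrite !dsum_prim; case: g; rewrite ?addrA.
Qed.

End Primitive.

Lemma prim_dsum (K : fieldType) k (W : lmodType K) (b : prim K k)
    (h : prim K k -> prim K k -> W) :
  dsum (gdec b) h = if b then h false true + h true false else h false false.
Proof. exact: dsum_prim. Qed.

(** * Coalgebra maps into the tensor coalgebra *)

Section TensorCoalgebra.
Variables (K : fieldType) (X : grVect K).
Implicit Types (a b z : tensV X) (x : X).

Lemma Delta_Tone : Delta (Tone X) = Tone X \ox Tone X.
Proof. by rewrite DeltaE big_ord_recl big_ord0 addr0. Qed.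

Definition counit_l : tens (tensV X) (tensV X) -> tensV X :=
  tenlift (fun a b => counit a *: b).

Lemma counit_l_bilin : bilin (fun a b => counit a *: b).
Proof.
split=> [b|a] c u v; last by rewrite scalerDr !scalerA mulrC.
by rewrite counit_linear scalerDl scalerA.
Qed.

Lemma counit_l_linear : linear counit_l.
Proof. exact: tenlift_linear counit_l_bilin. Qed.

Lemma counit_lE a b : counit_l (a \ox b) = counit a *: b.
Proof. exact: tenliftE counit_l_bilin. Qed.

Lemma counit_l_Delta a : counit_l (Delta a) = a.
Proof.
move: a; apply: tensV_ext => [|//|s].
  exact: (linear_comp counit_l_linear (@Delta_linear K X)).
rewrite DeltaE (linear_sumE counit_l_linear) big_ord_recl counit_lE take0 drop0.
rewrite counitE scale1r big1 ?addr0// => i _.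
by case: s i => [[]//|y s] i; rewrite counit_lE counitE scale0r.
Qed.

Definition lcons_p1 : tens (tensV X) (tensV X) -> tensV X :=
  tenlift (fun a b => lcons (p1 a) b).

Lemma lcons_p1_bilin : bilin (fun a b => lcons (p1 a) b).
Proof.
split=> [b|a] c u v; last exact: lcons_linear.
by rewrite p1_linear lcons_linl.
Qed.

Lemma lcons_p1_linear : linear lcons_p1.
Proof. exact: tenlift_linear lcons_p1_bilin. Qed.

Lemma lcons_p1E a b : lcons_p1 (a \ox b) = lcons (p1 a) b.
Proof. exact: tenliftE lcons_p1_bilin. Qed.

Lemma p1_word s : p1 (word s) = if s is [:: x] then x else 0 :> X.
Proof. by rewrite /p1 tliftE//; exact: p1_multilin. Qed.

Lemma p1_Tone : p1 (Tone X) = 0.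
Proof. exact: p1_word. Qed.

Lemma lcons0 a : lcons (0 : X) a = 0.
Proof. exact: (linear0E (@lcons_linl _ _ _)). Qed.

(** In the coproduct of a nonempty word the only term with a single letter on the
    left is the one that splits off the first letter. This makes tensors
    accessible to recursion through their coproducts. *)
Lemma lcons_p1_Delta a : a = counit a *: Tone X + lcons_p1 (Delta a).
Proof.
move: a; apply: (tensV_ext (f := id)) => [//||s].
  apply: linear_add; last exact: (linear_comp lcons_p1_linear (@Delta_linear K X)).
  by move=> c u v; rewrite counit_linear scalerDl scalerA.
rewrite counitE DeltaE (linear_sumE lcons_p1_linear) big_ord_recl lcons_p1E.
rewrite take0 p1_Tone lcons0 add0r.
case: s => [|y s]; first by rewrite big_ord0 scale1r addr0.
rewrite scale0r add0r big_ord_recl lcons_p1E/= drop0 take0 p1E lconsE.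
rewrite big1 ?addr0// => i _; rewrite lcons_p1E/=.
case: s i => [[]//|y' s] i.
by rewrite p1_word lcons0.
Qed.

(** By [lcons_p1_Delta]: in the coproduct of a primitive tensor nothing follows a
    first letter, and the counit law makes its counit vanish. *)
Lemma primitive_letter z : Delta z = z \ox Tone X + Tone X \ox z ->
  z = word [:: p1 z].
Proof.
move=> Dz; have tl := @tprod_bilin K (tensV X) (tensV X).
have ez : counit z = 0.
  have := counit_l_Delta z.
  rewrite Dz (linD _ _ counit_l_linear) !counit_lE counitE scale1r addrC.
  rewrite -[RHS]addr0 => /addrI/(congr1 (@counit K X)).
  rewrite (linZ _ _ (@counit_linear K X)) (linear0E (@counit_linear K X)) counitE.
  by rewrite /GRing.scale/= mulr1.
rewrite {1}(lcons_p1_Delta z) ez scale0r add0r Dz (linD _ _ lcons_p1_linear).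
by rewrite !lcons_p1E p1_Tone lcons0 addr0 lconsE.
Qed.

Definition lcons_l x : tens (tensV X) (tensV X) -> tens (tensV X) (tensV X) :=
  tenlift (fun a b => lcons x a \ox b).

Lemma lcons_l_bilin x : bilin (fun a b => lcons x a \ox b).
Proof.
split=> [b|a] c u v; last exact: tprodr.
by rewrite lcons_linear tprodl.
Qed.

Lemma lcons_l_linear x : linear (lcons_l x).
Proof. exact: tenlift_linear (lcons_l_bilin x). Qed.

Lemma lcons_lE x a b : lcons_l x (a \ox b) = lcons x a \ox b.
Proof. exact: tenliftE (lcons_l_bilin x). Qed.

(** The recursive form of deconcatenation, on which the inductions on the length
    of words rely. *)
Lemma Delta_lcons x a :
  Delta (lcons x a) = Tone X \ox lcons x a + lcons_l x (Delta a).
Proof.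
have Dl := @Delta_linear K X; have ll := @lcons_linear K X x.
move: a; apply: tensV_ext => [||s].
- exact: (linear_comp Dl ll).
- apply: linear_add; first exact: (linear_comp (@tprodr _ _ _ _) ll).
  exact: (linear_comp (@lcons_l_linear x) Dl).
rewrite lconsE !DeltaE (linear_sumE (lcons_l_linear x)) big_ord_recl.
congr (_ + _); apply: eq_bigr => i _.
by rewrite lcons_lE lconsE.
Qed.

Lemma counit_lcons x a : counit (lcons x a) = 0.
Proof.
move: a; apply: tensV_ext => [c u v|c u v|s].
- by rewrite lcons_linear counit_linear.
- by rewrite scaler0 addr0.
by rewrite lconsE counitE.
Qed.

Lemma p1_lcons x a : p1 (lcons x a) = counit a *: x.
Proof.
move: a; apply: tensV_ext => [c u v|c u v|s].
- by rewrite lcons_linear p1_linear.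
- by rewrite counit_linear scalerDl scalerA.
rewrite lconsE counitE.
case: s => [|y s]; first by rewrite p1E scale1r.
by rewrite scale0r p1_word.
Qed.

End TensorCoalgebra.

(** A coalgebra map from the coalgebra with basis [G], given on the basis. *)
Definition cmap (K : fieldType) (G : gcoalg K) (X : grVect K)
    (F : G -> tensV X) : Prop :=
  F gone = Tone X /\
  forall g, Delta (F g) = dsum (gdec g) (fun a b => F a \ox F b).

(** Both projections used here, [p1] and [tau1], are instances. *)
Definition projection (K : fieldType) (X : grVect K) (tau : tensV X -> X) :=
  linear tau /\ forall x, tau (word [:: x]) = x.

Section Cofree.
Variables (K : fieldType) (X : grVect K) (tau : tensV X -> X).
Hypothesis tauP : projection tau.
Let tl : linear tau := tauP.1.

Lemma primitive_eq0 (z : tensV X) :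
  Delta z = z \ox Tone X + Tone X \ox z -> tau z = 0 -> z = 0.
Proof.
by move=> /primitive_letter ->; rewrite tauP.2 => ->; rewrite -lconsE lcons0.
Qed.

(** By induction on the size, the difference of the two maps is primitive. *)
Lemma cmap_unique (G : gcoalg K) (F F' : G -> tensV X) :
  cmap F -> cmap F' -> (forall g, tau (F g) = tau (F' g)) ->
  forall g, F g = F' g.
Proof.
move=> [F1 FD] [F'1 F'D] FF' g.
have [n] := ubnP (gsize g); elim: n g => // n IH g gn.
have [/eqP/gsize0 ->|g0] := boolP (gsize g == 0%N); first by rewrite F1 F'1.
apply/eqP; rewrite -subr_eq0; apply/eqP/primitive_eq0; last first.
  by rewrite linB// FF' subrr.
rewrite (linB _ _ (@Delta_linear K X)) FD F'D.
transitivity (dsum (gdec g) (fun a b => F a \ox F b - F' a \ox F' b)).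
  rewrite -scaleN1r -dsumZ -dsumD; apply: eq_dsum => a b.
  by rewrite scaleN1r.
(* The terms [g (x) 1] and [1 (x) g] are the ones at which [F] and [F'] may
   still differ. *)
rewrite -(gcounitr (fun a _ => (F a - F' a) \ox Tone X)).
rewrite -(gcounitl (fun _ b => Tone X \ox (F b - F' b))) -dsumD.
have tb := @tprod_bilin K (tensV X) (tensV X).
apply: eq_gsum => a b sab _.
have [sa|sa] := eqVneq (gsize a) 0%N.
  rewrite (gsize0 sa) F1 F'1; have [sb|sb] := eqVneq (gsize b) 0%N.
    by move: g0; rewrite -sab sa sb.
  by rewrite add0r (linB _ _ (tb.2 _)).
rewrite addr0; have [sb|sb] := eqVneq (gsize b) 0%N.
  by rewrite (gsize0 sb) F1 F'1 (linB _ _ (tb.1 _)).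
by rewrite (IH a) ?(IH b) ?subrr//; lia.
Qed.

End Cofree.

Lemma counit_cmap (K : fieldType) (X : grVect K) (G : gcoalg K)
    (F : G -> tensV X) g : cmap F -> counit (F g) = (gsize g == 0%N)%:R.
Proof.
move=> [F1 FD]; have [n] := ubnP (gsize g); elim: n g => // n IH g gn.
have [/gsize0 ->|g0] := eqVneq (gsize g) 0%N; first by rewrite F1 counitE.
have := congr1 (@counit K X) (counit_l_Delta (F g)).
rewrite FD (linear_dsum _ _ (@counit_l_linear K X)).
rewrite (linear_dsum _ _ (@counit_linear K X)).
rewrite (_ : dsum _ _ = counit (F g) + counit (F g)).
  by rewrite -[RHS]addr0 => /addrI.
rewrite -{1}(gcounitr (fun a _ => counit (F a))).
rewrite -(gcounitl (fun _ b => counit (F b))) -dsumD.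
apply: eq_gsum => a b sab _.
rewrite counit_lE (linZ _ _ (@counit_linear K X)).
have [sa|sa] := eqVneq (gsize a) 0%N.
  rewrite (gsize0 sa) F1 counitE scale1r; have [sb|sb] := eqVneq (gsize b) 0%N.
    by move: g0; rewrite -sab sa sb.
  by rewrite add0r.
rewrite addr0; have [sb|sb] := eqVneq (gsize b) 0%N.
  by rewrite (gsize0 sb) F1 counitE /GRing.scale/= mulr1.
rewrite (IH a); last by lia.
by rewrite (negbTE sa) scale0r.
Qed.

(** A class [LF] of maps [X -> G], thought of as words with a hole for one
    letter, which the coproduct preserves: it moves the hole into one of the two
    factors. A function on [G] is multilinear if it is linear along [LF]. *)
Definition linear_families (K : fieldType) (X : lmodType K) (G : gcoalg K)
    (LF : (X -> G) -> Prop) : Prop :=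
  (forall c, LF c -> forall x,
     [/\ gsize (c x) = gsize (c 0), gsize (c x) != 0%N &
         gdeg (c x) = gdeg (c 0)]) /\
  (forall c (W : lmodType K) (h : G -> G -> W), LF c ->
     (forall c' b, LF c' -> (gsize (c' 0%R) + gsize b)%N = gsize (c 0) ->
        linear (fun x => h (c' x) b)) ->
     (forall a c', LF c' -> (gsize a + gsize (c' 0%R))%N = gsize (c 0) ->
        linear (fun x => h a (c' x))) ->
     linear (fun x => dsum (gdec (c x)) h)).

Section Homogeneous.
Variables (K : fieldType) (X : grVect K).

Lemma homogD (V : grVect K) n (x y : V) : homog n x -> homog n y ->
  homog n (x + y).
Proof. by move=> xn yn; rewrite /homog (linD _ _ (@gpr_linear _ _ _)) xn yn. Qed.

Lemma homogZ (V : grVect K) n c (x : V) : homog n x -> homog n (c *: x).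
Proof. by move=> xn; rewrite /homog (linZ _ _ (@gpr_linear _ _ _)) xn. Qed.

Lemma homog0 (V : grVect K) n : homog n (0 : V).
Proof. exact: (linear0E (@gpr_linear _ _ _)). Qed.

Lemma homog_gsum (V : grVect K) (G : gcoalg K) (g : G) n (h : G -> G -> V) :
  (forall a b, (gsize a + gsize b)%N = gsize g -> gdeg a + gdeg b = gdeg g ->
     homog n (h a b)) -> homog n (dsum (gdec g) h).
Proof.
move=> hn; rewrite /homog (linear_dsum _ _ (@gpr_linear _ _ _)).
by apply: eq_gsum => a b /hn; exact.
Qed.

Lemma homog_letter n (x : X) : homog n x -> homog (V := Tc X) n (word [:: x]).
Proof.
move=> xn; rewrite -[n]addr0; apply: hword_homog.
by apply: HCons => //; exact: HNil.
Qed.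

Lemma homog_lcons m n (x : X) (a : tensV X) : homog m x ->
  homog (V := Tc X) n a -> homog (V := Tc X) (m + n) (lcons x a).
Proof.
move=> xm /homog_span an; apply: (span_homog (f := lcons x : _ -> Tc X)) an.
  exact: lcons_linear.
by move=> _ [s sn ->]; rewrite lconsE; exact/hword_homog/HCons.
Qed.

Lemma p1_degree : has_degree 0 (@p1 K X : Tc X -> X).
Proof.
move=> n a /homog_span an; rewrite addr0; apply: span_homog an.
  exact: p1_linear.
move=> _ [s sn ->]; case: sn => [|i x k t xi]; first by rewrite p1_Tone; exact: homog0.
case=> [|j y m t' yj _]; first by rewrite addr0 p1E.
by rewrite p1_word; exact: homog0.
Qed.

End Homogeneous.

Section CofreeExistence.
Variables (K : fieldType) (X : grVect K) (tau : tensV X -> X).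
Hypothesis tauP : projection tau.
Let tl : linear tau := tauP.1.

Variables (G : gcoalg K) (psi : G -> X).
Hypothesis psi1 : psi gone = tau (Tone X).

Definition cofree_tail (F : G -> tensV X) (g : G) : tensV X :=
  dsum (gdec g) (fun a b => if (gsize a == 0%N) || (gsize b == 0%N) then 0
                            else lcons (p1 (F a)) (F b)).

Fixpoint cofree_rec (n : nat) (g : G) : tensV X :=
  if n is n'.+1 then
    if gsize g == 0%N then Tone X else
    let r := cofree_tail (cofree_rec n') g in r + word [:: psi g - tau r]
  else Tone X.

(** The coalgebra map [F] with [tau \o F = psi]. As
    [F g = counit g + sum lcons (p1 (F g')) (F g'')] over the coproduct of [g],
    only the single-letter part [p1 (F g)] is not given by the values of [F] at
    smaller generators; it is adjusted to make [tau (F g) = psi g]. *)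
Definition cofree (g : G) : tensV X := cofree_rec (gsize g) g.

Lemma eq_cofree_tail F F' g :
  (forall a, (gsize a < gsize g)%N -> F a = F' a) ->
  cofree_tail F g = cofree_tail F' g.
Proof.
move=> FF'; apply: eq_gsum => a b sab _.
by case: eqP => //= sa; case: eqP => //= sb; rewrite !FF'//; lia.
Qed.

Lemma cofree_rec_fuel n m g : (gsize g <= n)%N -> (gsize g <= m)%N ->
  cofree_rec n g = cofree_rec m g.
Proof.
elim: n m g => [|n IH] [|m] g //=; rewrite ?leqn0.
- by move=> -> _.
- by move=> _ ->.
move=> gn gm; case: eqP => // g0.
by rewrite (@eq_cofree_tail _ (cofree_rec m))// => a ag; apply: IH; lia.
Qed.

Lemma cofree1 : cofree gone = Tone X.
Proof. by rewrite /cofree gone_size. Qed.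

Lemma cofreeE g : gsize g != 0%N ->
  cofree g = cofree_tail cofree g + word [:: psi g - tau (cofree_tail cofree g)].
Proof.
rewrite /cofree; case E : (gsize g) => [//|n] _ /=; rewrite E/=.
rewrite (@eq_cofree_tail _ (fun a => cofree_rec (gsize a) a))// => a.
by rewrite E => an; apply: cofree_rec_fuel; lia.
Qed.

Lemma tau_cofree g : tau (cofree g) = psi g.
Proof.
have [/gsize0 ->|g0] := eqVneq (gsize g) 0%N; first by rewrite cofree1.
by rewrite cofreeE// linD// tauP.2 addrC subrK.
Qed.

Lemma counit_cofree g : gsize g != 0%N -> counit (cofree g) = 0.
Proof.
move=> g0; rewrite cofreeE// (linD _ _ (@counit_linear K X)) counitE addr0.
rewrite (linear_dsum _ _ (@counit_linear K X)) -[RHS](dsum0 (gdec g)).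
apply: eq_dsum => a b; case: ifP => _; last exact: counit_lcons.
exact: (linear0E (@counit_linear K X)).
Qed.

Lemma p1_cofree g : gsize g != 0%N ->
  p1 (cofree g) = psi g - tau (cofree_tail cofree g).
Proof.
move=> g0; rewrite {1}cofreeE// (linD _ _ (@p1_linear K X)) p1E.
rewrite (linear_dsum _ _ (@p1_linear K X)) -[RHS]add0r.
congr (_ + _); rewrite -[RHS](dsum0 (gdec g)).
apply: eq_dsum => a b; case: eqP => [_|_]; first exact: (linear0E (@p1_linear K X)).
case: eqP => [_|/eqP b0] /=; first exact: (linear0E (@p1_linear K X)).
by rewrite p1_lcons counit_cofree// scale0r.
Qed.

Lemma cofree_step g : cofree g = (gsize g == 0%N)%:R *: Tone X +
  dsum (gdec g) (fun a b => lcons (p1 (cofree a)) (cofree b)).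
Proof.
have [/gsize0 ->|g0] := eqVneq (gsize g) 0%N.
  rewrite cofree1 scale1r -{1}[Tone X]addr0; congr (_ + _).
  rewrite -[LHS](dsum0 (gdec (gone : G))); apply: eq_gsum => a b.
  rewrite gone_size => /eqP; rewrite addn_eq0 => /andP[/eqP/gsize0 -> _] _.
  by rewrite cofree1 p1_Tone lcons0.
rewrite scale0r add0r {1}cofreeE//.
have -> : word [:: psi g - tau (cofree_tail cofree g)] =
    lcons (p1 (cofree g)) (cofree gone).
  by rewrite p1_cofree// cofree1 lconsE.
rewrite -(gcounitr (fun a b => lcons (p1 (cofree a)) (cofree b))) -dsumD.
apply: eq_gsum => a b sab _.
have [/gsize0 ->|sa] := eqVneq (gsize a) 0%N.
  by rewrite cofree1 p1_Tone !lcons0 if_same addr0.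
by case: eqP => _; rewrite ?add0r ?addr0.
Qed.

(** Coassociativity turns the recursion for [F] at the first factors of the
    coproduct of [g] into the recursion for the coproduct of [F g]. *)
Lemma cofree_cmap : cmap cofree.
Proof.
split=> [|g]; first exact: cofree1.
have [n] := ubnP (gsize g); elim: n g => // n IH g gn.
have tb := @tprod_bilin K (tensV X) (tensV X).
have Dl := @Delta_linear K X.
transitivity (Tone X \ox cofree g + dsum (gdec g)
  (fun a b => lcons_l (p1 (cofree a)) (Delta (cofree b)))).
  rewrite {1}cofree_step (linD _ _ Dl) (linZ _ _ Dl) Delta_Tone.
  rewrite (linear_dsum _ _ Dl) {1}cofree_step (bilinDr _ _ _ tb).
  rewrite (bilinZr _ _ _ tb) -addrA; congr (_ + _).
  rewrite (linear_dsum _ _ (tb.2 _)) -dsumD.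
  by apply: eq_dsum => a b; exact: Delta_lcons.
transitivity (Tone X \ox cofree g + dsum (gdec g) (fun a b =>
    dsum (gdec b) (fun b1 b2 =>
      lcons (p1 (cofree a)) (cofree b1) \ox cofree b2))).
  congr (_ + _); apply: eq_gsum => a b sab _.
  have [/gsize0 ->|sa] := eqVneq (gsize a) 0%N.
    rewrite cofree1 p1_Tone.
    have l0 : forall z, lcons_l (0 : X) z = 0.
      apply: tens_ext => [|c u v|u v]; first exact: lcons_l_linear.
        by rewrite scaler0 addr0.
      by rewrite lcons_lE lcons0 (bilin0l _ tb).
    rewrite l0 -[LHS](dsum0 (gdec b)); apply: eq_dsum => b1 b2.
    by rewrite lcons0 (bilin0l _ tb).
  rewrite IH; last by lia.
  rewrite (linear_dsum _ _ (@lcons_l_linear K X _)).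
  by apply: eq_dsum => b1 b2; rewrite lcons_lE.
rewrite -(gcoassoc g (fun a b c =>
  lcons (p1 (cofree a)) (cofree b) \ox cofree c)).
rewrite -(gcounitl (fun _ b => Tone X \ox cofree b)) -dsumD.
apply: eq_dsum => a b; rewrite (cofree_step a) (bilinDl _ _ _ tb).
rewrite (bilinZl _ _ _ tb) (linear_dsum _ _ (tb.1 _)).
by congr (_ + _); case: eqP => _; rewrite ?scale1r ?scale0r.
Qed.

Lemma cofree_linear (Y : lmodType K) (LF : (Y -> G) -> Prop) :
  linear_families LF -> (forall c, LF c -> linear (fun x => psi (c x))) ->
  forall c, LF c -> linear (fun x => cofree (c x)).
Proof.
move=> [LFs LFd] LFpsi c.
have [n] := ubnP (gsize (c 0)); elim: n c => // n IH c cn cLF.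
have LFs0 c' x : LF c' -> gsize (c' x) = gsize (c' 0) by move=> /LFs/(_ x)[].
have rl : linear (fun x => cofree_tail cofree (c x)).
  apply: LFd => // [c' b c'LF sc|a c' c'LF sc] k u v /=; rewrite !(LFs0 c' _ c'LF).
    have [_|a0] := eqVneq (gsize (c' 0)) 0%N; first by rewrite scaler0 addr0.
    have [_|b0] := eqVneq (gsize b) 0%N; first by rewrite scaler0 addr0.
    rewrite (IH c')//; last by lia.
    by rewrite p1_linear lcons_linl.
  have [_|a0] := eqVneq (gsize a) 0%N; first by rewrite scaler0 addr0.
  have [_|b0] := eqVneq (gsize (c' 0)) 0%N; first by rewrite scaler0 addr0.
  rewrite (IH c')//; last by lia.
  by rewrite lcons_linear.
have pl := LFpsi _ cLF.
have cn0 x : gsize (c x) != 0%N by have [] := LFs _ cLF x.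
move=> k u v; rewrite !cofreeE// rl scalerDr addrACA.
congr (_ + _); rewrite -(word_multilin [::] [::]) pl; congr (word [:: _]).
by rewrite tl scalerBr opprD addrACA.
Qed.

Lemma cofree_homog : has_degree 0 (tau : Tc X -> X) ->
  (forall g, homog (gdeg g) (psi g)) ->
  forall g, homog (V := Tc X) (gdeg g) (cofree g).
Proof.
move=> tau0 psid g.
have [n] := ubnP (gsize g); elim: n g => // n IH g gn.
have [/gsize0 ->|g0] := eqVneq (gsize g) 0%N.
  by rewrite gone_deg cofree1; exact: Tone_homog.
have rh : homog (V := Tc X) (gdeg g) (cofree_tail cofree g).
  apply: (homog_gsum (V := Tc X)) => a b sab dab.
  have [_|a0] := eqVneq (gsize a) 0%N; first exact: homog0.
  have [_|b0] := eqVneq (gsize b) 0%N; first exact: homog0.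
  rewrite -dab; apply: homog_lcons; last by apply: IH; lia.
  by rewrite -[gdeg a]addr0; apply: p1_degree; apply: IH; lia.
rewrite cofreeE//; apply: (homogD (V := Tc X)) => //; apply: homog_letter.
apply: homogD => //; rewrite -scaleN1r; apply: homogZ.
by rewrite -[gdeg g]addr0; exact: tau0.
Qed.

End CofreeExistence.

(** * The coalgebra of homogeneous words *)

Section LinearFamilies.
Variables (K : fieldType) (X : lmodType K).

Lemma no_family (G : gcoalg K) : linear_families (fun _ : X -> G => False).
Proof. by []. Qed.

Variables (G H : gcoalg K) (LG : (X -> G) -> Prop) (LH : (X -> H) -> Prop).

Definition tfamily (c : X -> tcoalg G H) : Prop :=
  (exists c' b, LG c' /\ c = fun x => (c' x, b)) \/
  (exists a c', LH c' /\ c = fun x => (a, c' x)).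

Lemma tfamily_linear : linear_families LG -> linear_families LH ->
  linear_families tfamily.
Proof.
move=> [LGs LGd] [LHs LHd]; split.
  move=> _ [[c [b [cL ->]]]|[a [c [cL ->]]]] x /=.
    by have [-> c0 ->] := LGs c cL x; split=> //; rewrite addn_eq0 negb_and c0.
  by have [-> c0 ->] := LHs c cL x; split=> //; rewrite addn_eq0 negb_and c0 orbT.
move=> _ W h [[c [b [cL ->]]]|[a [c [cL ->]]]] hl hr.
  under eq_fun do rewrite tcoalg_dsum.
  apply: (LGd c W (fun a a' => dsum (gdec b) (fun d d' =>
    ksign (gdeg a' * gdeg d) *: h (a, d) (a', d'))) cL).
    move=> c' a c'L sc k u v /=; rewrite -dsumZ -dsumD.
    apply: eq_gsum => d d' sd _; rewrite (hl (fun x => (c' x, d)))//=.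
    - by rewrite scalerDr !scalerA mulrC.
    - by left; exists c', d.
    - by rewrite -sd -sc addnACA.
  move=> a c' c'L sc k u v /=; rewrite -dsumZ -dsumD.
  apply: eq_gsum => d d' sd _; rewrite (hr (a, d) (fun x => (c' x, d')))//=.
  - have dc x : gdeg (c' x) = gdeg (c' 0) by have [] := LGs c' c'L x.
    by rewrite !dc scalerDr !scalerA mulrC.
  - by left; exists c', d'.
  - by rewrite -sd -sc addnACA.
under eq_fun do rewrite tcoalg_dsum dsum_exchange.
apply: (LHd c W (fun d d' => dsum (gdec a) (fun b b' =>
  ksign (gdeg b' * gdeg d) *: h (b, d) (b', d'))) cL).
  move=> c' d c'L sc k u v /=; rewrite -dsumZ -dsumD.
  apply: eq_gsum => b b' sb _; rewrite (hl (fun x => (b, c' x)))//=.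
  - have dc x : gdeg (c' x) = gdeg (c' 0) by have [] := LHs c' c'L x.
    by rewrite !dc scalerDr !scalerA mulrC.
  - by right; exists b, c'.
  - by rewrite -sb -sc addnACA.
move=> d c' c'L sc k u v /=; rewrite -dsumZ -dsumD.
apply: eq_gsum => b b' sb _; rewrite (hr (b, d) (fun x => (b', c' x)))//=.
- by rewrite scalerDr !scalerA mulrC.
- by right; exists b', c'.
- by rewrite -sb -sc addnACA.
Qed.

End LinearFamilies.

Section Words.
Variables (K : fieldType) (X : grVect K).

(** Koszul signs depend on the degrees of the letters, so the generators are words
    in homogeneous letters; these span all words. *)
Record letter := Letter { ldeg : int; lval : X; lvalP : homog ldeg lval }.

(** Projecting makes every vector a letter of degree [i], linearly in the vector,
    which is what the hole of [wfamily] requires. *)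
Definition mkletter (i : int) (x : X) : letter := Letter (gpr_homog i x).

Lemma letter_eq (l l' : letter) : ldeg l = ldeg l' -> lval l = lval l' -> l = l'.
Proof.
case: l l' => [i x p] [j y q] /= ij xy; case: _ / ij in q *.
by case: _ / xy in q *; congr Letter; exact: Prop_irrelevance.
Qed.

Lemma mkletterE l : mkletter (ldeg l) (lval l) = l.
Proof. by apply: letter_eq => //=; exact: lvalP. Qed.

Definition wdeg (w : seq letter) : int := foldr (fun l d => ldeg l + d) 0 w.

Definition wval (w : seq letter) : tensV X := word (map lval w).

Fixpoint wdec (w : seq letter) : seq (K * (seq letter * seq letter)) :=
  (1, ([::], w)) :: (if w is l :: w' then
    [seq (x.1, (l :: x.2.1, x.2.2)) | x <- wdec w'] else [::]).

Section DSumWDec.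
Variable W : lmodType K.
Implicit Types h : seq letter -> seq letter -> W.

Lemma dsum_wdec0 h : dsum (wdec [::]) h = h [::] [::].
Proof. by rewrite /dsum big_seq1 scale1r. Qed.

Lemma dsum_wdec_cons l w h : dsum (wdec (l :: w)) h =
  h [::] (l :: w) + dsum (wdec w) (fun a b => h (l :: a) b).
Proof. by rewrite /dsum /= big_cons big_map scale1r. Qed.

End DSumWDec.

Fact eq_wsum (W : lmodType K) w (h h' : seq letter -> seq letter -> W) :
  (forall a b, (size a + size b)%N = size w -> wdeg a + wdeg b = wdeg w ->
     h a b = h' a b) ->
  dsum (wdec w) h = dsum (wdec w) h'.
Proof.
elim: w h h' => [|l w IH] h h' hh; first by rewrite !dsum_wdec0 hh ?addr0.
rewrite !dsum_wdec_cons hh ?add0r//; congr (_ + _).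
by apply: IH => a b sab dab; rewrite hh//= ?addSn ?sab// -addrA dab.
Qed.

Fact wcounitl (W : lmodType K) w (h : seq letter -> seq letter -> W) :
  dsum (wdec w) (fun a b => if size a == 0%N then h a b else 0) = h [::] w.
Proof.
case: w => [|l w]; first by rewrite dsum_wdec0.
by rewrite dsum_wdec_cons dsum0 addr0.
Qed.

Fact wcounitr (W : lmodType K) w (h : seq letter -> seq letter -> W) :
  dsum (wdec w) (fun a b => if size b == 0%N then h a b else 0) = h w [::].
Proof.
elim: w h => [|l w IH] h; first by rewrite dsum_wdec0.
by rewrite dsum_wdec_cons/= add0r (IH (fun a b => h (l :: a) b)).
Qed.

Fact wcoassoc (W : lmodType K) w
    (h : seq letter -> seq letter -> seq letter -> W) :
  dsum (wdec w) (fun a b => dsum (wdec a) (fun a1 a2 => h a1 a2 b)) =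
  dsum (wdec w) (fun a b => dsum (wdec b) (fun b1 b2 => h a b1 b2)).
Proof.
elim: w h => [|l w IH] h; first by rewrite !dsum_wdec0.
rewrite !dsum_wdec_cons dsum_wdec0 -addrA; congr (_ + _).
under eq_dsum do rewrite dsum_wdec_cons.
by rewrite dsumD IH.
Qed.

Program Definition words : gcoalg K :=
  @GCoalg K (seq letter) [::] size wdeg wdec erefl erefl _
    eq_wsum wcounitl wcounitr wcoassoc.
Next Obligation. by case. Qed.

Lemma wval_cons l (w : words) : wval (l :: w) = lcons (lval l) (wval w).
Proof. by rewrite /wval lconsE. Qed.

Lemma wval_cmap : cmap (wval : words -> tensV X).
Proof.
split=> // w /=; elim: w => [|l w IH]; first by rewrite dsum_wdec0 Delta_Tone.
rewrite dsum_wdec_cons wval_cons Delta_lcons IH; congr (_ + _).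
rewrite (linear_dsum _ _ (@lcons_l_linear K X _)).
by apply: eq_dsum => a b; rewrite lcons_lE wval_cons.
Qed.

Lemma wval_homog (w : words) : homog (V := Tc X) (gdeg w) (wval w).
Proof.
apply: hword_homog; elim: w => [|l w IH] /=; first exact: HNil.
by apply: HCons => //; exact: lvalP.
Qed.

Lemma hword_wval n s : hword n s ->
  exists2 w : words, gdeg w = n & word s = wval w.
Proof.
move=> ns; suff [w [<- ->]] : exists w, wdeg w = n /\ s = map lval w by exists w.
elim: ns => [|i x m t xi _ [w [<- ->]]]; first by exists [::].
by exists (Letter xi :: w).
Qed.

Lemma wval_ext (W : lmodType K) (f g : tensV X -> W) : linear f -> linear g ->
  (forall w, f (wval w) = g (wval w)) -> forall a, f a = g a.
Proof.
by move=> fl gl fg; apply: hword_ext => // n s /hword_wval[w _ ->].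
Qed.

Lemma homog_wval_ext (W : lmodType K) n (f g : tensV X -> W) :
  linear f -> linear g ->
  (forall w : words, gdeg w = n -> f (wval w) = g (wval w)) ->
  forall a, homog (V := Tc X) n a -> f a = g a.
Proof.
move=> fl gl fg a /homog_span/spanP aP; apply/eqP.
apply: (aP _ (linear_eq0_submod fl gl)) => _ [s /hword_wval[w wn ->] ->].
by rewrite unfold_in; apply/eqP/fg.
Qed.

Definition wfamily (c : X -> words) : Prop :=
  exists s i t, c = fun x => s ++ mkletter i x :: t.

Lemma wfamily_linear : linear_families wfamily.
Proof.
split=> [_ [s [i [t ->]]] x|_ W h [s [i [t ->]]]].
  rewrite /= !size_cat/= addnS; split => //.
  by elim: s => //= l s ->.
elim: s h => [|l s IH] h hl hr k u v /=; rewrite !dsum_wdec_cons scalerDr addrACA.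
  congr (_ + _).
    by apply: (hr _ (fun x => mkletter i x :: t)) => //; exists [::], i, t.
  rewrite -dsumZ -dsumD; apply: (eq_gsum (g0 := words)) => a b sab _.
  apply: (hl (fun x => mkletter i x :: a)); first by exists [::], i, a.
  by rewrite /= in sab *; rewrite addSn sab.
congr (_ + _).
  apply: (hr _ (fun x => l :: s ++ mkletter i x :: t)) => //.
  by exists (l :: s), i, t.
apply: (IH (fun a b => h (l :: a) b)) => [c' b [s' [i' [t' ->]]] sc|a c' c'L sc].
  apply: (hl (fun x => l :: s' ++ mkletter i' x :: t')).
    by exists (l :: s'), i', t'.
  by rewrite /= addSn sc.
by apply: hr => //; rewrite /= addSn sc.
Qed.

(** A function on homogeneous words that is linear in each letter extends to all
    words by decomposing the letters into homogeneous components. *)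
Fixpoint wextend (W : lmodType K) (f : words -> W) (s : seq X) : W :=
  if s is x :: s' then
    \sum_(i \in setT) wextend (fun w => f (mkletter i (gpr i x) :: w)) s'
  else f [::].

Section Extend.
Variable W : lmodType K.
Implicit Types f : words -> W.

Definition wlinear f := forall c, wfamily c -> linear (fun x => f (c x)).

Lemma wlinear_cons f l : wlinear f -> wlinear (fun w => f (l :: w)).
Proof.
move=> fl _ [s [i [t ->]]].
by apply: (fl (fun x => l :: s ++ mkletter i x :: t)); exists (l :: s), i, t.
Qed.

Lemma wlinear_head f i w : wlinear f -> linear (fun x => f (mkletter i x :: w)).
Proof. by move=> fl; apply: (fl (fun x => _ :: w)); exists [::], i, w. Qed.

Lemma eq_wextend f g s : f =1 g -> wextend f s = wextend g s.
Proof. by move=> /funext ->. Qed.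

Let headl f s i : (forall f g a, wlinear f -> wlinear g ->
    wextend (fun w => a *: f w + g w) s = a *: wextend f s + wextend g s) ->
  wlinear f -> linear (fun x => wextend (fun w => f (mkletter i x :: w)) s).
Proof.
move=> sl fl a x y; rewrite -sl; [|exact: wlinear_cons..].
by apply: eq_wextend => w; exact: wlinear_head.
Qed.

Lemma wextend_comb f g a s : wlinear f -> wlinear g ->
  wextend (fun w => a *: f w + g w) s = a *: wextend f s + wextend g s.
Proof.
elim: s f g a => [//|x s IH] f g a fl gl /=.
have [r xr] := gpr_supp x.
have xr' i : i \notin undup r -> gpr i x = 0 by rewrite mem_undup; exact: xr.
have ur := undup_uniq r.
have hl := headl _ IH.
have cl : wlinear (fun w => a *: f w + g w).
  by move=> c cL; apply: linear_comb; [exact: fl|exact: gl].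
rewrite (@gsumE _ _ _ (fun i y => wextend (fun w => f (mkletter i y :: w)) s)
  x _ (fun i => hl f i fl) ur xr').
rewrite (@gsumE _ _ _ (fun i y => wextend (fun w => g (mkletter i y :: w)) s)
  x _ (fun i => hl g i gl) ur xr').
rewrite (@gsumE _ _ _ (fun i y => wextend (fun w => a *: f (mkletter i y :: w)
  + g (mkletter i y :: w)) s) x _ (fun i => hl _ i cl) ur xr').
rewrite scaler_sumr -big_split/=; apply: eq_bigr => i _.
by rewrite IH//; exact: wlinear_cons.
Qed.

Lemma wextend_head f s i : wlinear f ->
  linear (fun x => wextend (fun w => f (mkletter i x :: w)) s).
Proof. by apply: headl => g g' a; exact: wextend_comb. Qed.

Lemma wextend_multilin f : wlinear f -> multilin (wextend f).
Proof.
move=> fl s t; elim: s f fl => [|y s IH] f fl /=.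
  exact: (gsum_linear (F := fun i x =>
    wextend (fun w => f (mkletter i x :: w)) t)) (fun i => wextend_head _ _ fl).
have [r yr] := gpr_supp y.
have yr' i : i \notin undup r -> gpr i y = 0 by rewrite mem_undup; exact: yr.
move=> a u v.
rewrite !(@gsumE _ _ _ (fun i y => wextend (fun w => f (mkletter i y :: w))
  (s ++ _ :: t)) y _ _ (undup_uniq r) yr'); [|by move=> i; exact: wextend_head..].
rewrite scaler_sumr -big_split/=; apply: eq_bigr => i _.
by rewrite IH//; exact: wlinear_cons.
Qed.

Lemma wextendE f w : wlinear f -> wextend f (map lval w) = f w.
Proof.
elim: w f => [//|l w IH] f fl /=.
rewrite (gsum_homog (F := fun i y => wextend (fun w => f (mkletter i y :: w)) _)
  (fun i => wextend_head _ _ fl) (lvalP l)) IH ?mkletterE//.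
exact: wlinear_cons.
Qed.

Definition wlift f : tensV X -> W := tlift (wextend f).

Lemma wlift_linear f : wlinear f -> linear (wlift f).
Proof. by move=> fl; exact/tlift_linear/wextend_multilin. Qed.

Lemma wliftE f w : wlinear f -> wlift f (wval w) = f w.
Proof.
by move=> fl; rewrite /wlift tliftE ?wextendE//; exact: wextend_multilin.
Qed.

End Extend.

Section Extend2.
Variables (W : lmodType K) (f : tcoalg words words -> W).
Hypothesis fl : forall c, tfamily wfamily wfamily c -> linear (fun x => f (c x)).

Definition wlift2 (a b : tensV X) : W :=
  wlift (fun s => wlift (fun t => f (s, t)) b) a.

Let fr s : wlinear (fun t => f (s, t)).
Proof. by move=> c cL; apply: (fl (c := fun x => (s, c x))); right; exists s, c. Qed.

Let f1 b : wlinear (fun s => wlift (fun t => f (s, t)) b).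
Proof.
move=> c cL k u v; move: b; apply: wval_ext.
- exact: wlift_linear.
- by apply: linear_comb; exact: wlift_linear.
move=> w; rewrite !wliftE//.
by apply: (fl (c := fun x => (c x, w))); left; exists c, w.
Qed.

Lemma wlift2_bilin : bilin wlift2.
Proof.
split=> [b|a]; first exact: wlift_linear.
move=> k u v; move: a; apply: wval_ext.
- exact: wlift_linear.
- by apply: linear_comb; exact: wlift_linear.
by move=> w; rewrite /wlift2 !wliftE//; exact: wlift_linear.
Qed.

Lemma wlift2E s t : wlift2 (wval s) (wval t) = f (s, t).
Proof. by rewrite /wlift2 !wliftE. Qed.

End Extend2.

End Words.

(** * Multiplications and coderivations as coalgebra maps *)

Section CmapTransport.
Variables (K : fieldType) (X : grVect K).

Lemma dsum_gone (G : gcoalg K) (W : lmodType K) (h : G -> G -> W) :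
  dsum (gdec gone) h = h gone gone.
Proof.
rewrite -(gcounitl h); apply: eq_gsum => a b.
by rewrite gone_size => /eqP; rewrite addn_eq0 => /andP[-> _].
Qed.

Lemma cmap_gonel (G H : gcoalg K) (F : tcoalg G H -> tensV X) :
  cmap F -> cmap (fun h => F (gone, h)).
Proof.
move=> [F1 FD]; split=> [//|h]; rewrite FD tcoalg_dsum dsum_gone.
by apply: eq_dsum => a b; rewrite gone_deg mul0r ksign0 scale1r.
Qed.

Lemma cmap_goner (G H : gcoalg K) (F : tcoalg G H -> tensV X) :
  cmap F -> cmap (fun g => F (g, gone)).
Proof.
move=> [F1 FD]; split=> [//|h]; rewrite FD tcoalg_dsum.
by apply: eq_dsum => a b; rewrite dsum_gone gone_deg mulr0 ksign0 scale1r.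
Qed.

(** Both bracketings of a threefold tensor product have the same signs in their
    coproducts. *)
Lemma cmap_assoc (G H L : gcoalg K) (F : tcoalg G (tcoalg H L) -> tensV X) :
  cmap F ->
  cmap (fun x : tcoalg (tcoalg G H) L => F (x.1.1, (x.1.2, x.2))).
Proof.
move=> [F1 FD]; split=> [//|[[g h] l]]; rewrite FD !tcoalg_dsum/=.
apply: eq_dsum => a a'; rewrite tcoalg_dsum/=; apply: eq_dsum => b b'.
rewrite -dsumZ; apply: eq_dsum => c c'; rewrite !scalerA; congr (_ *: _).
by rewrite mulrDr mulrDl !ksignD; ring.
Qed.

Definition tens_Tmap (Y : grVect K) (f : X -> Y) :
    tens (tensV X) (tensV X) -> tens (tensV Y) (tensV Y) :=
  tenlift (fun a b => Tmap f a \ox Tmap f b).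

Lemma Tmap_cmap (Y : grVect K) (f : X -> Y) (G : gcoalg K) (F : G -> tensV X) :
  linear f -> cmap F -> cmap (fun g => Tmap f (F g)).
Proof.
move=> fl [F1 FD]; split=> [|g]; first by rewrite F1 TmapE.
have tb : bilin (fun a b => Tmap f a \ox Tmap f b).
  by split=> [b|a] c u v; rewrite Tmap_linear// ?tprodl ?tprodr.
have tl : linear (tens_Tmap f) by exact: tenlift_linear.
have tE a b : tens_Tmap f (a \ox b) = Tmap f a \ox Tmap f b by exact: tenliftE.
have DT z : Delta (Tmap f z) = tens_Tmap f (Delta z).
  move: z; apply: tensV_ext => [||s].
  - exact: (linear_comp (@Delta_linear K Y) (Tmap_linear fl)).
  - exact: (linear_comp tl (@Delta_linear K X)).
  rewrite TmapE// !DeltaE (linear_sumE tl) size_map; apply: eq_bigr => i _.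
  by rewrite tE !TmapE// map_take map_drop.
by rewrite DT FD (linear_dsum _ _ tl); apply: eq_dsum => a b; rewrite tE.
Qed.

Section Product.
Variable mu : tensV X -> tensV X -> tensV X.
Hypotheses (mb : bilin mu) (mu1 : mu (Tone X) (Tone X) = Tone X).
Hypothesis muD : forall a b,
  Delta (mu a b) = tens_mul (V := Tc X) mu (Delta a) (Delta b).

Lemma product_cmap (G H : gcoalg K) (F : G -> tensV X) (F' : H -> tensV X) :
  cmap F -> (forall g, homog (V := Tc X) (gdeg g) (F g)) ->
  cmap F' -> (forall g, homog (V := Tc X) (gdeg g) (F' g)) ->
  cmap (fun x : tcoalg G H => mu (F x.1) (F' x.2)).
Proof.
move=> [F1 FD] Fh [F'1 F'D] F'h; split=> [|[g h]]; first by rewrite F1 F'1.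
have tb := tens_mul_bilin (V := Tc X) mb.
rewrite muD FD F'D tcoalg_dsum (linear_dsum _ _ (tb.1 _)); apply: eq_dsum => a a'.
rewrite (linear_dsum _ _ (tb.2 _)); apply: eq_dsum => b b'.
exact: (tens_mulE (V := Tc X) mb).
Qed.

End Product.

Section Coderivation.
Variable d : tensV X -> tensV X.
Hypothesis dl : linear d.
Hypothesis dD : forall a, Delta (d a) =
  tens_map 0 d id (Delta a : tens (Tc X) (Tc X)) +
  tens_map (-1) id d (Delta a : tens (Tc X) (Tc X)).

Definition with_coderivation (G : gcoalg K) (F : G -> tensV X)
    (x : tcoalg (prim K (-1)) G) : tensV X :=
  if x.1 then d (F x.2) else F x.2.

Lemma coderivation_cmap (G : gcoalg K) (F : G -> tensV X) :
  cmap F -> (forall g, homog (V := Tc X) (gdeg g) (F g)) ->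
  cmap (with_coderivation F).
Proof.
move=> [F1 FD] Fh; split=> [//|[b g]]; rewrite tcoalg_dsum prim_dsum.
rewrite /with_coderivation; case: b => /=; last first.
  by rewrite FD; apply: eq_dsum => a b; rewrite mul0r ksign0 scale1r.
rewrite dD FD addrC.
have il := @linear_id K (Tc X).
rewrite (linear_dsum _ _ (@tens_map_linear _ (Tc X) (Tc X) _ _ _ _ _ dl il)).
rewrite (linear_dsum _ _ (@tens_map_linear _ (Tc X) (Tc X) _ _ _ _ _ il dl)).
congr (_ + _); apply: eq_dsum => a b.
  exact: (tens_mapE (U := Tc X) (V := Tc X) _ il dl _ (Fh a)).
exact: (tens_mapE (U := Tc X) (V := Tc X) _ dl il _ (Fh a)).
Qed.

End Coderivation.

End CmapTransport.

Section BinfFromDelta.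
Variables (K : fieldType) (X : grVect K) (tau : tensV X -> X).
Hypothesis tauP : projection tau.

Variable mu : tensV X -> tensV X -> tensV X.
Hypotheses (mb : bilin mu) (mu1 : mu (Tone X) (Tone X) = Tone X).
Hypothesis muD : forall a b,
  Delta (mu a b) = tens_mul (V := Tc X) mu (Delta a) (Delta b).
Hypothesis muh : forall i j a b,
  homog (V := Tc X) i a -> homog (V := Tc X) j b ->
  homog (V := Tc X) (i + j) (mu a b).

Let wv : words X -> tensV X := @wval K X.
Let wmap := @wval_cmap K X.
Let wh := @wval_homog K X.
Let wmul : tcoalg (words X) (words X) -> tensV X :=
  fun x => mu (wval x.1) (wval x.2).

Lemma wmul_cmap : cmap wmul.
Proof. exact: product_cmap. Qed.

Lemma wmul_homog x : homog (V := Tc X) (gdeg x) (wmul x).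
Proof. exact: muh. Qed.

(** Both bracketings are coalgebra maps of three words, so they may be compared
    after [tau]. *)
Lemma product_assoc :
  (forall a b c, tau (mu (mu a b) c) = tau (mu a (mu b c))) -> associative mu.
Proof.
move=> tA a b c; move: a; apply: wval_ext.
- by case: mb => + _; exact.
- by move=> k u v; rewrite !mb.1.
move=> s; move: b; apply: wval_ext.
- by move=> k u v; rewrite mb.1 mb.2.
- by move=> k u v; rewrite mb.2 mb.1.
move=> t; move: c; apply: wval_ext.
- by move=> k u v; rewrite !mb.2.
- by move=> k u v; rewrite !mb.2.
move=> r; apply/esym.
exact: (cmap_unique tauP
  (product_cmap mb mu1 muD wmul_cmap wmul_homog wmap wh)
  (cmap_assoc (product_cmap mb mu1 muD wmap wh wmul_cmap wmul_homog))
  (fun x => tA _ _ _) ((s, t), r)).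
Qed.

Lemma product_1l : (forall a, tau (mu (Tone X) a) = tau a) -> left_id (Tone X) mu.
Proof.
move=> t1; apply: wval_ext => [|//|w]; first exact: mb.2.
exact: (cmap_unique tauP (cmap_gonel wmul_cmap) wmap (fun x => t1 _) w).
Qed.

Lemma product_1r : (forall a, tau (mu a (Tone X)) = tau a) -> right_id (Tone X) mu.
Proof.
move=> t1; apply: wval_ext => [|//|w]; first exact: mb.1.
exact: (cmap_unique tauP (cmap_goner wmul_cmap) wmap (fun x => t1 _) w).
Qed.

Lemma product_counit a b : counit (mu a b) = counit a * counit b.
Proof.
have cl := @counit_linear K X.
move: a; apply: wval_ext => [c u v|c u v|s].
- by rewrite mb.1 cl.
- by rewrite cl mulrDl -mulrA.
move: b; apply: wval_ext => [c u v|c u v|t].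
- by rewrite mb.2 cl.
- by rewrite cl mulrDr mulrCA.
rewrite (counit_cmap ((s, t) : tcoalg (words X) (words X)) wmul_cmap)
  (counit_cmap (s : words X) wmap) (counit_cmap (t : words X) wmap) addn_eq0.
by case: eqP; case: eqP; rewrite /= ?mulr1 ?mulr0.
Qed.

Variable d : tensV X -> tensV X.
Hypothesis dl : linear d.
Hypothesis dh : has_degree (-1) (d : Tc X -> Tc X).
Hypothesis dD : forall a, Delta (d a) =
  tens_map 0 d id (Delta a : tens (Tc X) (Tc X)) +
  tens_map (-1) id d (Delta a : tens (Tc X) (Tc X)).

Lemma coderivation1 : tau (d (Tone X)) = 0 -> d (Tone X) = 0.
Proof.
apply: (primitive_eq0 tauP).
have := (coderivation_cmap dl dD wmap wh).2 (true, [::]).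
rewrite tcoalg_dsum prim_dsum !dsum_gone /with_coderivation/= !mulr0 !ksign0.
by rewrite !scale1r addrC.
Qed.

Lemma with_coderivation_homog x :
  homog (V := Tc X) (gdeg x) (with_coderivation d wv x).
Proof.
case: x => [[] x]; rewrite /with_coderivation/= ?add0r; last exact: wh.
by rewrite addrC; apply: dh; exact: wh.
Qed.

(** [d \o d] and [0] are both the [delta (x) delta] part of a coalgebra map on
    [prim (x) (prim (x) words)] that is given by [id] and [d] elsewhere: the two
    mixed terms [d w' (x) d w''] in its coproduct cancel. *)
Lemma coderivation_sq :
  (forall a, tau (d (d a)) = 0) -> forall a, d (d a) = 0.
Proof.
move=> tdd; apply: wval_ext => [k u v|k u v|w]; first by rewrite !dl.
  by rewrite scaler0 addr0.
have F1 := coderivation_cmap dl dD wmap wh.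
have Fh := with_coderivation_homog.
have F2 := coderivation_cmap dl dD F1 Fh.
pose F (x : tcoalg (prim K (-1)) (tcoalg (prim K (-1)) (words X))) :=
  if x.1 && x.2.1 then 0
  else with_coderivation d (with_coderivation d wv) x.
have FF : cmap F.
  split=> [//|[b [c u]]]; have := F2.2 (b, (c, u)).
  case: b; last by rewrite !tcoalg_dsum !prim_dsum.
  case: c => [_|]; rewrite !tcoalg_dsum !prim_dsum.
    rewrite !tcoalg_dsum !prim_dsum /F /with_coderivation/= -!dsumD.
    rewrite (linear0E (@Delta_linear K X)) -[LHS](dsum0 (wdec u)).
    apply: eq_dsum => a a'; have tb := @tprod_bilin K (tensV X) (tensV X).
    rewrite (bilin0r _ tb) (bilin0l _ tb) !mul0r !add0r ksign0 !scale1r !scaler0.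
    rewrite (ksign_odd (i := -1 * (-1 + _)) (j := -1 * wdeg a) (k := 0)); last by ring.
    by rewrite add0r addr0 scaleNr addNr.
  by rewrite !tcoalg_dsum !prim_dsum.
apply: (cmap_unique tauP F2 FF _ (true, (true, w))) => -[b [c u]].
by rewrite /F/=; case: ifP => //= /andP[-> ->]; rewrite tdd (linear0E tauP.1).
Qed.

(** Both sides, with [mu] itself, form coalgebra maps on
    [prim (x) (words (x) words)]. For the right-hand side this is seen from the
    coalgebra map on [(prim (x) words) (x) (prim (x) words)] that sends
    [((b, s), (c, t))] to the product of [d^b s] and [d^c t]. *)
Lemma coderivation_mul :
  (forall i a b, homog (V := Tc X) i a ->
     tau (d (mu a b)) = tau (mu (d a) b + (-1) ^ i *: mu a (d b))) ->
  forall i a b, homog (V := Tc X) i a ->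
    d (mu a b) = mu (d a) b + (-1) ^ i *: mu a (d b).
Proof.
move=> tdm.
suff dm (s t : words X) : d (mu (wval s) (wval t)) =
    mu (d (wval s)) (wval t) + ksign (gdeg s) *: mu (wval s) (d (wval t)).
  move=> i a b ai; move: b; apply: wval_ext => [||t].
  - exact: (linear_comp dl (mb.2 a)).
  - move=> k x y; rewrite dl (bilinDr _ _ _ mb) (bilinZr _ _ _ mb) mb.2.
    by rewrite scalerDr scalerDr !scalerA (mulrC k) addrACA.
  move: a ai; apply: homog_wval_ext => [||s si].
  - exact: (linear_comp dl (mb.1 _)).
  - move=> k x y; rewrite dl (bilinDl _ _ _ mb) (bilinZl _ _ _ mb) mb.1.
    by rewrite scalerDr scalerDr !scalerA (mulrC k) addrACA.
  by rewrite dm si.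
have Eh := with_coderivation_homog.
have E := coderivation_cmap dl dD wmap wh.
have P := product_cmap mb mu1 muD E Eh E Eh.
have F1 := coderivation_cmap dl dD wmul_cmap wmul_homog.
pose F (x : tcoalg (prim K (-1)) (tcoalg (words X) (words X))) :=
  if x.1 then mu (d (wval x.2.1)) (wval x.2.2) +
    ksign (gdeg x.2.1) *: mu (wval x.2.1) (d (wval x.2.2))
  else mu (wval x.2.1) (wval x.2.2).
have FF : cmap F.
  split=> [//|[b [u v]]]; have tb := @tprod_bilin K (tensV X) (tensV X).
  have Dl := @Delta_linear K X.
  case: b; rewrite tcoalg_dsum !prim_dsum; last first.
    by have := F1.2 (false, (u, v)); rewrite tcoalg_dsum !prim_dsum.
  pose T a a' b b' (p q r z : tensV X -> tensV X) :=
    mu (p (wv a)) (q (wv b)) \ox mu (r (wv a')) (z (wv b')).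
  have D1 : Delta (mu (d (wval u)) (wval v)) =
      dsum (gdec u) (fun a a' => dsum (gdec v) (fun b b' =>
        ksign (- gdeg a + (gdeg a' - 1) * gdeg b) *: T a a' b b' id id d id +
        ksign (gdeg a' * gdeg b) *: T a a' b b' d id id id)).
    rewrite (P.2 ((true, u), (false, v))) !tcoalg_dsum prim_dsum -dsumD.
    apply: eq_dsum => a a'; rewrite !tcoalg_dsum !prim_dsum -!dsumZ -dsumD.
    apply: eq_dsum => b b'; rewrite !scalerA -!ksignD /T /with_coderivation/=.
    by congr (ksign _ *: _ + ksign _ *: _); ring.
  have D2 : Delta (mu (wval u) (d (wval v))) =
      dsum (gdec u) (fun a a' => dsum (gdec v) (fun b b' =>
        ksign (- gdeg b + gdeg a' * gdeg b) *: T a a' b b' id id id d +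
        ksign (gdeg a' * (gdeg b - 1)) *: T a a' b b' id d id id)).
    rewrite (P.2 ((false, u), (true, v))) !tcoalg_dsum prim_dsum.
    apply: eq_dsum => a a'; rewrite !tcoalg_dsum !prim_dsum -dsumD -dsumZ.
    apply: eq_dsum => b b'; rewrite scalerDr !scalerA -!ksignD /T /with_coderivation/=.
    by congr (ksign _ *: _ + ksign _ *: _); ring.
  have -> : F (true, (u, v)) = mu (d (wval u)) (wval v) +
    ksign (gdeg u) *: mu (wval u) (d (wval v)) by [].
  rewrite (linD _ _ Dl) (linZ _ _ Dl) D1 D2 !tcoalg_dsum -dsumZ -!dsumD.
  apply: eq_gsum => a a' _ da; rewrite -!dsumZ -!dsumD.
  apply: eq_dsum => b b'; rewrite -da.
  rewrite (bilinDr _ _ _ tb) (bilinDl _ _ _ tb) (bilinZl _ _ _ tb) (bilinZr _ _ _ tb).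
  rewrite !scalerDr !scalerA -!ksignD /=.
  rewrite addrACA /T; congr (_ + _ + (_ + _)).
  - by congr (ksign _ *: _); ring.
  - by congr (_ *: _); apply: (ksign_even (k := wdeg a)); ring.
  - by congr (ksign _ *: _); ring.
  - by congr (ksign _ *: _); ring.
apply: (cmap_unique tauP F1 FF _ (true, (s, t))) => -[[] [u v]] //.
by rewrite /F/= (tdm (wdeg u)) //; exact: wh.
Qed.

End BinfFromDelta.

(** * Comparing B-infinity structures *)

Lemma p1_projection (K : fieldType) (X : grVect K) : projection (@p1 K X).
Proof. by split; [exact: p1_linear|exact: p1E]. Qed.

(** [Tmap f] before or after the operations gives two coalgebra maps, which may be
    compared after [tau]. With [tau = p1] the condition concerns the structure maps of [S] and
    [S'], with [tau = tau1] the operations of a 2-associative algebra. *)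
Section TmapCommutes.
Variables (K : fieldType) (X Y : grVect K) (S : binf X) (S' : binf Y).
Variables (f : X -> Y) (tau : tensV Y -> Y).
Hypotheses (fl : linear f) (f0 : has_degree 0 f) (tauP : projection tau).

Let Tl : linear (Tmap f) := Tmap_linear fl.

Let Th (w : words X) : homog (V := Tc Y) (gdeg w) (Tmap f (wval w)).
Proof. by rewrite -[gdeg w]addr0; exact: (Tmap_degree fl f0 (wval_homog w)). Qed.

Let Tmap_words : cmap (fun w : words X => Tmap f (wval w)) := Tmap_cmap fl (wval_cmap X).

Lemma Tmap_bmu :
  (forall s t, tau (Tmap f (bmu S (word s) (word t))) =
               tau (bmu S' (word (map f s)) (word (map f t)))) ->
  forall a b, Tmap f (bmu S a b) = bmu S' (Tmap f a) (Tmap f b).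
Proof.
move=> tST a b.
have Sb := bmu_bilin S; have Sb' := bmu_bilin S'.
move: a; apply: wval_ext => [||s].
- exact: (linear_comp Tl (Sb.1 b)).
- exact: (linear_comp (Sb'.1 _) Tl).
move: b; apply: wval_ext => [||t].
- exact: (linear_comp Tl (Sb.2 _)).
- exact: (linear_comp (Sb'.2 _) Tl).
have P := product_cmap Sb (bmu1l S _) (bmu_Delta S) (@wval_cmap K X)
  (@wval_homog K X) (@wval_cmap K X) (@wval_homog K X).
have P' := product_cmap Sb' (bmu1l S' _) (bmu_Delta S') Tmap_words Th Tmap_words Th.
apply: (cmap_unique tauP (Tmap_cmap fl P) P' _ (s, t)) => -[{}s {}t] /=.
by rewrite tST /wval !TmapE.
Qed.

Lemma Tmap_bdiff :
  (forall s, tau (Tmap f (word s)) = tau (word (map f s))) ->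
  (forall s, tau (Tmap f (bdiff S (word s))) = tau (bdiff S' (word (map f s)))) ->
  forall a, Tmap f (bdiff S a) = bdiff S' (Tmap f a).
Proof.
move=> tT tST.
have Sl := bdiff_linear S; have Sl' := bdiff_linear S'.
apply: wval_ext => [||s].
- exact: (linear_comp Tl Sl).
- exact: (linear_comp Sl' Tl).
have P := coderivation_cmap Sl (bdiff_Delta S) (@wval_cmap K X) (@wval_homog K X).
have P' := coderivation_cmap Sl' (bdiff_Delta S') Tmap_words Th.
apply: (cmap_unique tauP (Tmap_cmap fl P) P' _ (true, s)) => -[[] {}s] //=.
by rewrite /with_coderivation/= tST /wval TmapE.
Qed.

End TmapCommutes.

Lemma binf_ext (K : fieldType) (X : grVect K) (S S' : binf X) :
  (forall a b, bmu S a b = bmu S' a b) -> (forall a, bdiff S a = bdiff S' a) ->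
  S = S'.
Proof.
case: S S' => [m d p1 p2 p3 p4 p5 p6 p7 p8 p9 q1 q2 q3 q4].
case=> [m' d' p1' p2' p3' p4' p5' p6' p7' p8' p9' q1' q2' q3' q4'] /= mm dd.
have em : m = m' by apply/funext => a; apply/funext => b.
have {mm} ed : d = d' by apply/funext.
subst m' d'; congr Binf; exact: Prop_irrelevance.
Qed.

(** * The underlying B-infinity structure *)

Section Underlying.
Variables (K : fieldType) (V : dAs K).

Let tau := @tau1 K V.

Lemma tau1_linear : linear tau.
Proof. exact/tlift_linear/tau1_multilin. Qed.

Let tl := tau1_linear.

Lemma tau1_projection : projection tau.
Proof. by split=> // x; rewrite /tau tau1E/= dodot1r. Qed.

Lemma tau1_Tone : tau (Tone V) = dunit V.
Proof. by rewrite /tau tau1E. Qed.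

Lemma tau1_degree : has_degree 0 (tau : Tc V -> V).
Proof.
move=> n a /homog_span an; rewrite addr0; apply: (span_homog tl) an.
move=> _ [s sn ->]; rewrite /tau tau1E.
elim: sn => [|i x m t xi _ IH]; first exact: dunit_degree.
exact: dodot_degree.
Qed.

Lemma tau1_concat a b : tau (concat a b) = dodot (tau a) (tau b).
Proof.
have ob := dodot_bilin V.
move: a; apply: tensV_ext => [||s].
- exact: (linear_comp tl ((concat_bilin V).1 b)).
- exact: (linear_comp (ob.1 _) tl).
move: b; apply: tensV_ext => [||t].
- exact: (linear_comp tl ((concat_bilin V).2 _)).
- exact: (linear_comp (ob.2 _) tl).
rewrite concatE /tau !tau1E; elim: s => [|x s IH] /=; first by rewrite dodot1l.
by rewrite IH dodotA.
Qed.

Lemma dd_unit : dd (dunit V) = 0.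
Proof.
have := dd_mul (dunit V) (dunit_degree V).
rewrite dmul1l dmul1r scale1r dmul1l -[LHS]addr0.
by move=> /addrI.
Qed.

(** The values that [tau1] must take on the product, here also for empty words:
    both operations have the same unit, so the formula holds there as well. *)
Definition und_prod_letter (x : tcoalg (words V) (words V)) : V :=
  dmul (tau (wval x.1)) (tau (wval x.2)).

Definition und_diff_letter (x : tcoalg (prim K (-1)) (words V)) : V :=
  if x.1 then dd (tau (wval x.2)) else tau (wval x.2).

Definition und_prod := wlift2 (cofree tau und_prod_letter).

Definition und_diff :=
  wlift (fun w => cofree tau und_diff_letter ((true, w) : tcoalg (prim K _) _)).

Let wval_linear c : wfamily c -> linear (fun x => wval (c x) : tensV V).
Proof.
move=> [s [i [t ->]]] k x y; rewrite /wval !map_cat/= gpr_linear.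
exact: word_multilin.
Qed.

Let prod1 : und_prod_letter gone = tau (Tone V).
Proof. by rewrite /und_prod_letter/= tau1_Tone dmul1l. Qed.

Let prod_linear c : tfamily (@wfamily K V) (@wfamily K V) c ->
  linear (fun x => cofree tau und_prod_letter (c x)).
Proof.
apply: (cofree_linear tau1_projection
  (tfamily_linear (@wfamily_linear K V) (@wfamily_linear K V))) => {}c.
have mb := dmul_bilin V; rewrite /und_prod_letter.
case=> [[c' [w [/wval_linear cl ->]]]|[w [c' [/wval_linear cl ->]]]] /=.
  exact: (linear_comp (mb.1 _) (linear_comp tl cl)).
exact: (linear_comp (mb.2 _) (linear_comp tl cl)).
Qed.

Let und_prodE s t :
  und_prod (wval s) (wval t) = cofree tau und_prod_letter (s, t).
Proof. exact: wlift2E. Qed.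

Let diff1 : und_diff_letter gone = tau (Tone V).
Proof. by []. Qed.

Let diff_linear c : tfamily (fun _ => False) (@wfamily K V) c ->
  linear (fun x => cofree tau und_diff_letter (c x)).
Proof.
apply: (cofree_linear tau1_projection
  (tfamily_linear (@no_family K V _) (@wfamily_linear K V))) => {}c.
case=> [[c' [w [[] //]]]|[[] [c' [/wval_linear cl ->]]]].
  exact: (linear_comp (@dd_linear K V) (linear_comp tl cl)).
exact: (linear_comp tl cl).
Qed.

Let diff_wlinear : wlinear (fun w => cofree tau und_diff_letter
  ((true, w) : tcoalg (prim K (-1)) (words V))).
Proof.
move=> c cL; apply: (diff_linear (c := fun x => (true, c x))).
by right; exists true, c.
Qed.

Let und_diffE w : und_diff (wval w) =
  cofree tau und_diff_letter ((true, w) : tcoalg (prim K (-1)) (words V)).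
Proof. exact: wliftE. Qed.

Let diff_cmap : cmap (cofree tau und_diff_letter) := cofree_cmap _ _.
Let prod_cmap : cmap (cofree tau und_prod_letter) := cofree_cmap _ _.

Let diff_false w : cofree tau und_diff_letter
  ((false, w) : tcoalg (prim K (-1)) (words V)) = wval w.
Proof.
apply: (cmap_unique tau1_projection (cmap_gonel diff_cmap) (@wval_cmap K V)) => {}w.
exact: (tau_cofree tau1_projection diff1).
Qed.

Let mb : bilin und_prod. Proof. exact: wlift2_bilin. Qed.

Let dl : linear und_diff. Proof. exact: wlift_linear. Qed.

Lemma tau1_und_prod a b : tau (und_prod a b) = dmul (tau a) (tau b).
Proof.
have db := dmul_bilin V.
move: a; apply: wval_ext => [||s].
- exact: (linear_comp tl (mb.1 b)).
- exact: (linear_comp (db.1 _) tl).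
move: b; apply: wval_ext => [||t].
- exact: (linear_comp tl (mb.2 _)).
- exact: (linear_comp (db.2 _) tl).
by rewrite und_prodE (tau_cofree tau1_projection prod1).
Qed.

Lemma tau1_und_diff a : tau (und_diff a) = dd (tau a).
Proof.
move: a; apply: wval_ext => [||s].
- exact: (linear_comp tl dl).
- exact: (linear_comp (@dd_linear K V) tl).
by rewrite und_diffE (tau_cofree tau1_projection diff1).
Qed.

Let mu1 : und_prod (Tone V) (Tone V) = Tone V.
Proof. by rewrite (und_prodE [::] [::]) (cofree1 _ _). Qed.

Let muh i j (a b : Tc V) : homog i a -> homog j b ->
  homog (V := Tc V) (i + j) (und_prod a b).
Proof.
move=> ai bj.
have h := cofree_homog (psi := und_prod_letter) tau1_degree.
have {}h (s t : words V) :
    homog (V := Tc V) (gdeg s + gdeg t) (und_prod (wval s) (wval t)).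
  rewrite und_prodE; apply: (h _ (s, t)) => -[{}s {}t].
  by apply: dmul_degree; rewrite -[gdeg _]addr0; apply: tau1_degree; exact: wval_homog.
have Tl := @Tpr_linear K V (i + j).
move: a ai; apply: homog_wval_ext => [||s <-].
- exact: (linear_comp Tl (mb.1 b)).
- exact: (mb.1 b).
move: b bj; apply: homog_wval_ext => [||t <-].
- exact: (linear_comp (@Tpr_linear K V _) (mb.2 _)).
- exact: (mb.2 _).
exact: h.
Qed.

Let dh : has_degree (-1) (und_diff : Tc V -> Tc V).
Proof.
move=> n; apply: homog_wval_ext => [||w <-].
- exact: (linear_comp (@Tpr_linear K V _) dl).
- exact: dl.
rewrite und_diffE addrC.
apply: (cofree_homog tau1_degree _
  ((true, w) : tcoalg (prim K (-1)) (words V))) => -[b {}w].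
have th : homog (gdeg w) (tau (wval w)).
  by rewrite -[gdeg w]addr0; apply: tau1_degree; exact: wval_homog.
rewrite /und_diff_letter; case: b => /=; last by rewrite add0r.
by rewrite addrC; exact: dd_degree.
Qed.

Let muD a b :
  Delta (und_prod a b) = tens_mul (V := Tc V) und_prod (Delta a) (Delta b).
Proof.
have Dl := @Delta_linear K V; have tb := tens_mul_bilin (V := Tc V) mb.
move: a; apply: wval_ext => [||s].
- exact: (linear_comp Dl (mb.1 b)).
- exact: (linear_comp (tb.1 _) Dl).
move: b; apply: wval_ext => [||t].
- exact: (linear_comp Dl (mb.2 _)).
- exact: (linear_comp (tb.2 _) Dl).
have wD := (@wval_cmap K V).2.
rewrite und_prodE prod_cmap.2 tcoalg_dsum (wD s) (wD t).
rewrite (linear_dsum _ _ (tb.1 _)); apply: eq_dsum => a a'.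
rewrite (linear_dsum _ _ (tb.2 _)); apply: eq_dsum => b b'.
rewrite (tens_mulE (V := Tc V) mb _ _ (wval_homog _) (wval_homog _)).
by rewrite !und_prodE.
Qed.

Let dD a : Delta (und_diff a) =
  tens_map 0 und_diff id (Delta a : tens (Tc V) (Tc V)) +
  tens_map (-1) id und_diff (Delta a : tens (Tc V) (Tc V)).
Proof.
have Dl := @Delta_linear K V; have il := @linear_id K (Tc V).
have tl1 := @tens_map_linear _ (Tc V) (Tc V) _ _ 0 _ _ dl il.
have tl2 := @tens_map_linear _ (Tc V) (Tc V) _ _ (-1) _ _ il dl.
move: a; apply: wval_ext => [||s].
- exact: (linear_comp Dl dl).
- by apply: linear_add; [exact: (linear_comp tl1 Dl)|exact: (linear_comp tl2 Dl)].
rewrite und_diffE diff_cmap.2 tcoalg_dsum prim_dsum ((@wval_cmap K V).2 s).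
rewrite (linear_dsum _ _ tl1) (linear_dsum _ _ tl2) addrC.
congr (_ + _); apply: eq_dsum => a b; rewrite diff_false -und_diffE.
  exact/esym/(tens_mapE (U := Tc V) (V := Tc V) _ dl il _ (wval_homog _)).
exact/esym/(tens_mapE (U := Tc V) (V := Tc V) _ il dl _ (wval_homog _)).
Qed.

Let tdm i (a b : Tc V) : homog i a -> tau (und_diff (und_prod a b)) =
  tau (und_prod (und_diff a) b + (-1) ^ i *: und_prod a (und_diff b)).
Proof.
move=> ai; rewrite (linD _ _ tl) (linZ _ _ tl) !(tau1_und_diff, tau1_und_prod).
by apply: dd_mul; rewrite -[i]addr0; exact: tau1_degree.
Qed.

Definition und_binf : binf V :=
  Binf mb muh muD (product_counit mb mu1 muD)
   (product_assoc tau1_projection mb mu1 muD muh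
      (fun a b c => ltac:(by rewrite !tau1_und_prod dmulA)))
   (product_1l tau1_projection mb mu1 muD
      (fun a => ltac:(by rewrite tau1_und_prod tau1_Tone dmul1l)))
   (product_1r tau1_projection mb mu1 muD
      (fun a => ltac:(by rewrite tau1_und_prod tau1_Tone dmul1r)))
   dl dh dD
   (coderivation1 tau1_projection dl dD
      ltac:(by rewrite tau1_und_diff tau1_Tone dd_unit))
   (coderivation_sq tau1_projection dl dh dD
      (fun a => ltac:(by rewrite !tau1_und_diff dd2)))
   (coderivation_mul tau1_projection mb mu1 muD muh dl dh dD tdm).

Lemma und_binfP : underlying_structure und_binf.
Proof.
by split=> [a b _ _|a _]; [exact: tau1_und_prod|exact: tau1_und_diff].
Qed.

(** Both products share the unit, which [dd] kills, so the conditions on [Tbar]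
    extend to all of [T^c(V)]. *)
Lemma tau1_underlying (S : binf V) : underlying_structure S ->
  (forall a b, tau (bmu S a b) = dmul (tau a) (tau b)) /\
  (forall a, tau (bdiff S a) = dd (tau a)).
Proof.
move=> [Sm Sd]; have Sb := bmu_bilin S; have db := dmul_bilin V.
have wT (s : seq V) : s != [::] -> word s \in Tbar.
  by move=> s0; apply: mem_span; exists s.
split=> [a b|a].
  move: a; apply: tensV_ext => [||s].
  - exact: (linear_comp tl (Sb.1 b)).
  - exact: (linear_comp (db.1 _) tl).
  move: b; apply: tensV_ext => [||t].
  - exact: (linear_comp tl (Sb.2 _)).
  - exact: (linear_comp (db.2 _) tl).
  have [->|s0] := eqVneq s [::]; first by rewrite bmu1l tau1_Tone dmul1l.
  have [->|t0] := eqVneq t [::]; first by rewrite bmu1r tau1_Tone dmul1r.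
  by apply: Sm; exact: wT.
move: a; apply: tensV_ext => [||s].
- exact: (linear_comp tl (bdiff_linear S)).
- exact: (linear_comp (@dd_linear K V) tl).
have [->|s0] := eqVneq s [::]; last by apply: Sd; exact: wT.
by rewrite bdiff1 tau1_Tone dd_unit (linear0E tl).
Qed.

Lemma underlying_unique (S S' : binf V) :
  underlying_structure S -> underlying_structure S' -> S = S'.
Proof.
move=> /tau1_underlying[Sm Sd] /tau1_underlying[S'm S'd].
have il := @linear_id K V.
apply: binf_ext => [a b|a].
  rewrite -[LHS]Tmap_id (Tmap_bmu (S' := S') il (@has_degree_id K V) tau1_projection).
    by rewrite !Tmap_id.
  by move=> s t; rewrite Tmap_id !map_id S'm; exact: Sm.
rewrite -[LHS]Tmap_id (Tmap_bdiff (S' := S') il (@has_degree_id K V) tau1_projection).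
- by rewrite Tmap_id.
- by move=> s; rewrite Tmap_id map_id.
- by move=> s; rewrite Tmap_id !map_id S'd; exact: Sd.
Qed.

Lemma underlying_exists_unique : exists! S : binf V, underlying_structure S.
Proof.
exists und_binf; split=> [|S]; first exact: und_binfP.
by apply: underlying_unique; exact: und_binfP.
Qed.

End Underlying.

(** * Homomorphisms *)

Section BinfHoms.
Variable K : fieldType.

Lemma p1_Tmap (X Y : grVect K) (f : X -> Y) (a : tensV X) : linear f ->
  p1 (Tmap f a) = f (p1 a).
Proof.
move=> fl; move: a; apply: tensV_ext => [||s].
- exact: (linear_comp (@p1_linear K Y) (Tmap_linear fl)).
- exact: (linear_comp fl (@p1_linear K X)).
by rewrite TmapE// !p1_word; case: s => [|x [|y s]] /=; rewrite ?(linear0E fl).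
Qed.

Section Commuting.
Variables (A B : binfAlg K) (f : A -> B).
Hypotheses (fl : linear f) (f0 : has_degree 0 f).
Hypothesis fmu : forall a b, Tmap f (bmu A a b) = bmu B (Tmap f a) (Tmap f b).
Hypothesis fd : forall a, Tmap f (bdiff A a) = bdiff B (Tmap f a).

Program Definition binf_hom_of_Tmap : binf_hom A B :=
  @BinfHom K A B f fl f0 _ _.
Next Obligation. by move=> n c _ _; rewrite /bm -(p1_Tmap _ fl) fd. Qed.
Next Obligation. by move=> i j a b _ _ _ _; rewrite /bmm -(p1_Tmap _ fl) fmu. Qed.

End Commuting.

Section Tmap.
Variables (A B : binfAlg K) (f : binf_hom A B).
Let fl := bfun_linear f.
Let f0 := bfun_degree f.

Let tpow_word (X : grVect K) (s : seq X) : word s \in tpow (size s).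
Proof. by apply: mem_span; exists s. Qed.

Lemma binf_hom_bmu a b : Tmap f (bmu A a b) = bmu B (Tmap f a) (Tmap f b).
Proof.
apply: (Tmap_bmu fl f0 (p1_projection B)) => s t; rewrite p1_Tmap//.
have [->|s0] := eqVneq s [::].
  by rewrite !bmu1l !p1_word; case: t => [|x []] /=; rewrite ?(linear0E fl).
have [->|t0] := eqVneq t [::].
  by rewrite !bmu1r !p1_word; case: s {s0} => [|x []] /=; rewrite ?(linear0E fl).
rewrite -!(TmapE fl).
by apply: (bfun_mm f _ _ (tpow_word s) (tpow_word t)); rewrite lt0n size_eq0.
Qed.

Lemma binf_hom_bdiff a : Tmap f (bdiff A a) = bdiff B (Tmap f a).
Proof.
apply: (Tmap_bdiff fl f0 (p1_projection B)) => s; first by rewrite TmapE.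
rewrite p1_Tmap//; have [->|s0] := eqVneq s [::].
  by rewrite !bdiff1 (linear0E (@p1_linear K _)) (linear0E (@p1_linear K _)) (linear0E fl).
by rewrite -(TmapE fl); apply: (bfun_m f _ (tpow_word s)); rewrite lt0n size_eq0.
Qed.

Lemma Tmap_concat (a b : tensV A) :
  Tmap f (concat a b) = concat (Tmap f a) (Tmap f b).
Proof.
have Tl := Tmap_linear fl.
move: a; apply: tensV_ext => [||s].
- exact: (linear_comp Tl ((concat_bilin A).1 b)).
- exact: (linear_comp ((concat_bilin B).1 _) Tl).
move: b; apply: tensV_ext => [||t].
- exact: (linear_comp Tl ((concat_bilin A).2 _)).
- exact: (linear_comp ((concat_bilin B).2 _) Tl).
by rewrite concatE !TmapE// concatE map_cat.
Qed.

Definition Tc_hom : dAs_hom (TcAlg A) (TcAlg B) :=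
  @DAsHom K (TcAlg A) (TcAlg B) (Tmap f) (Tmap_linear fl) (Tmap_degree fl f0)
    binf_hom_bmu Tmap_concat (TmapE fl [::]) binf_hom_bdiff.

End Tmap.

Program Definition Tc_functor : functor (@Tc_obj K) :=
  @Functor (BinfCat K) (DAsCat K) (@Tc_obj K) (fun A B f => Tc_hom f) _ _.
Next Obligation. by move=> A; apply: dAs_hom_ext => a; exact: Tmap_id. Qed.
Next Obligation.
move=> A B C g f; apply: dAs_hom_ext => a.
exact: (Tmap_comp a (bfun_linear g) (bfun_linear f)).
Qed.

End BinfHoms.

Section UnderlyingFunctor.
Variables (K : fieldType) (und : forall V : dAs K, binf V).
Hypothesis undP : forall V, underlying_structure (und V).

Lemma tau1_bmu (V : dAs K) a b :
  tau1 (bmu (und V) a b) = dmul (tau1 a) (tau1 b).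
Proof. by have [+ _] := tau1_underlying (undP V); exact. Qed.

Lemma tau1_bdiff (V : dAs K) a : tau1 (bdiff (und V) a) = dd (tau1 a).
Proof. by have [_] := tau1_underlying (undP V); exact. Qed.

(** Comparing under [tau1] replaces the structure maps of the underlying algebra
    by the operations of [V]. *)
Section IntoUnderlying.
Variables (A : binfAlg K) (V : dAs K) (f : A -> V).
Hypotheses (fl : linear f) (f0 : has_degree 0 f).
Hypothesis fmu : forall s t, tau1 (Tmap f (bmu A (word s) (word t))) =
  dmul (tau1 (word (map f s))) (tau1 (word (map f t))).
Hypothesis fd : forall s, tau1 (Tmap f (bdiff A (word s))) =
  dd (tau1 (word (map f s))).

Definition into_underlying : binf_hom A (BinfAlg (und V)).
Proof.
apply: (@binf_hom_of_Tmap K A (BinfAlg (und V)) f fl f0) => [a b|a].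
  apply: (Tmap_bmu fl f0 (tau1_projection V)) => s t.
  by rewrite fmu tau1_bmu.
apply: (Tmap_bdiff fl f0 (tau1_projection V)) => s; first by rewrite TmapE.
by rewrite fd tau1_bdiff.
Defined.

End IntoUnderlying.

Lemma tau1_Tmap (V W : dAs K) (f : dAs_hom V W) a :
  tau1 (Tmap f a) = f (tau1 a).
Proof.
have fl := dfun_linear f.
move: a; apply: tensV_ext => [||s].
- exact: (linear_comp (@tau1_linear K W) (Tmap_linear fl)).
- exact: (linear_comp fl (@tau1_linear K V)).
rewrite TmapE// !tau1E; elim: s => [|x s IH] /=; first by rewrite dfun_one.
by rewrite IH dfun_odot.
Qed.

Definition underlying_hom (V W : dAs K) (f : dAs_hom V W) :
  binf_hom (BinfAlg (und V)) (BinfAlg (und W)).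
Proof.
apply: (@into_underlying (BinfAlg (und V)) W f (dfun_linear f) (dfun_degree f)).
  abstract by move=> s t; rewrite tau1_Tmap tau1_bmu dfun_mul -!tau1_Tmap
    !(TmapE (dfun_linear f)).
abstract by move=> s; rewrite tau1_Tmap tau1_bdiff dfun_dd -tau1_Tmap
  (TmapE (dfun_linear f)).
Defined.

Program Definition underlying_functor : functor (underlying_obj und) :=
  @Functor (DAsCat K) (BinfCat K) (underlying_obj und)
    (fun V W f => underlying_hom f) _ _.
Next Obligation. by move=> V; exact: binf_hom_ext. Qed.
Next Obligation. by move=> U V W g f; exact: binf_hom_ext. Qed.

(** * The adjunction *)

Section Adjunction.
Variables (A : binfAlg K) (V : dAs K).

Section Restrict.
Variable h : dAs_hom (TcAlg A) V.
Let hl : linear h := dfun_linear h.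
Definition on_letters (x : A) : V := h (word [:: x]).

Lemma on_letters_linear : linear on_letters.
Proof. by move=> c x y; rewrite /on_letters (word_multilin [::] [::]) hl. Qed.

Lemma on_letters_degree : has_degree 0 on_letters.
Proof. by move=> n x xn; apply: (dfun_degree h); exact: homog_letter. Qed.

(** A homomorphism out of the tensor algebra is determined by its values on
    letters, words being [dodot]-products of letters. *)
Lemma tau1_on_letters a : tau1 (Tmap on_letters a) = h a.
Proof.
have ll := on_letters_linear.
move: a; apply: tensV_ext => [||s].
- exact: (linear_comp (@tau1_linear K V) (Tmap_linear ll)).
- exact: hl.
rewrite TmapE// tau1E; elim: s => [|x s IH] /=; first by rewrite -(dfun_one h).
rewrite IH -(dfun_odot h); congr (h _); exact: (concatE [:: x] s).
Qed.

Definition adj_right : binf_hom A (BinfAlg (und V)).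
Proof.
apply: (into_underlying on_letters_linear on_letters_degree) => [s t|s].
  abstract by rewrite tau1_on_letters -!(TmapE on_letters_linear)
    !tau1_on_letters; exact: (dfun_mul h).
abstract by rewrite tau1_on_letters -!(TmapE on_letters_linear)
  !tau1_on_letters; exact: (dfun_dd h).
Defined.

End Restrict.

Section Extend.
Variable g : binf_hom A (BinfAlg (und V)).
Let gl := bfun_linear g.

Definition adj_left : dAs_hom (TcAlg A) V.
Proof.
apply: (@DAsHom K (TcAlg A) V (fun a => tau1 (Tmap g a))).
- exact: (linear_comp (@tau1_linear K V) (Tmap_linear gl)).
- exact: (has_degree_comp0 (@tau1_degree K V) (Tmap_degree gl (bfun_degree g))).
- abstract by move=> a b; rewrite -[dmul a b]/(bmu A a b) binf_hom_bmu tau1_bmu.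
- abstract by move=> a b; rewrite -[dodot a b]/(concat a b) Tmap_concat tau1_concat.
- abstract by rewrite -[dunit _]/(word [::]) (TmapE gl) tau1E.
- abstract by move=> a; rewrite -[dd a]/(bdiff A a) binf_hom_bdiff tau1_bdiff.
Defined.

Lemma adj_leftE x : adj_left (word [:: x]) = g x.
Proof. by rewrite /= (TmapE gl) tau1E/= dodot1r. Qed.

End Extend.

Lemma adj_rightK : cancel adj_right adj_left.
Proof. by move=> h; apply: dAs_hom_ext => a; exact: tau1_on_letters. Qed.

Lemma adj_leftK : cancel adj_left adj_right.
Proof. by move=> g; apply: binf_hom_ext => x; exact: adj_leftE. Qed.

Lemma Tc_hom_ext (h h' : dAs_hom (TcAlg A) V) :
  (forall x, h (word [:: x]) = h' (word [:: x])) -> h = h'.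
Proof.
by move=> hh; rewrite -(adj_rightK h) -(adj_rightK h'); congr adj_left;
  apply: binf_hom_ext.
Qed.

End Adjunction.

Lemma Tc_left_adjoint : left_adjoint (Tc_functor K) underlying_functor.
Proof.
exists (fun A V h => @adj_right A V h); split=> [A V|A A' V V' f h g].
  by exists (@adj_left A V); [exact: adj_rightK|exact: adj_leftK].
apply: binf_hom_ext => x /=.
by rewrite /on_letters/= (TmapE (bfun_linear f)).
Qed.

End UnderlyingFunctor.

(** * Free 2-associative differential algebras *)

Section GradedSupport.
Variable K : fieldType.

Lemma gpr_degree (U V : grVect K) k (f : U -> V) n x :
  linear f -> has_degree k f -> gpr (n + k) (f x) = f (gpr n x).
Proof.
move=> fl fk.
have lhs : linear (fun x => gpr (n + k) (f x)).
  exact: (linear_comp (@gpr_linear K V _) fl).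
have rhs : linear (fun x => f (gpr n x)) by exact: (linear_comp fl (@gpr_linear K U _)).
apply/eqP; apply: (homog_ind (linear_eq0_submod lhs rhs)) => m {}x xm.
rewrite unfold_in (homog_gpr _ xm) (homog_gpr _ (fk _ _ xm)) (inj_eq (addIr k)).
by apply/eqP; case: ifP => // _; rewrite (linear0E fl).
Qed.

Lemma dAs_hom_gpr (V W : dAs K) (h : dAs_hom V W) n x :
  h (gpr n x) = gpr n (h x).
Proof.
by rewrite -{2}[n]addr0 (gpr_degree _ _ (dfun_linear h) (dfun_degree h)).
Qed.

Lemma gpr_partial_sum (V : grVect K) (s t : seq int) (x : V) :
  (forall n, n \notin s -> gpr n x = 0) -> uniq t -> {subset s <= t} ->
  x = \sum_(n <- t) gpr n x.
Proof.
move=> xs ut st; rewrite -{1}(gpr_sum x); apply: fsbig_uniq => // n nt.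
by apply: xs; apply: contra nt; exact: st.
Qed.

Lemma gpr_bilin (U V W : grVect K) (m : U -> V -> W) (s t : seq int) x y :
  bilin m ->
  (forall i j a b, homog i a -> homog j b -> homog (i + j) (m a b)) ->
  (forall n, n \notin s -> gpr n x = 0) -> (forall n, n \notin t -> gpr n y = 0) ->
  forall n, n \notin [seq i + j | i <- s, j <- t] -> gpr n (m x y) = 0.
Proof.
move=> mb mh xs yt n nst.
have us : {subset s <= undup s} by move=> i; rewrite mem_undup.
have ut : {subset t <= undup t} by move=> i; rewrite mem_undup.
rewrite (gpr_partial_sum xs (undup_uniq s) us).
rewrite (gpr_partial_sum yt (undup_uniq t) ut).
rewrite (linear_sumE (mb.1 _)) (linear_sumE (@gpr_linear K W n)).
rewrite big1_seq// => i /andP[_]; rewrite mem_undup => si.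
rewrite (linear_sumE (mb.2 _)) (linear_sumE (@gpr_linear K W n)).
rewrite big1_seq// => j /andP[_]; rewrite mem_undup => tj.
rewrite (homog_gpr _ (mh _ _ _ _ (gpr_homog _ _) (gpr_homog _ _))).
case: eqP => // nij; case/negP: nst; apply/allpairsP.
by exists (i, j).
Qed.

End GradedSupport.

Section Terms.
Variables (K : fieldType) (X : grVect K).

(** The projections [TPr] to homogeneous components are operations like the
    others; the grading of the free algebra is read off from them. *)
Inductive term :=
| TVar of X
| TZero
| TAdd of term & term
| TScale of K & term
| TOne
| TMul of term & term
| TOdot of term & term
| TDiff of term
| TPr of int & term.

Fixpoint eval (V : dAs K) (g : X -> V) (t : term) : V :=
  match t with
  | TVar x => g x
  | TZero => 0
  | TAdd t u => eval g t + eval g u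
  | TScale a t => a *: eval g t
  | TOne => dunit V
  | TMul t u => dmul (eval g t) (eval g u)
  | TOdot t u => dodot (eval g t) (eval g u)
  | TDiff t => dd (eval g t)
  | TPr n t => gpr n (eval g t)
  end.

HB.instance Definition _ := gen_eqMixin term.
HB.instance Definition _ := gen_choiceMixin term.

(** Two terms are identified when all 2-associative differential algebras
    identify them. Every identity between the operations then holds in the
    quotient because it holds in each of these algebras. *)
Definition term_eq (t u : term) : bool := `[< forall (V : dAs K) (g : X -> V),
  linear g -> has_degree 0 g -> eval g t = eval g u >].

Fact term_eq_refl : reflexive term_eq.
Proof. by move=> t; apply/asboolP. Qed.

Fact term_eq_sym : symmetric term_eq.
Proof.
by move=> t u; apply/asboolP/asboolP => tu V g gl g0; rewrite tu.
Qed.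

Fact term_eq_trans : transitive term_eq.
Proof.
move=> u t v /asboolP tu /asboolP uv; apply/asboolP => V g gl g0.
by rewrite tu// uv.
Qed.

Canonical term_equiv := EquivRel term_eq term_eq_refl term_eq_sym term_eq_trans.

Definition fterm := {eq_quot term_equiv}%qT.
HB.instance Definition _ := Choice.on fterm.
HB.instance Definition _ := Quotient.on fterm.
HB.instance Definition _ := EqQuotient.on fterm.

Definition cls (t : term) : fterm := (\pi_fterm t)%qT.

Definition feval (V : dAs K) (g : X -> V) (q : fterm) : V := eval g (repr q).

(** The quotient embeds into the algebras in which terms are evaluated; all
    axioms below are pulled back along [feval]. *)
Lemma feval_ext (q r : fterm) :
  (forall (V : dAs K) (g : X -> V), linear g -> has_degree 0 g ->
     feval g q = feval g r) -> q = r.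
Proof.
move=> qr; rewrite -(reprK q) -(reprK r); apply/eqmodP; apply/asboolP.
exact: qr.
Qed.

Lemma feval_cls (V : dAs K) (g : X -> V) t : linear g -> has_degree 0 g ->
  feval g (cls t) = eval g t.
Proof.
move=> gl g0; have /eqmodP/asboolP : (repr (cls t) = t %[mod fterm])%qT.
  by rewrite reprK.
exact.
Qed.

Definition fzero : fterm := cls TZero.
Definition fadd (q r : fterm) : fterm := cls (TAdd (repr q) (repr r)).
Definition fscale (a : K) (q : fterm) : fterm := cls (TScale a (repr q)).
Definition fopp (q : fterm) : fterm := fscale (-1) q.
Definition fone : fterm := cls TOne.
Definition fmul (q r : fterm) : fterm := cls (TMul (repr q) (repr r)).
Definition fodot (q r : fterm) : fterm := cls (TOdot (repr q) (repr r)).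
Definition fdiff (q : fterm) : fterm := cls (TDiff (repr q)).
Definition fpr (n : int) (q : fterm) : fterm := cls (TPr n (repr q)).
Definition fvar (x : X) : fterm := cls (TVar x).

Section FEval.
Variables (V : dAs K) (g : X -> V).
Hypotheses (gl : linear g) (g0 : has_degree 0 g).

Lemma feval0 : feval g fzero = 0. Proof. exact: feval_cls. Qed.
Lemma fevalD q r : feval g (fadd q r) = feval g q + feval g r.
Proof. exact: feval_cls. Qed.
Lemma fevalZ a q : feval g (fscale a q) = a *: feval g q.
Proof. exact: feval_cls. Qed.
Lemma fevalN q : feval g (fopp q) = - feval g q.
Proof. by rewrite fevalZ scaleN1r. Qed.
Lemma feval1 : feval g fone = dunit V. Proof. exact: feval_cls. Qed.
Lemma fevalM q r : feval g (fmul q r) = dmul (feval g q) (feval g r).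
Proof. exact: feval_cls. Qed.
Lemma fevalO q r : feval g (fodot q r) = dodot (feval g q) (feval g r).
Proof. exact: feval_cls. Qed.
Lemma feval_dd q : feval g (fdiff q) = dd (feval g q).
Proof. exact: feval_cls. Qed.
Lemma feval_pr n q : feval g (fpr n q) = gpr n (feval g q).
Proof. exact: feval_cls. Qed.
Lemma feval_var x : feval g (fvar x) = g x.
Proof. exact: feval_cls. Qed.

Definition fevalE := (feval0, fevalD, fevalN, fevalZ, feval1, fevalM, fevalO,
  feval_dd, feval_pr, feval_var).

End FEval.

Fact faddA : associative fadd.
Proof. by move=> p q r; apply: feval_ext => V g gl g0; rewrite !fevalE ?addrA. Qed.
Fact faddC : commutative fadd.
Proof.
by move=> q r; apply: feval_ext => V g gl g0; rewrite !fevalE ?(addrC (feval g q)).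
Qed.
Fact fadd0 : left_id fzero fadd.
Proof. by move=> q; apply: feval_ext => V g gl g0; rewrite !fevalE ?add0r. Qed.
Fact faddN : left_inverse fzero fopp fadd.
Proof. by move=> q; apply: feval_ext => V g gl g0; rewrite !fevalE ?addNr. Qed.

HB.instance Definition _ := GRing.isZmodule.Build fterm faddA faddC fadd0 faddN.

Fact fscaleA a b q : fscale a (fscale b q) = fscale (a * b) q.
Proof. by apply: feval_ext => V g gl g0; rewrite !fevalE ?scalerA. Qed.
Fact fscale1 : left_id 1 fscale.
Proof. by move=> q; apply: feval_ext => V g gl g0; rewrite !fevalE ?scale1r. Qed.
Fact fscaleDr : right_distributive fscale +%R.
Proof.
by move=> a q r; apply: feval_ext => V g gl g0; rewrite !fevalE ?scalerDr.
Qed.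
Fact fscaleDl q : {morph fscale^~ q : a b / a + b}.
Proof.
by move=> a b; apply: feval_ext => V g gl g0; rewrite !fevalE ?scalerDl.
Qed.

HB.instance Definition _ := GRing.Zmodule_isLmodule.Build K fterm
  fscaleA fscale1 fscaleDr fscaleDl.

Lemma feval_linear (V : dAs K) (g : X -> V) : linear g -> has_degree 0 g ->
  linear (feval g : fterm -> V).
Proof. by move=> gl g0 a q r; rewrite -[a *: q + r]/(fadd (fscale a q) r) !fevalE. Qed.

Lemma fterm_linear (U : lmodType K) (f : U -> fterm) :
  (forall (V : dAs K) (g : X -> V), linear g -> has_degree 0 g ->
     linear (fun x => feval g (f x))) -> linear f.
Proof.
move=> fl a x y; apply: feval_ext => V g gl g0.
by rewrite fl// (feval_linear gl g0).
Qed.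

Fact fpr_linear n : linear (fpr n).
Proof.
apply: fterm_linear => V g gl g0 a x y; rewrite !feval_pr//.
by rewrite (feval_linear gl g0) gpr_linear.
Qed.

Fact fpr_fpr m n q : fpr m (fpr n q) = if m == n then fpr n q else 0.
Proof.
apply: feval_ext => V g gl g0; rewrite !fevalE// gpr_gpr.
by case: ifP => _; rewrite ?fevalE// (linear0E (feval_linear gl g0)).
Qed.

(** The support can be chosen independently of the evaluation, as evaluating
    variables preserves degrees; hence elements of the quotient have finitely
    many components. *)
Lemma term_support (t : term) : exists s : seq int,
  forall (V : dAs K) (g : X -> V), linear g -> has_degree 0 g ->
  forall n, n \notin s -> gpr n (eval g t) = 0.
Proof.
elim: t => [x||t [s st] u [r ru]|a t [s st]||t [s st] u [r ru]|t [s st] u [r ru]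
  |t [s st]|k t [s st]].
- have [s xs] := gpr_supp x; exists s => V g gl g0 n /xs nx /=.
  by rewrite -[n]addr0 gpr_degree// nx linear0E.
- by exists [::] => V g _ _ n _; rewrite (linear0E (@gpr_linear K V n)).
- exists (s ++ r) => V g gl g0 n; rewrite mem_cat negb_or => /andP[ns nr] /=.
  by rewrite (linD _ _ (@gpr_linear K V n)) st// ru// addr0.
- exists s => V g gl g0 n ns /=.
  by rewrite (linZ _ _ (@gpr_linear K V n)) st// scaler0.
- exists [:: 0] => V g _ _ n; rewrite inE /= => n0.
  by rewrite (homog_gpr _ (dunit_degree V)) (negbTE n0).
- exists [seq i + j | i <- s, j <- r] => V g gl g0.
  by apply: (gpr_bilin (dmul_bilin V) (@dmul_degree K V)); [exact: st|exact: ru].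
- exists [seq i + j | i <- s, j <- r] => V g gl g0.
  by apply: (gpr_bilin (dodot_bilin V) (@dodot_degree K V)); [exact: st|exact: ru].
- exists [seq i - 1 | i <- s] => V g gl g0 n ns /=.
  rewrite -[n](subrK (-1)) opprK (gpr_degree _ _ (@dd_linear K V) (@dd_degree K V)).
  rewrite st ?(linear0E (@dd_linear K V))//; apply: contra ns => ns.
  by apply/mapP; exists (n + 1); rewrite ?addrK.
exists [:: k] => V g _ _ n; rewrite inE /= gpr_gpr => /negbTE ->.
by [].
Qed.

Fact fpr_sum q : exists s : seq int, forall t : seq int,
  uniq t -> {subset s <= t} -> q = \sum_(n <- t) fpr n q.
Proof.
have [s qs] := term_support (repr q); exists s => t ut st.
apply: feval_ext => V g gl g0.
rewrite (linear_sumE (feval_linear gl g0)).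
under eq_bigr do rewrite feval_pr//.
exact: gpr_partial_sum (qs V g gl g0) ut st.
Qed.

Definition fgr : grVect K := grVect_of fpr_linear fpr_fpr fpr_sum.

Lemma feval_homog (V : dAs K) (g : X -> V) n (q : fgr) :
  linear g -> has_degree 0 g -> homog n q -> homog n (feval g q).
Proof. by move=> gl g0 qn; rewrite /homog -feval_pr// [fpr n q]qn. Qed.

Lemma fgr_homog n (q : fgr) :
  (forall (V : dAs K) (g : X -> V), linear g -> has_degree 0 g ->
     homog n (feval g q)) -> homog n q.
Proof.
by move=> qn; apply: feval_ext => V g gl g0; rewrite feval_pr//; exact: qn.
Qed.

Program Definition fdAs : dAs K :=
  @DAs K fgr fmul fodot fone fdiff _ _ _ _ _ _ _ _ _ _ _ _ _ _ _.
Next Obligation.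
split=> [r|q]; apply: fterm_linear => V g gl g0 a x y; rewrite !fevalM//
  (feval_linear gl g0); have [ml mr] := dmul_bilin V; by rewrite ?ml ?mr.
Qed.
Next Obligation.
move=> i j a b ai bj; apply: fgr_homog => V g gl g0; rewrite fevalM//.
by apply: dmul_degree; exact: feval_homog.
Qed.
Next Obligation.
by move=> p q r; apply: feval_ext => V g gl g0; rewrite !fevalM// dmulA.
Qed.
Next Obligation.
by move=> q; apply: feval_ext => V g gl g0; rewrite fevalM// feval1// dmul1l.
Qed.
Next Obligation.
by move=> q; apply: feval_ext => V g gl g0; rewrite fevalM// feval1// dmul1r.
Qed.
Next Obligation.
split=> [r|q]; apply: fterm_linear => V g gl g0 a x y; rewrite !fevalO//
  (feval_linear gl g0); have [ol or] := dodot_bilin V; by rewrite ?ol ?or.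
Qed.
Next Obligation.
move=> i j a b ai bj; apply: fgr_homog => V g gl g0; rewrite fevalO//.
by apply: dodot_degree; exact: feval_homog.
Qed.
Next Obligation.
by move=> p q r; apply: feval_ext => V g gl g0; rewrite !fevalO// dodotA.
Qed.
Next Obligation.
by move=> q; apply: feval_ext => V g gl g0; rewrite fevalO// feval1// dodot1l.
Qed.
Next Obligation.
by move=> q; apply: feval_ext => V g gl g0; rewrite fevalO// feval1// dodot1r.
Qed.
Next Obligation.
by apply: fgr_homog => V g gl g0; rewrite feval1//; exact: dunit_degree.
Qed.
Next Obligation.
apply: fterm_linear => V g gl g0 a x y; rewrite !feval_dd//.
by rewrite (feval_linear gl g0) dd_linear.
Qed.
Next Obligation.
move=> n q qn; apply: fgr_homog => V g gl g0; rewrite feval_dd//.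
by apply: dd_degree; exact: feval_homog.
Qed.
Next Obligation.
move=> q; apply: feval_ext => V g gl g0; rewrite !feval_dd// dd2.
by rewrite (linear0E (feval_linear gl g0)).
Qed.
Next Obligation.
move=> i a b ai; apply: feval_ext => V g gl g0.
have el := feval_linear gl g0.
rewrite (linD _ _ el) (linZ _ _ el) !(feval_dd, fevalM)//.
by apply: dd_mul; exact: feval_homog.
Qed.

Lemma fvar_linear : linear (fvar : X -> fdAs).
Proof.
by apply: fterm_linear => V g gl g0 a x y; rewrite !feval_var// gl.
Qed.

Lemma fvar_degree : has_degree 0 (fvar : X -> fdAs).
Proof.
move=> n x xn; apply: fgr_homog => V g gl g0; rewrite feval_var//.
exact: g0.
Qed.

Section Universal.
Variables (V : dAs K) (g : X -> V).
Hypotheses (gl : linear g) (g0 : has_degree 0 g).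

Definition feval_hom : dAs_hom fdAs V :=
  @DAsHom K fdAs V (feval g) (feval_linear gl g0)
    (fun n q => eq_rect_r (fun k => homog n q -> homog k _)
       (@feval_homog V g n q gl g0) (addr0 n))
    (fevalM gl g0) (fevalO gl g0) (feval1 gl g0) (feval_dd gl g0).

Lemma feval_hom_unique (h : dAs_hom fdAs V) :
  (forall x, h (fvar x) = g x) -> forall q, h q = feval g q.
Proof.
move=> hx q; rewrite -[q]reprK -/(cls _) feval_cls//.
have hl := dfun_linear h.
have clsE (t : term) (q' : fterm) :
    (forall (W : dAs K) (k : X -> W), linear k -> has_degree 0 k ->
       eval k t = feval k q') -> cls t = q'.
  by move=> tq; apply: feval_ext => W k kl k0; rewrite feval_cls// tq.
elim: (repr q) => [x||t IHt u IHu|a t IHt||t IHt u IHu|t IHt u IHu|t IHt|n t IHt] /=.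
- exact: hx.
- exact: (linear0E hl).
- rewrite -IHt -IHu -(linD _ _ hl); congr (h _); apply: clsE => W k kl k0.
  by rewrite fevalD// !feval_cls.
- rewrite -IHt -(linZ _ _ hl); congr (h _); apply: clsE => W k kl k0.
  by rewrite fevalZ// !feval_cls.
- exact: (dfun_one h).
- rewrite -IHt -IHu -(dfun_mul h); congr (h _); apply: clsE => W k kl k0.
  by rewrite fevalM// !feval_cls.
- rewrite -IHt -IHu -(dfun_odot h); congr (h _); apply: clsE => W k kl k0.
  by rewrite fevalO// !feval_cls.
- rewrite -IHt -(dfun_dd h); congr (h _); apply: clsE => W k kl k0.
  by rewrite feval_dd// !feval_cls.
- rewrite -IHt -dAs_hom_gpr; congr (h _); apply: clsE => W k kl k0.
  by rewrite feval_pr// !feval_cls.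
Qed.

End Universal.

Lemma free_dAs_exists : inhabited (free_dAs X).
Proof.
constructor; apply: (FreeDAs fvar_linear fvar_degree) => V g gl g0.
exists (feval_hom gl g0); split=> [x|h hx]; first exact: feval_var.
by apply: dAs_hom_ext => q; rewrite (feval_hom_unique gl g0 hx).
Qed.

End Terms.

(** * Quotients and the universal enveloping algebra *)

Section Quotient.
Variables (K : fieldType) (V : dAs K) (rel : V -> Prop).

Let Q := quotDAs rel.

Program Definition quot_pi : dAs_hom V Q :=
  @DAsHom K V Q (quotDAs_pi rel) (@qpi_linear _ _ _) _ _ _ erefl _.
Next Obligation. by move=> n x xn; rewrite addr0 /homog/= qprE xn. Qed.
Next Obligation. by move=> x y; exact/esym/qmulE. Qed.
Next Obligation. by move=> x y; exact/esym/qodotE. Qed.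
Next Obligation. by move=> x; exact/esym/qddE. Qed.

Lemma quot_piK (q : Q) : quot_pi (qrepr q) = q.
Proof. exact: qreprK. Qed.

Lemma quot_pi_rel x y : rel (x - y) -> quot_pi x = quot_pi y.
Proof. by move=> xy; apply/qpiE/mem_span/IdealRel. Qed.

Section Factor.
Variables (W : dAs K) (h : dAs_hom V W).
Hypothesis hrel : forall x, rel x -> h x = 0.
Let hl := dfun_linear h.

Lemma ideal_gen_ker x : ideal_gen rel x -> h x = 0.
Proof.
have mb := dmul_bilin W; have ob := dodot_bilin W.
elim=> {x} [x|| c x y _ hx _ hy|n x _ hx|x _ hx|a x _ hx|a x _ hx|a x _ hx|a x _ hx].
- exact: hrel.
- exact: (linear0E hl).
- by rewrite hl hx hy scaler0 addr0.
- by rewrite dAs_hom_gpr hx (linear0E (@gpr_linear K W n)).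
- by rewrite dfun_dd hx (linear0E (@dd_linear K W)).
- by rewrite dfun_mul hx (bilin0r _ mb).
- by rewrite dfun_mul hx (bilin0l _ mb).
- by rewrite dfun_odot hx (bilin0r _ ob).
- by rewrite dfun_odot hx (bilin0l _ ob).
Qed.

Definition quot_factor (q : Q) : W := h (qrepr q).

Lemma quot_factorE x : quot_factor (quot_pi x) = h x.
Proof.
apply/eqP; rewrite eq_sym -subr_eq0 -(linB _ _ hl); apply/eqP/ideal_gen_ker.
by apply/span_idealE; exact: qpi_repr.
Qed.

Let pil := dfun_linear quot_pi.

Program Definition quot_factor_hom : dAs_hom Q W :=
  @DAsHom K Q W quot_factor _ _ _ _ _ _.
Next Obligation.
move=> c q r; rewrite -(quot_piK q) -(quot_piK r) -pil.
by rewrite !quot_factorE hl.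
Qed.
Next Obligation.
move=> n q qn; rewrite -qn -(quot_piK q).
have -> : gpr n (quot_pi (qrepr q)) = quot_pi (gpr n (qrepr q)) by exact: qprE.
by rewrite quot_factorE; apply: (dfun_degree h); exact: gpr_homog.
Qed.
Next Obligation.
move=> q r; rewrite -(quot_piK q) -(quot_piK r) -dfun_mul.
by rewrite !quot_factorE dfun_mul.
Qed.
Next Obligation.
move=> q r; rewrite -(quot_piK q) -(quot_piK r) -dfun_odot.
by rewrite !quot_factorE dfun_odot.
Qed.
Next Obligation. by rewrite -(dfun_one quot_pi) quot_factorE dfun_one. Qed.
Next Obligation.
by move=> q; rewrite -(quot_piK q) -dfun_dd !quot_factorE dfun_dd.
Qed.

End Factor.

Lemma quot_hom_ext (W : dAs K) (h h' : dAs_hom Q W) :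
  dAs_comp h quot_pi = dAs_comp h' quot_pi -> h = h'.
Proof.
move=> hh; apply: dAs_hom_ext => q; rewrite -(quot_piK q).
exact: (congr1 (fun k : dAs_hom V W => k (qrepr q)) hh).
Qed.

End Quotient.

Lemma free_hom_ext (K : fieldType) (X : grVect K) (F : free_dAs X) (V : dAs K)
    (h h' : dAs_hom F V) :
  (forall x, h (falpha F x) = h' (falpha F x)) -> h = h'.
Proof.
move=> hh; have al := @falpha_linear K X F; have a0 := @falpha_degree K X F.
have gl := linear_comp (dfun_linear h) al.
have g0 := has_degree_comp0 (dfun_degree h) a0.
have [k [_ kU]] := falpha_univ F (gl : linear (h \o falpha F)) g0.
by rewrite -(kU h)// -(kU h')// => x /=; rewrite hh.
Qed.

Section Enveloping.
Variables (K : fieldType) (und : forall V : dAs K, binf V).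
Hypothesis undP : forall V, underlying_structure (und V).
Variable F : forall X : grVect K, free_dAs X.

Section Universal.
Variable A : binfAlg K.

Let S := und (F A).
Let E : dAs K := env (F A) S.
Let pi : dAs_hom (F A) E := quot_pi (env_rel S).
Let al : linear (@falpha K A (F A)) := @falpha_linear K A (F A).

Lemma env_map_linear : linear (env_map (F A) S).
Proof. exact: (linear_comp (dfun_linear pi) al). Qed.

Lemma env_map_degree : has_degree 0 (env_map (F A) S : A -> E).
Proof.
exact: (has_degree_comp0 (dfun_degree pi) (@falpha_degree K A (F A))).
Qed.

(** The relations defining the enveloping algebra say exactly that the canonical
    map is a homomorphism to the underlying algebra. *)
Definition env_unit : binf_hom A (BinfAlg (und E)).
Proof.
apply: (@BinfHom K A (BinfAlg (und E)) (env_map (F A) S) env_map_linear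
  env_map_degree).
  abstract (move=> n c n0 cn; rewrite /env_map;
    rewrite [LHS](quot_pi_rel (EnvM S n0 cn));
    rewrite [LHS](bfun_m (underlying_hom undP pi) n0 (Tmap_tpow al cn));
    by rewrite -(Tmap_comp c (dfun_linear pi) al)).
abstract (move=> i j a b i0 j0 ai bj; rewrite /env_map;
  rewrite [LHS](quot_pi_rel (EnvMM S i0 j0 ai bj));
  rewrite [LHS](bfun_mm (underlying_hom undP pi) i0 j0 (Tmap_tpow al ai) (Tmap_tpow al bj));
  by rewrite -(Tmap_comp a (dfun_linear pi) al) -(Tmap_comp b (dfun_linear pi) al)).
Defined.

Lemma env_hom_ext (V : dAs K) (h h' : dAs_hom E V) :
  (forall x, h (env_map (F A) S x) = h' (env_map (F A) S x)) -> h = h'.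
Proof.
by move=> hh; apply: quot_hom_ext; apply: free_hom_ext.
Qed.

(** The extension of [g] to the free algebra kills the defining relations because
    it is also a homomorphism of the underlying B-infinity algebras. *)
Lemma env_extend (V : dAs K) (g : binf_hom A (BinfAlg (und V))) :
  exists h : dAs_hom E V, forall x, h (env_map (F A) S x) = g x.
Proof.
have gl := bfun_linear g.
have [h0 [h0a _]] := falpha_univ (F A) (bfun_linear g) (bfun_degree g).
have h0l := dfun_linear h0.
have Th0 c : Tmap h0 (Tmap (falpha (F A)) c) = Tmap g c.
  rewrite -(Tmap_comp c h0l al); congr (Tmap _ c).
  by apply/funext => x; exact: h0a.
have ker x : env_rel S x -> h0 x = 0.
  case=> [i j a b i0 j0 ai bj|n c n0 cn]; rewrite (linB _ _ h0l) h0a.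
    rewrite (bfun_mm g i0 j0 ai bj).
    have := bfun_mm (underlying_hom undP h0) i0 j0 (Tmap_tpow al ai) (Tmap_tpow al bj).
    by move=> /= ->; rewrite !Th0 subrr.
  rewrite (bfun_m g n0 cn).
  have := bfun_m (underlying_hom undP h0) n0 (Tmap_tpow al cn).
  by move=> /= ->; rewrite !Th0 subrr.
by exists (quot_factor_hom ker) => x; rewrite -h0a; exact: quot_factorE.
Qed.

Definition env_lift (V : dAs K) (g : binf_hom A (BinfAlg (und V))) :
  dAs_hom E V := projT1 (cid (env_extend g)).

Lemma env_liftE (V : dAs K) (g : binf_hom A (BinfAlg (und V))) x :
  env_lift g (env_map (F A) S x) = g x.
Proof. exact: (projT2 (cid (env_extend g))). Qed.

End Universal.

Definition env_hom (A B : binfAlg K) (f : binf_hom A B) :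
    dAs_hom (env (F A) (und (F A))) (env (F B) (und (F B))) :=
  env_lift (binf_comp (env_unit B) f).

Lemma env_homE A B (f : binf_hom A B) x :
  env_hom f (env_map (F A) (und (F A)) x) = env_map (F B) (und (F B)) (f x).
Proof. by rewrite /env_hom env_liftE. Qed.

Program Definition env_functor : functor (env_obj und F) :=
  @Functor (BinfCat K) (DAsCat K) (env_obj und F) (fun A B f => env_hom f) _ _.
Next Obligation. by move=> A; apply: env_hom_ext => x; exact: env_homE. Qed.
Next Obligation.
move=> A B C g f; apply: env_hom_ext => x.
by rewrite env_homE /= !env_homE.
Qed.

(** Both algebras represent homomorphisms from [A] to underlying algebras, the
    letters of [T^c(A)] corresponding to the canonical image of [A] in [U(A)]. *)
Lemma Tc_env_isomorphic : naturally_isomorphic (Tc_functor K) env_functor.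
Proof.
have [eta etaE] : exists eta : forall A : binfAlg K,
    dAs_hom (TcAlg A) (env (F A) (und (F A))),
    forall A x, eta A (word [:: x]) = env_map (F A) (und (F A)) x.
  by exists (fun A => adj_left undP (env_unit A)) => A x; exact: adj_leftE.
exists eta; split=> [A|A B f].
  exists (env_lift (adj_right undP (dAs_id (TcAlg A)))); split.
    apply: (Tc_hom_ext undP) => x; rewrite /= etaE.
    by rewrite [LHS]env_liftE.
  apply: env_hom_ext => x; rewrite /= env_liftE; exact: etaE.
apply: (Tc_hom_ext undP) => x.
rewrite [LHS]/= (TmapE (bfun_linear f)) etaE.
by rewrite [RHS]/= etaE env_homE.
Qed.

End Enveloping.

Theorem proposition3p2p1 (K : fieldType) :
  [/\ forall V : dAs K, exists! S : binf V, underlying_structure S,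
      forall X : grVect K, inhabited (free_dAs X)
    & forall und : (forall V : dAs K, binf V),
      (forall V : dAs K, underlying_structure (und V)) ->
      forall F : (forall X : grVect K, free_dAs X),
      exists (R : functor (underlying_obj und)) (L : functor (@Tc_obj K))
             (U : functor (env_obj und F)),
        [/\ forall (V W : dAs K) (f : dAs_hom V W) (x : V),
              (fmap R f : binf_hom _ _) x = f x,
            forall (A B : binfAlg K) (f : binf_hom A B) (a : Tc A),
              (fmap L f : dAs_hom _ _) a = Tmap f a,
            forall (A B : binfAlg K) (f : binf_hom A B) (x : A),
              (fmap U f : dAs_hom _ _) (env_map (F A) (und (F A)) x) =
              env_map (F B) (und (F B)) (f x),
            left_adjoint L R
          & naturally_isomorphic L U]].
Proof.
split=> [V|X|und undP F]; first exact: underlying_exists_unique.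
  exact: free_dAs_exists.
exists (underlying_functor undP), (Tc_functor K), (env_functor undP F).
split=> // [A B f x||]; first exact: env_homE.
  exact: Tc_left_adjoint.
exact: Tc_env_isomorphic.
Qed.
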